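(* Let $\Sigma$ be a rational fan (not necessarily complete) and let $X_\Sigma$ be the associated complex toric variety with its action of the compact torus $T$. If $\Sigma$ is complete, then $X_\Sigma$ is a (necessarily finite) $T$-CW complex. In general, $X_\Sigma$ has the $T$-equivariant homotopy type of a finite $T$-CW complex.
   Context: $T\cong (S^1)^n$ is a compact torus with Lie algebra $\mathfrak t\cong\mathbb R^n$; $N\subset\mathfrak t$ is the lattice of one-parameter subgroups of $T$, so $\mathfrak t=N_{\mathbb R}=N\otimes\mathbb R$, and $M=N^\vee$. A rational fan $\Sigma$ in $\mathfrak t$ is a finite non-empty collection of strongly convex polyhedral cones, rational with respect to $N$, closed under taking faces and such that any two cones meet in a common face; it is complete if its cones cover $\mathfrak t$. $X_\Sigma$ is the usual complex toric variety of $\Sigma$ with its metric (classical) topology; $T=\mathrm{Hom}(M,S^1)$ acts on it as the compact subgroup of the algebraic torus $\mathrm{Hom}(M,\mathbb C^* )$. A $T$-CW complex is an equivariant CW complex in the usual sense, built from equivariant cells of the form $(T/H)\times D^m$ with $H\subset T$ a closed subgroup; it is finite if it has finitely many equivariant cells. *)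

(* Defs.v *)
From HB Require Import structures.
From Stdlib Require Import Relation_Operators.
From mathcomp Require Import all_boot all_order all_algebra generic_quotient.
From mathcomp Require Import complex.
From mathcomp Require Import all_classical all_reals all_analysis.

Set Implicit Arguments.
Unset Strict Implicit.
Unset Printing Implicit Defensive.

Import Order.TTheory GRing.Theory Num.Theory.
Import numFieldNormedType.Exports.

Local Open Scope classical_set_scope.
Local Open Scope ring_scope.
Local Open Scope quotient_scope.

(* The quotient space by the equivalence relation generated by [r]. *)
Section Gluing.
Context {Z : topologicalType} (r : Z -> Z -> Prop).

Definition gluing_eq (x y : Z) : bool := `[< clos_refl_sym_trans Z r x y >].

Lemma gluing_eq_refl : reflexive gluing_eq.
Proof. by move=> x; apply/asboolP; exact: rst_refl. Qed.

Lemma gluing_eq_sym : symmetric gluing_eq.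
Proof.
by move=> x y; apply/asboolP/asboolP => xy; exact: rst_sym.
Qed.

Lemma gluing_eq_trans : transitive gluing_eq.
Proof.
move=> y x z /asboolP xy /asboolP yz; apply/asboolP; exact: rst_trans xy yz.
Qed.

Definition gluing_equiv :=
  EquivRel gluing_eq gluing_eq_refl gluing_eq_sym gluing_eq_trans.

Definition gluing := {eq_quot gluing_equiv}.

HB.instance Definition _ := Topological.copy gluing (quotient_topology gluing).
HB.instance Definition _ := Quotient.on gluing.

End Gluing.
Arguments gluing {Z} r.

(* Coordinates are fixed so that N = M = Z^n with the standard pairing, and   *)
(* the Lie algebra of the torus is R^n; vectors are rows.                      *)

Section Fans.
Context {R : realType} {n : nat}.
Implicit Types (sigma tau : set 'rV[R]_n) (Sigma : set (set 'rV[R]_n)).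

Definition pairing (w u : 'rV[R]_n) : R := \sum_i w 0 i * u 0 i.

Definition lattice_vec (m : 'rV[int]_n) : 'rV[R]_n := map_mx intr m.

Definition rational_polyhedral_cone sigma :=
  exists (k : nat) (v : 'I_k -> 'rV[int]_n),
    sigma = [set u | exists c : 'I_k -> R,
      (forall i, 0 <= c i) /\ u = \sum_i c i *: lattice_vec (v i)].

Definition strongly_convex sigma :=
  forall u, sigma u -> sigma (- u) -> u = 0.

Definition is_face tau sigma :=
  exists w : 'rV[R]_n, (forall u, sigma u -> 0 <= pairing w u) /\
    tau = sigma `&` [set u | pairing w u = 0].

Record rational_fan Sigma : Prop := RationalFan {
  fan_finite : finite_set Sigma;
  fan_nonempty : Sigma !=set0;
  fan_rational : forall sigma, Sigma sigma -> rational_polyhedral_cone sigma;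
  fan_strongly_convex : forall sigma, Sigma sigma -> strongly_convex sigma;
  fan_face : forall sigma tau, Sigma sigma -> is_face tau sigma -> Sigma tau;
  fan_meet : forall sigma tau, Sigma sigma -> Sigma tau ->
    is_face (sigma `&` tau) sigma /\ is_face (sigma `&` tau) tau }.

Definition complete_fan Sigma := \bigcup_(sigma in Sigma) sigma = setT.

(* The semigroup of lattice points of the dual cone of sigma. *)
Definition dual_monoid sigma : set 'rV[int]_n :=
  [set m | forall u, sigma u -> 0 <= pairing (lattice_vec m) u].

End Fans.

(* T = Hom(M, S^1) with the topology of pointwise convergence. *)
Definition torus_points (R : realType) (n : nat) :
    set {ptws 'rV[int]_n -> R[i]^o} :=
  [set t | (forall m, `|t m| = 1) /\ (forall m m', t (m + m') = t m * t m')].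

Definition torus (R : realType) (n : nat) : Type :=
  set_type (@torus_points R n).

HB.instance Definition _ (R : realType) (n : nat) :=
  Topological.copy (torus R n) (set_type (@torus_points R n)).

Definition torus_eval (R : realType) (n : nat) (t : torus R n)
  (m : 'rV[int]_n) : R[i] := (\val t : {ptws _ -> _}) m.
Coercion torus_eval : torus >-> Funclass.

Section TorusGroup.
Context {R : realType} {n : nat}.
Implicit Types s t : torus R n.

Lemma torus_norm t m : `|t m| = 1.
Proof. by have [t1 _] := set_mem (valP t); exact: t1. Qed.

Lemma torusD t m m' : t (m + m') = t m * t m'.
Proof. by have [_ tM] := set_mem (valP t); exact: tM. Qed.

Lemma torus_neq0 t m : t m != 0.
Proof. by rewrite -normr_eq0 torus_norm oner_eq0. Qed.

Lemma torus_ext s t : (forall m, s m = t m) -> s = t.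
Proof. by move=> st; apply: val_inj; apply: funext => m; exact: st. Qed.

Lemma torus_one_subproof : torus_points (fun _ : 'rV[int]_n => 1 : R[i]).
Proof. by split=> [m|m m']; rewrite ?normr1 ?mulr1. Qed.
Definition torus_one : torus R n :=
  exist (fun f => f \in @torus_points R n) _ (mem_set torus_one_subproof).

Lemma torus_mul_subproof s t : torus_points (fun m => s m * t m).
Proof.
by split=> [m|m m']; rewrite ?normrM ?torus_norm ?mulr1// !torusD mulrACA.
Qed.
Definition torus_mul s t : torus R n :=
  exist (fun f => f \in @torus_points R n) _ (mem_set (torus_mul_subproof s t)).

Lemma torus_inv_subproof t : torus_points (fun m => (t m)^-1).
Proof.
by split=> [m|m m']; rewrite ?normfV ?torus_norm ?invr1// torusD invfM.
Qed.
Definition torus_inv t : torus R n :=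
  exist (fun f => f \in @torus_points R n) _ (mem_set (torus_inv_subproof t)).

Lemma torus_mulA : associative torus_mul.
Proof. by move=> r s t; apply: torus_ext => m; exact: mulrA. Qed.
Lemma torus_mul1 : left_id torus_one torus_mul.
Proof. by move=> t; apply: torus_ext => m; exact: mul1r. Qed.
Lemma torus_1mul : right_id torus_one torus_mul.
Proof. by move=> t; apply: torus_ext => m; exact: mulr1. Qed.
Lemma torus_mulV : left_inverse torus_one torus_inv torus_mul.
Proof.
by move=> t; apply: torus_ext => m; apply: mulVf; exact: torus_neq0.
Qed.
Lemma torus_Vmul : right_inverse torus_one torus_inv torus_mul.
Proof.
by move=> t; apply: torus_ext => m; apply: mulfV; exact: torus_neq0.
Qed.

End TorusGroup.

HB.instance Definition _ (R : realType) (n : nat) :=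
  isGroup.Build (torus R n) torus_mulA torus_mul1 torus_1mul
    torus_mulV torus_Vmul.

Section ToricVariety.
Context {R : realType} {n : nat}.
Implicit Types sigma tau : set 'rV[R]_n.

(* The complex points of U_sigma = Spec C[S], S the intersection of M with    *)
(* the dual cone: monoid homomorphisms from S to the multiplicative monoid C. *)
(* The classical topology on them is that of pointwise convergence.           *)
Definition affine_points sigma :
    set {ptws dual_monoid sigma -> R[i]^o} :=
  [set x | (forall a, \val a = 0 -> x a = 1) /\
           (forall a b c, \val c = \val a + \val b -> x c = x a * x b)].

Definition affine_toric sigma : Type := set_type (@affine_points sigma).

HB.instance Definition _ sigma :=
  Topological.copy (affine_toric sigma) (set_type (@affine_points sigma)).

Definition affine_eval sigma (x : affine_toric sigma)
  (a : dual_monoid sigma) : R[i] := (\val x : {ptws _ -> _}) a.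

Lemma affine_act_subproof sigma (t : torus R n) (x : affine_toric sigma) :
  @affine_points sigma (fun a => t (\val a) * affine_eval x a).
Proof.
have [x1 xM] := set_mem (valP x); split=> [a a0|a b c abc].
  have t1 : t 0 = 1.
    by apply: (mulfI (torus_neq0 t 0)); rewrite mulr1 -torusD addr0.
  by rewrite a0 t1 mul1r; exact: x1.
by rewrite abc torusD mulrACA; congr (_ * _); exact: xM.
Qed.

Definition affine_act sigma (t : torus R n) (x : affine_toric sigma) :
    affine_toric sigma :=
  exist (fun x => x \in @affine_points sigma) _ (mem_set (affine_act_subproof t x)).

Variable Sigma : set (set 'rV[R]_n).

Definition charts := {sigma : Sigma & affine_toric (\val sigma)}.
HB.instance Definition _ := Topological.on charts.

(* [glue_face x y]: x lies in U_tau for a face tau of sigma, and y is the     *)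
(* image of x under the inclusion of U_tau into U_sigma, that is, the          *)
(* restriction of x to the smaller monoid of sigma.                            *)
Definition glue_face (x y : charts) : Prop :=
  is_face (\val (projT1 x)) (\val (projT1 y)) /\
  forall a b, \val a = \val b ->
    affine_eval (projT2 x) a = affine_eval (projT2 y) b.

Definition toric_variety : topologicalType := gluing glue_face.

Definition charts_act (t : torus R n) (x : charts) : charts :=
  existT _ (projT1 x) (affine_act t (projT2 x)).

(* [charts_act t] is compatible with [glue_face], so that the choice of the   *)
(* representative is immaterial.                                               *)
Definition toric_act (t : torus R n) (x : toric_variety) : toric_variety :=
  \pi_(gluing glue_face) (charts_act t (repr (x : gluing glue_face))).

End ToricVariety.
Arguments toric_act {R n} Sigma t x.

Section TSpaces.
Context {R : realType} {n : nat}.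
Local Notation T := (torus R n).

Record is_action (X : topologicalType) (act : T -> X -> X) : Prop :=
  IsAction {
    act_one : forall x, act 1%g x = x;
    act_mul : forall s t x, act (s * t)%g x = act s (act t x);
    act_continuous : continuous (fun p : T * X => act p.1 p.2) }.

Definition equivariant (X Y : Type) (actX : T -> X -> X) (actY : T -> Y -> Y)
  (f : X -> Y) := forall t x, f (actX t x) = actY t (f x).

Definition unit_interval : topologicalType := set_type `[0 : R, 1].

Definition T_homotopic (X Y : topologicalType) (actX : T -> X -> X)
    (actY : T -> Y -> Y) (f g : X -> Y) :=
  exists H : X * unit_interval -> Y,
    [/\ continuous H,
        forall u, equivariant actX actY (fun x => H (x, u)),
        forall x u, \val u = 0 -> H (x, u) = f x &
        forall x u, \val u = 1 -> H (x, u) = g x].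

Definition T_homotopy_equivalent (X Y : topologicalType) (actX : T -> X -> X)
    (actY : T -> Y -> Y) :=
  [/\ is_action actX, is_action actY &
    exists (f : X -> Y) (g : Y -> X),
      [/\ continuous f /\ equivariant actX actY f,
          continuous g /\ equivariant actY actX g,
          T_homotopic actX actX (g \o f) id &
          T_homotopic actY actY (f \o g) id]].

Record closed_subgroup (H : set T) : Prop := ClosedSubgroup {
  subgroup_closed : closed H;
  subgroup_one : H 1%g;
  subgroup_mul : forall s t, H s -> H t -> H (s * t)%g;
  subgroup_inv : forall s, H s -> H s^-1%g }.

(* The orbit T/H: for a subgroup H, [same_coset H] is already an equivalence. *)
Definition same_coset (H : set T) (s t : T) : Prop := H (s^-1 * t)%g.
Definition orbit (H : set T) : topologicalType := gluing (same_coset H).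
Definition orbit_act (H : set T) (t : T) (a : orbit H) : orbit H :=
  \pi_(gluing (same_coset H)) (t * repr (a : gluing (same_coset H)))%g.

Definition sqnorm (k : nat) (v : 'rV[R]_k) : R := \sum_i v 0 i ^+ 2.
Definition disk (k : nat) : topologicalType :=
  set_type [set v : 'rV[R]_k | sqnorm v <= 1].
Definition in_sphere (k : nat) (v : disk k) := sqnorm (\val v) = 1.

Definition cell_type (H : set T) (k : nat) : topologicalType :=
  (orbit H * disk k)%type.

(* The subset A of X meets the subspace B in a closed subset of B. *)
Definition closed_in (X : topologicalType) (B A : set X) :=
  closed ((fun b : B => \val b) @^-1` A).

(* A T-CW structure on a T-space X: a filtration                              *)
(* set0 = X^(-1) <= X^0 <= X^1 <= .. of X, where X^k is obtained from X^(k-1) *)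
(* by attaching a family of cells T/H x D^k along T/H x S^(k-1), and X is the  *)
(* colimit of the X^k. Indices are shifted by one: [skeleton k] is X^(k-1).    *)
Record TCW_structure (X : topologicalType) (act : T -> X -> X) := TCWStructure {
  TCW_action : is_action act;
  cell : nat -> Type;
  stab : forall k, cell k -> set T;
  stab_subgroup : forall k (e : cell k), closed_subgroup (stab e);
  char_map : forall k (e : cell k), cell_type (stab e) k -> X;
  char_map_continuous : forall k (e : cell k), continuous (@char_map k e);
  char_map_equivariant : forall k (e : cell k) t a v,
    char_map (orbit_act t a, v : disk k) = act t (@char_map k e (a, v));
  skeleton : nat -> set X;
  skeleton0 : skeleton 0 = set0;
  skeletonS : forall k, skeleton k.+1 =
    skeleton k `|` \bigcup_(e in [set: cell k]) range (@char_map k e);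
  skeleton_bigcup : \bigcup_k skeleton k = setT;
  attach_boundary : forall k (e : cell k) p,
    in_sphere p.2 -> skeleton k (@char_map k e p);
  attach_interior : forall k (e : cell k) p,
    ~ in_sphere p.2 -> ~ skeleton k (@char_map k e p);
  attach_injective : forall k (e e' : cell k) p p',
    ~ in_sphere p.2 -> ~ in_sphere p'.2 ->
    @char_map k e p = @char_map k e' p' ->
    existT (fun e => cell_type (stab e) k : Type) e p = existT _ e' p';
  (* X^k carries the topology of the pushout *)
  skeleton_closed : forall k A,
    closed_in (skeleton k.+1) A <->
    closed_in (skeleton k) A /\
    forall e : cell k, closed (@char_map k e @^-1` A);
  (* X carries the topology of the colimit *)
  colimit_closed : forall A, closed A <-> forall k, closed_in (skeleton k) A }.

Definition finite_TCW (X : topologicalType) (act : T -> X -> X)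
  (S : TCW_structure act) := finite_set [set: {k : nat & cell S k}].

End TSpaces.

(* Main.v *)
(* A point x of the toric variety is recorded by the cone of its orbit and by  *)
(* a character of the lattice orthogonal to that cone, extended by 0.          *)
(*                                                                            *)
(* In general, weights Lam j, positive exactly on the charts, map X to the     *)
(* space Y of pairs (p, class of t) where p is a point of the cube [0,1]^J     *)
(* with some coordinate equal to 1 and t is taken modulo the stabilizer of the *)
(* intersection of the cones in the support of p; the second component of the  *)
(* map is the argument of x. The faces of the cube are the cells of Y. A       *)
(* homotopy inverse sends (p, t) to t times a limit of the one-parameter       *)
(* subgroups of interior vectors of the cones, and both composites are         *)
(* deformed to the identity by interpolating moduli and weights.               *)
(*                                                                            *)
(* If the fan is complete, fix a cone z and v_i in the relative interior of    *)
(* each cone i. Modulo the span of z, a vector is in a unique way a positive   *)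
(* combination of the v_i for a chain of cones i strictly above z. Hence the   *)
(* moduli of the points of the orbit of z are given by coordinates             *)
(* c_i = exp (- a_i) in ]0,1[ on chains, and letting some c_i tend to 0 leads   *)
(* to the orbits of larger cones: the chains index the cells of X. A compact   *)
(* T-CW complex has finitely many cells, since one point chosen in each cell   *)
(* yields a closed discrete subset.                                           *)

From HB Require Import structures.
From Stdlib Require Import Eqdep_dec.
Require Import Defs.
From mathcomp Require Import all_boot all_order all_algebra complex generic_quotient.
From mathcomp Require Import all_classical all_reals all_analysis.
From mathcomp Require Import ring lra zify.

Set Implicit Arguments.
Unset Strict Implicit.
Unset Printing Implicit Defensive.

Import Order.TTheory GRing.Theory Num.Theory.
Import numFieldNormedType.Exports.

Local Open Scope classical_set_scope.
Local Open Scope ring_scope.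
Local Open Scope complex_scope.
Local Open Scope quotient_scope.

(** * Polyhedral cones *)

(** A point x of X is the cone [orb x] of its orbit together with a character [hat x] of the lattice
    orthogonal to that cone, extended by 0 ([point_exists], [point_unique], [toric_ext]). Every
    chart containing x sees a restriction of the same function [hat x], and the separating forms
    [sep] tell through [perp_sep] which charts contain x. The topology of X is then handled by
    [hat_cvg] and [cvg_toric], and the continuous weights [lam] give [toric_hausdorff].

    For an arbitrary fan, each intersection of charts is again a chart U_k, which contracts
    T-equivariantly onto a compact orbit T/T_k, where T_k is the annihilator of the lattice
    orthogonal to k. Gluing these orbits along the nerve of the covering gives the finite complex
    [nerve]: over a point p of the cube sits T modulo the stabilizer of the cone [capJ p]. The map
    [to_nerve] retains the weights [Lam] and the phase of x, [from_nerve] supplies moduli that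
    vanish on the correct characters, and [contract] and [slide] deform the composites to the
    identities. The danger is that a phase jumps where its character vanishes; there it is always
    multiplied by a factor tending to 0 ([cvg_mul_bounded], [bent_cvg]).

    For a complete fan, the logarithms of the moduli identify the orbit of z modulo T with the Lie
    algebra modulo the span of z. The barycentric subdivision of the star of z cuts this quotient
    into simplicial cones, one for each chain of cones strictly above z: this is [chain_exists] and
    [chain_unique], both resting on Farkas' lemma. Exponentiating the coefficients turns such a cone
    into an open cube, and its closure in X is reached by letting coordinates tend to 0 (a larger
    cone, hence a smaller orbit) or to 1 (a shorter chain); see [cell_point_inj], [cell_point_surj]
    and [cell_point_boundary].

    Both families of cells are faces of a cube times orbits of T, and [cube_structure] turns such a
    parametrization of a Hausdorff space into a T-CW structure: the cells are compact and finite in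
    number, so their maps are closed and the topological axioms follow. The space is then also
    compact, whence finiteness of every T-CW structure on it by [compact_TCW_finite]. *)

Section Dot.
Context {F : pzRingType} {n : nat}.
Implicit Types u v w : 'rV[F]_n.

Definition dot w u : F := \sum_i w 0 i * u 0 i.

Lemma dotDl w w' u : dot (w + w') u = dot w u + dot w' u.
Proof. by rewrite -big_split; apply: eq_bigr => i _; rewrite mxE mulrDl. Qed.

Lemma dotDr w u u' : dot w (u + u') = dot w u + dot w u'.
Proof. by rewrite -big_split; apply: eq_bigr => i _; rewrite mxE mulrDr. Qed.

Lemma dotNl w u : dot (- w) u = - dot w u.
Proof. by rewrite -sumrN; apply: eq_bigr => i _; rewrite mxE mulNr. Qed.

Lemma dotNr w u : dot w (- u) = - dot w u.
Proof. by rewrite -sumrN; apply: eq_bigr => i _; rewrite mxE mulrN. Qed.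

Lemma dot0l u : dot 0 u = 0.
Proof. by apply: big1 => i _; rewrite mxE mul0r. Qed.

Lemma dot0r w : dot w 0 = 0.
Proof. by apply: big1 => i _; rewrite mxE mulr0. Qed.

Lemma dotZl a w u : dot (a *: w) u = a * dot w u.
Proof. by rewrite mulr_sumr; apply: eq_bigr => i _; rewrite mxE mulrA. Qed.

Lemma dotMnl w u k : dot (w *+ k) u = dot w u *+ k.
Proof. by elim: k => [|k IH]; rewrite ?mulr0n ?dot0l// !mulrS dotDl IH. Qed.

Lemma dot_suml (I : finType) (f : I -> 'rV[F]_n) u :
  dot (\sum_i f i) u = \sum_i dot (f i) u.
Proof.
by apply: (big_morph (fun w => dot w u)) => [w w'|]; rewrite ?dotDl ?dot0l.
Qed.

Lemma dot_sumr (I : finType) (f : I -> 'rV[F]_n) w :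
  dot w (\sum_i f i) = \sum_i dot w (f i).
Proof. by apply: (big_morph (dot w)) => [u u'|]; rewrite ?dotDr ?dot0r. Qed.

End Dot.

Lemma dotZr (F : comPzRingType) n a (w u : 'rV[F]_n) :
  dot w (a *: u) = a * dot w u.
Proof. by rewrite mulr_sumr; apply: eq_bigr => i _; rewrite mxE mulrCA. Qed.

Lemma dot_map (F G : pzRingType) (f : {rmorphism F -> G}) n (w u : 'rV[F]_n) :
  dot (map_mx f w) (map_mx f u) = f (dot w u).
Proof. by rewrite rmorph_sum; apply: eq_bigr => i _; rewrite !mxE rmorphM. Qed.

(** * Farkas' lemma and finitely generated cones *)

Section Farkas.
Context {F : realFieldType} {n : nat}.
Implicit Types (u w b : 'rV[F]_n).

Definition incone k (v : 'I_k -> 'rV[F]_n) b :=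
  exists c : 'I_k -> F, (forall i, 0 <= c i) /\ b = \sum_i c i *: v i.

Let consf (T : Type) k (x : T) (c : 'I_k -> T) (i : 'I_k.+1) : T :=
  oapp c x (unlift ord0 i).

Let consf0 (T : Type) k (x : T) (c : 'I_k -> T) : consf x c ord0 = x.
Proof. by rewrite /consf unlift_none. Qed.

Let consfS (T : Type) k (x : T) (c : 'I_k -> T) i :
  consf x c (lift ord0 i) = c i.
Proof. by rewrite /consf liftK. Qed.

Let incone_cons k (v : 'I_k.+1 -> 'rV[F]_n) a b :
  0 <= a -> incone (fun i => v (lift ord0 i)) (b - a *: v ord0) ->
  incone v b.
Proof.
move=> a0 [c [c0 e]]; exists (consf a c); split=> [i|].
  by case: (unliftP ord0 i) => [j|] ->; rewrite ?consfS ?consf0.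
rewrite big_ord_recl consf0; under eq_bigr do rewrite consfS.
by rewrite -e addrC subrK.
Qed.

(* If m separates b from the cone of the other generators but is negative on  *)
(* v ord0, the problem is projected along v ord0 onto the kernel of m.        *)
Lemma farkas k (v : 'I_k -> 'rV[F]_n) b :
  incone v b \/ exists m, (forall i, 0 <= dot m (v i)) /\ dot m b < 0.
Proof.
elim: k v b => [|k IH] v b.
  have [->|b0] := eqVneq b 0.
    by left; exists (fun=> 0); split=> //; rewrite big_ord0.
  right; exists (- b); split=> [[]//|]; rewrite dotNl oppr_lt0 lt_neqAle.
  have sq0 i : 0 <= b 0 i * b 0 i by rewrite -expr2 sqr_ge0.
  rewrite sumr_ge0// andbT eq_sym psumr_eq0//; apply: contraNN b0 => /allP b0.
  apply/eqP/rowP => i; rewrite mxE; apply/eqP.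
  by rewrite -[_ == _]orbb -mulf_eq0; apply: b0; rewrite mem_index_enum.
set w := v ord0; set v' := fun i => v (lift ord0 i).
case: (IH v' b) => [bv|[m [mv mb]]].
  by left; apply: (@incone_cons _ _ 0) => //; rewrite scale0r subr0.
have [mw|mw] := leP 0 (dot m w).
  right; exists m; split=> // i.
  by case: (unliftP ord0 i) => [j|] ->; [exact: mv|].
have mw0 : dot m w != 0 by rewrite lt_eqF.
pose pr u := u - (dot m u / dot m w) *: w.
case: (IH (fun i => pr (v' i)) (pr b)) => [[c [c0 e]]|[m' [mv' mb']]].
  left; apply: (@incone_cons _ _
      (dot m b / dot m w - \sum_i c i * (dot m (v' i) / dot m w))).
    rewrite subr_ge0 (@le_trans _ _ 0)//.
      apply: sumr_le0 => i _; apply: mulr_ge0_le0 => //.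
      by apply: mulr_ge0_le0; rewrite ?mv// invr_le0 ltW.
    by apply: mulr_le0; rewrite ?invr_le0 ltW.
  exists c; split=> //; rewrite -/w.
  have -> : \sum_i c i *: v (lift ord0 i) =
      pr b + (\sum_i c i * (dot m (v' i) / dot m w)) *: w.
    rewrite e scaler_suml -big_split/=; apply: eq_bigr => i _.
    by rewrite /pr scalerBr scalerA subrK.
  by rewrite scalerBl opprB addrA addrAC.
right; exists (m' - (dot m' w / dot m w) *: m).
have E u : dot (m' - (dot m' w / dot m w) *: m) u = dot m' (pr u).
  by rewrite dotDl dotNl dotZl /pr dotDr dotNr dotZr; field.
split=> [i|]; rewrite E//; case: (unliftP ord0 i) => [j|] ->; first exact: mv'.
by rewrite /pr divff// scale1r subrr dot0r.
Qed.

End Farkas.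

Section InCone.
Context {F : realFieldType} {n k : nat}.
Implicit Types (v : 'I_k -> 'rV[F]_n) (u w b : 'rV[F]_n).

Lemma incone0 v : incone v 0.
Proof.
by exists (fun=> 0); split=> //; rewrite big1// => i _; rewrite scale0r.
Qed.

Lemma inconeD v b b' : incone v b -> incone v b' -> incone v (b + b').
Proof.
move=> [c [c0 ->]] [c' [c'0 ->]]; exists (fun i => c i + c' i).
split=> [i|]; first exact: addr_ge0.
by rewrite -big_split; apply: eq_bigr => i _; rewrite scalerDl.
Qed.

Lemma inconeZ v a b : 0 <= a -> incone v b -> incone v (a *: b).
Proof.
move=> a0 [c [c0 ->]]; exists (fun i => a * c i).
split=> [i|]; first exact: mulr_ge0.
by rewrite scaler_sumr; apply: eq_bigr => i _; rewrite scalerA.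
Qed.

Lemma incone_sum v (I : finType) (f : I -> 'rV[F]_n) :
  (forall i, incone v (f i)) -> incone v (\sum_i f i).
Proof.
by move=> vf; elim/big_ind: _ => //; [exact: incone0|exact: inconeD].
Qed.

Lemma incone_gen v i : incone v (v i).
Proof.
exists (fun j => (j == i)%:R); split=> [j|]; first exact: ler0n.
rewrite (bigD1 i)//= eqxx scale1r big1 ?addr0// => j /negPf ->.
by rewrite scale0r.
Qed.

Lemma incone_dot_ge0 v w b :
  (forall i, 0 <= dot w (v i)) -> incone v b -> 0 <= dot w b.
Proof.
move=> vw [c [c0 ->]]; rewrite dot_sumr; apply: sumr_ge0 => i _.
by rewrite dotZr mulr_ge0.
Qed.

Lemma incone_dot_eq0 v w b :
  (forall i, dot w (v i) = 0) -> incone v b -> dot w b = 0.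
Proof.
move=> vw [c [c0 ->]]; rewrite dot_sumr; apply: big1 => i _.
by rewrite dotZr vw mulr0.
Qed.

Lemma dot_sum_gen_eq0 v w : (forall i, 0 <= dot w (v i)) ->
  dot w (\sum_i v i) = 0 -> forall i, dot w (v i) = 0.
Proof.
move=> vw /eqP; rewrite dot_sumr psumr_eq0// => /allP e i.
by apply/eqP/e; rewrite mem_index_enum.
Qed.

(** The terms of [b] pair nonnegatively with [w] and their pairings sum to 0, so only generators
    killed by [w] occur. *)
Lemma incone_opp v w b : (forall i, 0 <= dot w (v i)) ->
  (forall i, dot w (v i) = 0 -> incone v (- v i)) ->
  incone v b -> dot w b = 0 -> incone v (- b).
Proof.
move=> vw vN [c [c0 ->]] /eqP.
rewrite dot_sumr psumr_eq0 => [/allP e|i _]; last by rewrite dotZr mulr_ge0.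
rewrite -sumrN; apply: incone_sum => i; rewrite -scalerN.
have := e i (mem_index_enum _); rewrite dotZr mulf_eq0 => /orP[/eqP->|/eqP wi].
  by rewrite scale0r; exact: incone0.
by apply: inconeZ => //; exact: vN.
Qed.

End InCone.

Lemma clear_denominators n (m : 'rV[rat]_n) :
  exists (d : int) (z : 'rV[int]_n),
    0 < d /\ map_mx intr z = d%:~R *: m :> 'rV[rat]_n.
Proof.
exists (\prod_i denq (m 0 i)).
exists (\row_i (numq (m 0 i) * \prod_(j | j != i) denq (m 0 j))).
split; first by apply: prodr_gt0 => i _; exact: denq_gt0.
apply/rowP => i; rewrite !mxE [X in _ = X%:~R * _](bigD1 i)//= !rmorphM/= -{3}[m 0 i]divq_num_den.
by field; rewrite intr_eq0 denq_neq0.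
Qed.

(** * Separation and projections over the lattice *)

Section LatticeCones.
Context {R : realType} {n : nat}.
Implicit Types (m : 'rV[int]_n).

Lemma dot_lattice m m' :
  dot (lattice_vec m) (lattice_vec m') = (dot m m')%:~R :> R.
Proof. exact: dot_map. Qed.

Lemma lattice_vecD m m' :
  lattice_vec (m + m') = lattice_vec m + lattice_vec m' :> 'rV[R]_n.
Proof. exact: map_mxD. Qed.

Lemma lattice_vecN m : lattice_vec (- m) = - lattice_vec m :> 'rV[R]_n.
Proof. exact: map_mxN. Qed.

Lemma lattice_vec0 : lattice_vec 0 = 0 :> 'rV[R]_n.
Proof. exact: map_mx0. Qed.

Lemma lattice_vec_sum (I : finType) (f : I -> 'rV[int]_n) :
  lattice_vec (\sum_i f i) = \sum_i lattice_vec (f i) :> 'rV[R]_n.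
Proof. exact: map_mx_sum. Qed.

(** Farkas' lemma is applied over the rationals, so that a separating form becomes integral after
    clearing denominators. The sum of the forms found for the various i lies in the relative
    interior of the dual cone: it vanishes only on generators of the largest linear subspace of the
    cone. *)
Lemma lattice_farkas k (v : 'I_k -> 'rV[int]_n) :
  exists m, (forall i, 0 <= dot m (v i)) /\
    forall i, dot m (v i) = 0 ->
      incone (fun j => lattice_vec (v j) : 'rV[R]_n) (- lattice_vec (v i)).
Proof.
pose vq i : 'rV[rat]_n := map_mx intr (v i).
have one i : exists m, (forall j, 0 <= dot m (v j)) /\
    (dot m (v i) = 0 ->
      incone (fun j => lattice_vec (v j) : 'rV[R]_n) (- lattice_vec (v i))).
  have [[c [c0 e]]|[m [mv mi]]] := farkas vq (- vq i).
    exists 0; split=> [j|_]; first by rewrite dot0l.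
    exists (fun j => ratr (c j)); split=> [j|]; first by rewrite ler0q.
    apply/rowP => l; have /rowP/(_ l) := e.
    rewrite !mxE summxE => /(congr1 (@ratr R)); rewrite rmorphN rmorph_sum/=.
    rewrite ratr_int summxE => ->; apply: eq_bigr => j _.
    by rewrite !mxE rmorphM/= ratr_int.
  have [d [z [d0 ez]]] := clear_denominators m.
  have E j : (dot z (v j))%:~R = d%:~R * dot m (vq j).
    by rewrite -(dot_map intr) ez dotZl.
  exists z; split=> [j|zi].
    by rewrite -(ler0z rat) E mulr_ge0 // ler0z ltW.
  exfalso; have := E i; rewrite zi => /esym/eqP; rewrite mulf_eq0 intr_eq0.
  by rewrite gt_eqF//= => /eqP mi0; move: mi; rewrite dotNr mi0 oppr0 ltxx.
have {one}[f fP] := choice one.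
exists (\sum_i f i); split=> [i|i].
  by rewrite dot_suml; apply: sumr_ge0 => j _; exact: (fP j).1.
rewrite dot_suml => /eqP; rewrite psumr_eq0 => [/allP e|j _]; last exact: (fP j).1.
by apply: (fP i).2; apply/eqP/e; rewrite mem_index_enum.
Qed.

(** This is [lattice_farkas] for the cone sigma - tau: a vector u of sigma killed by m has its
    opposite in sigma - tau, and symmetrically for tau. *)
Lemma lattice_separation k l (a : 'I_k -> 'rV[int]_n) (b : 'I_l -> 'rV[int]_n)
    (sigma := incone (fun i => lattice_vec (a i) : 'rV[R]_n))
    (tau := incone (fun i => lattice_vec (b i) : 'rV[R]_n)) :
  exists m, [/\ forall i, 0 <= dot m (a i), forall i, dot m (b i) <= 0,
    forall u, sigma u -> dot (lattice_vec m) u = 0 ->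
      exists s t, [/\ sigma s, tau t & u + s = t] &
    forall u, tau u -> dot (lattice_vec m) u = 0 ->
      exists s t, [/\ sigma s, tau t & u + t = s]].
Proof.
pose v (i : 'I_(k + l)) :=
  match fintype.split i with inl i => a i | inr i => - b i end.
pose vr i : 'rV[R]_n := lattice_vec (v i).
have vl i : v (lshift l i) = a i by rewrite /v (unsplitK (inl i)).
have vr_ i : v (rshift k i) = - b i by rewrite /v (unsplitK (inr i)).
have [m [m0 mN]] := lattice_farkas v.
have sub_s u : sigma u -> incone vr u.
  move=> [c [c0 ->]]; apply: incone_sum => i; apply: inconeZ => //.
  by rewrite -vl; exact: (incone_gen vr).
have sub_t u : tau u -> incone vr (- u).
  move=> [c [c0 ->]]; rewrite -sumrN; apply: incone_sum => i.
  rewrite -scalerN; apply: inconeZ => //.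
  by rewrite -lattice_vecN -vr_; exact: (incone_gen vr).
have dec u : incone vr u -> exists s t, [/\ sigma s, tau t & u = s - t].
  move=> [c [c0 ->]]; exists (\sum_i c (lshift l i) *: lattice_vec (a i)).
  exists (\sum_i c (rshift k i) *: lattice_vec (b i)); split.
  - by exists (fun i => c (lshift l i)).
  - by exists (fun i => c (rshift k i)).
  - rewrite big_split_ord/= /vr; congr (_ + _).
      by apply: eq_bigr => i _; rewrite vl.
    by rewrite -sumrN; apply: eq_bigr => i _; rewrite vr_ lattice_vecN scalerN.
have mr i : 0 <= dot (lattice_vec m) (vr i) by rewrite dot_lattice ler0z.
have mrN i : dot (lattice_vec m) (vr i) = 0 -> incone vr (- vr i).
  by rewrite dot_lattice => /eqP; rewrite intr_eq0 => /eqP; exact: mN.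
exists m; split=> [i|i|u su mu|u tu mu].
- by rewrite -vl.
- by rewrite -oppr_ge0 -dotNr -vr_.
- have [s [t [ss tt e]]] := dec _ (incone_opp mr mrN (sub_s _ su) mu).
  exists s, t; split=> //; apply/eqP; rewrite -subr_eq0 -addrA -e.
  by rewrite subrr.
- have mu' : dot (lattice_vec m) (- u) = 0 by rewrite dotNr mu oppr0.
  have [s [t [ss tt e]]] := dec _ (incone_opp mr mrN (sub_t _ tu) mu').
  by exists s, t; split=> //; rewrite -[u]opprK e subrK.
Qed.

(** Where [m0] is positive it is at least 1 by integrality, so a multiple of it exceeding all values
    of |m| on the generators suffices. *)
Lemma lattice_shift k (v : 'I_k -> 'rV[int]_n) m0 m :
  (forall i, 0 <= dot m0 (v i)) ->
  (forall i, dot m0 (v i) = 0 -> 0 <= dot m (v i)) ->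
  exists N : nat, forall i, 0 <= dot (m + m0 *+ N) (v i).
Proof.
move=> m00 m0m; exists (\sum_i `|dot m (v i)|)%N => i.
rewrite dotDl dotMnl; have [/m0m ?|m0i] := eqVneq (dot m0 (v i)) 0.
  by rewrite addr_ge0// mulrn_wge0.
have : 0 < dot m0 (v i) by rewrite lt_neqAle eq_sym m0i m00.
rewrite (bigD1 i)//=; set s := (\sum_(_ | _) _)%N.
by move: (dot m0 _) (dot m _) => x y x0; rewrite -mulr_natr; nia.
Qed.

(** For each generator not killed by A, choose a member of A positive on it; the sum of the choices
    is generic because nothing cancels. *)
Lemma lattice_generic k (v : 'I_k -> 'rV[int]_n) (A : set 'rV[int]_n) :
  A 0 -> (forall m m', A m -> A m' -> A (m + m')) ->
  (forall m i, A m -> 0 <= dot m (v i)) ->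
  exists2 m0, A m0 & forall i, dot m0 (v i) = 0 ->
    forall m, A m -> dot m (v i) = 0.
Proof.
move=> A0 AD Av.
have one i : exists m, A m /\ (dot m (v i) = 0 ->
    forall m, A m -> dot m (v i) = 0).
  have [[m [Am mi]]|H] := pselect (exists m, A m /\ dot m (v i) <> 0).
    by exists m; split=> // /mi.
  exists 0; split=> // _ m Am; apply: contrapT => mi; apply: H.
  by exists m.
have {one}[f fP] := choice one.
exists (\sum_i f i) => [|i].
  by elim/big_ind: _ => // i _; exact: (fP i).1.
rewrite dot_suml => /eqP; rewrite psumr_eq0 => [/allP e|j _]; last first.
  exact/Av/(fP j).1.
by apply: (fP i).2; apply/eqP/e; rewrite mem_index_enum.
Qed.

(* Smith normal form exhibits the annihilator of the v i as a direct summand  *)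
(* of the lattice.                                                            *)
Lemma lattice_projection k (v : 'I_k -> 'rV[int]_n) :
  exists Q : 'M[int]_n, (forall m i, dot (m *m Q) (v i) = 0) /\
    forall m, (forall i, dot m (v i) = 0) -> m *m Q = m.
Proof.
pose G := \matrix_(j < n, i < k) v i 0 j.
have GE m i : dot m (v i) = (m *m G) 0 i.
  by rewrite mxE; apply: eq_bigr => j _; rewrite mxE.
have [L Lu [P Pu [d _ GLP]]] := int_Smith_normal_form G.
pose D := \matrix_(i < n, j < k) (d`_i *+ (i == j :> nat)).
have {}GLP : G = L *m D *m P by rewrite GLP.
(* The diagonal matrix of e selects the zero rows of D: it annihilates D from the left and fixes
   every row vector annihilated by D. *)
pose e := \row_(i < n) ((row i D == 0)%:R : int).
exists (L *m diag_mx e *m invmx L); split=> [m i|m mv].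
  rewrite GE GLP !mulmxA mulmxKV// -(mulmxA _ _ D).
  suff -> : diag_mx e *m D = 0 by rewrite mulmx0 mul0mx mxE.
  apply/matrixP => j l; rewrite mul_diag_mx !mxE.
  have [/rowP/(_ l)|] := eqVneq (row j D) 0; last by rewrite mul0r.
  by rewrite !mxE mul1r.
have mLD : m *m L *m D = 0.
  apply: (can_inj (mulmxK Pu)); rewrite /= mul0mx -!mulmxA (mulmxA L) -GLP.
  by apply/rowP => i; rewrite -GE mv mxE.
rewrite !mulmxA; suff -> : m *m L *m diag_mx e = m *m L by rewrite mulmxK.
rewrite mul_mx_diag; apply/rowP => i; rewrite mxE [e _ _]mxE.
have [_|Di] := eqVneq (row i D) 0; first by rewrite mulr1.
have [j Dij] : exists j, D i j != 0.
  apply: contrapT => H; move/eqP: Di; apply; apply/rowP => j.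
  rewrite [row i D 0 j]mxE [RHS]mxE; apply/eqP; apply: contrapT => /negP ?.
  by apply: H; exists j.
have ij : i == j :> nat by move: Dij; rewrite mxE; apply: contraNT => /negPf ->.
rewrite mulr0; have /rowP/(_ j) := mLD.
rewrite mxE [RHS]mxE (bigD1 i)//= big1 => [|l li].
  by rewrite addr0 => /eqP; rewrite mulf_eq0 (negPf Dij) orbF => /eqP.
rewrite [D l j]mxE (_ : (l == j :> nat) = false) ?mulr0n ?mulr0//.
by apply: contraNF li => /eqP lj; rewrite -val_eqE/= lj eq_sym.
Qed.

End LatticeCones.

(** * Cones of a fan *)

Section FanCones.
Context {R : realType} {n : nat} (Sigma : set (set 'rV[R]_n)).
Context (fanS : rational_fan Sigma) {J : finType} (S : J -> Sigma).
Context (Sinj : injective S) (Ssurj : forall s : Sigma, exists j, S j = s).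
Implicit Types (j : J) (m : 'rV[int]_n).

(** The finite type J enumerates the fan, so that sums, products and maxima over the cones are big
    operators. *)
Definition cone j : set 'rV[R]_n := \val (S j).
(** [dualm j] is the monoid of characters regular on the chart of j; [perp j] is its group of units
    ([perpP]). *)
Definition dualm j m := forall u, cone j u -> 0 <= dot (lattice_vec m) u.
Definition perp j m := forall u, cone j u -> dot (lattice_vec m) u = 0.
Definition leJ i j := cone i `<=` cone j.

Lemma Sigma_cone j : Sigma (cone j).
Proof. by rewrite /cone; case: (S j) => s /= /set_mem. Qed.

Lemma cone_surj s : Sigma s -> exists j, cone j = s.
Proof.
move=> Ss; have [j e] := Ssurj (exist _ s (mem_set Ss)).
by exists j; rewrite /cone e.
Qed.

Lemma leJ_refl j : leJ j j. Proof. by []. Qed.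

Arguments leJ_refl : clear implicits.

Lemma leJ_anti i j : leJ i j -> leJ j i -> i = j.
Proof. by move=> ij ji; apply/Sinj/val_inj; apply/seteqP. Qed.

Lemma cone_gens j :
  exists k (v : 'I_k -> 'rV[int]_n), cone j = incone (fun i => lattice_vec (v i)).
Proof. exact: (fan_rational fanS (Sigma_cone j)). Qed.

Lemma dualm0 j : dualm j 0.
Proof. by move=> u _; rewrite lattice_vec0 dot0l. Qed.

Arguments dualm0 : clear implicits.

Lemma dualmD j m m' : dualm j m -> dualm j m' -> dualm j (m + m').
Proof. by move=> jm jm' u ju; rewrite lattice_vecD dotDl addr_ge0 ?jm ?jm'. Qed.

Lemma dualmMn j m N : dualm j m -> dualm j (m *+ N).
Proof.
move=> jm; elim: N => [|N IH]; first exact: dualm0.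
by rewrite mulrS; exact: dualmD.
Qed.

Lemma dualm_le i j m : leJ i j -> dualm j m -> dualm i m.
Proof. by move=> ij jm u /ij; exact: jm. Qed.

Lemma perp_le i j m : leJ i j -> perp j m -> perp i m.
Proof. by move=> ij jm u /ij; exact: jm. Qed.

Lemma perp0 j : perp j 0.
Proof. by move=> u _; rewrite lattice_vec0 dot0l. Qed.

Arguments perp0 : clear implicits.

Lemma perpN j m : perp j m -> perp j (- m).
Proof. by move=> jm u ju; rewrite lattice_vecN dotNl jm// oppr0. Qed.

Lemma perpD j m m' : perp j m -> perp j m' -> perp j (m + m').
Proof. by move=> jm jm' u ju; rewrite lattice_vecD dotDl jm// jm'// addr0. Qed.

Lemma perpMn j m N : perp j m -> perp j (m *+ N).
Proof.
move=> jm; elim: N => [|N IH]; first exact: perp0.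
by rewrite mulrS; exact: perpD.
Qed.

Lemma perp_dualm j m : perp j m -> dualm j m.
Proof. by move=> jm u ju; rewrite jm. Qed.

Lemma perpP j m : perp j m <-> dualm j m /\ dualm j (- m).
Proof.
split=> [jm|[jm jNm] u ju]; first by split; apply: perp_dualm => //; exact: perpN.
apply/eqP; rewrite eq_le jm// andbT -oppr_ge0 -dotNl -lattice_vecN.
exact: jNm.
Qed.

Lemma perp_addr j m m' : dualm j m -> dualm j m' ->
  perp j (m + m') <-> perp j m /\ perp j m'.
Proof.
move=> jm jm'; split=> [jmm|[? ?]]; last exact: perpD.
split=> u ju; have /eqP := jmm u ju; rewrite lattice_vecD dotDl;
  by rewrite paddr_eq0 ?jm ?jm'// => /andP[/eqP ? /eqP].
Qed.

Lemma dualm_gens j k (v : 'I_k -> 'rV[int]_n) m :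
  cone j = incone (fun i => lattice_vec (v i)) ->
  dualm j m <-> forall i, 0 <= dot m (v i).
Proof.
move=> jv; split=> [jm i|mv u].
  have := jm (lattice_vec (v i)); rewrite dot_lattice ler0z; apply.
  by rewrite jv; exact: (incone_gen (fun i => lattice_vec (v i))).
rewrite jv; apply: incone_dot_ge0 => i.
by rewrite dot_lattice ler0z.
Qed.

Lemma perp_gens j k (v : 'I_k -> 'rV[int]_n) m :
  cone j = incone (fun i => lattice_vec (v i)) ->
  perp j m <-> forall i, dot m (v i) = 0.
Proof.
move=> jv; split=> [/perpP[/(dualm_gens _ jv) jm /(dualm_gens _ jv) jNm] i|mv u].
  by apply/eqP; rewrite eq_le jm andbT -oppr_ge0 -dotNl.
rewrite jv; apply: incone_dot_eq0 => i.
by rewrite dot_lattice mv.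
Qed.

Lemma dualm_shift j m0 m : dualm j m0 ->
  (forall u, cone j u -> dot (lattice_vec m0) u = 0 ->
     0 <= dot (lattice_vec m) u) ->
  exists N : nat, dualm j (m + m0 *+ N).
Proof.
have [k [v jv]] := cone_gens j; move=> /(dualm_gens _ jv) m0v m0m.
have [i m0i|N NP] := lattice_shift (m := m) m0v; last first.
  by exists N; apply/(dualm_gens _ jv).
have := m0m (lattice_vec (v i)); rewrite !dot_lattice m0i ler0z; apply=> //.
by rewrite jv; exact: (incone_gen (fun i => lattice_vec (v i))).
Qed.

Lemma cone_face j w : (forall u, cone j u -> 0 <= dot w u) ->
  exists k, cone k = cone j `&` [set u | dot w u = 0].
Proof.
move=> jw; apply/cone_surj/(fan_face fanS (Sigma_cone j)).
by exists w.
Qed.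

Lemma leJ_face i j : leJ i j -> is_face (cone i) (cone j).
Proof.
move=> ij; have <- : cone j `&` cone i = cone i by apply/setIidPr.
exact: (fan_meet fanS (Sigma_cone j) (Sigma_cone i)).1.
Qed.

(** By [lattice_separation], a vector u of cone i killed by m satisfies u + s = t with s in cone i
    and t in both cones. The intersection is a face of cone i, and a face containing a sum of two
    vectors of the cone contains both summands, hence u. *)
Lemma separation i j : exists m, [/\ dualm i m, dualm j (- m),
  forall u, cone i u -> dot (lattice_vec m) u = 0 -> cone j u &
  forall u, cone j u -> dot (lattice_vec m) u = 0 -> cone i u].
Proof.
have [k [a ia]] := cone_gens i; have [l [b jb]] := cone_gens j.
have [m [ma mb mi mj]] := @lattice_separation R n k l a b.
have [[w [w0 wi]] [w' [w'0 wj]]] := fan_meet fanS (Sigma_cone i) (Sigma_cone j).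
have D (x y : 'rV[R]_n) (z z' : 'rV[R]_n) : 0 <= dot z x -> 0 <= dot z y ->
    z' = x + y -> dot z z' = 0 -> dot z x = 0.
  move=> x0 y0 -> /eqP; rewrite dotDr paddr_eq0// => /andP[/eqP ->].
  by [].
exists m; split.
- exact/(dualm_gens _ ia).
- by apply/(dualm_gens _ jb) => t; rewrite dotNl oppr_ge0.
- rewrite ia => u iu /(mi u iu)[s [t [si tj ust]]].
  have it : cone i t by rewrite -ust ia; exact: inconeD.
  have [_ jt] : (cone i `&` cone j) t by split => //; rewrite jb.
  have : (cone i `&` cone j) u; last by case.
  rewrite wi; rewrite -ia in iu si; split=> //=.
  apply: (D u s w t); [exact: w0|exact: w0|by []|].
  by have : (cone i `&` cone j) t by []; rewrite wi => -[].
- rewrite jb => u ju /(mj u ju)[s [t [si tj uts]]].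
  have js : cone j s by rewrite -uts jb; exact: inconeD.
  have [is_ _] : (cone i `&` cone j) s by split => //; rewrite ia.
  have : (cone i `&` cone j) u; last by case.
  rewrite wj; rewrite -jb in ju tj; split=> //=.
  apply: (D u t w' s); [exact: w'0|exact: w'0|by []|].
  by have : (cone i `&` cone j) s by []; rewrite wj => -[].
Qed.

(** On the chart of i, the monomial of exponent [sep i j] is invertible exactly on the intersection
    with the chart of j. *)
Definition sep i j : 'rV[int]_n := projT1 (cid (separation i j)).

Lemma sep_dualm i j : dualm i (sep i j).
Proof. by rewrite /sep; case: cid => m []. Qed.

Lemma sepN_dualm i j : dualm j (- sep i j).
Proof. by rewrite /sep; case: cid => m []. Qed.

Arguments sep_dualm : clear implicits.
Arguments sepN_dualm : clear implicits.

Lemma sep_cone i j u :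
  cone i u -> dot (lattice_vec (sep i j)) u = 0 -> cone j u.
Proof. by rewrite /sep; case: cid => m [? ? H ?]; exact: H. Qed.

Lemma sep_cone_r i j u :
  cone j u -> dot (lattice_vec (sep i j)) u = 0 -> cone i u.
Proof. by rewrite /sep; case: cid => m [? ? ? H]; exact: H. Qed.

(** This turns inclusions of cones into the nonvanishing of one function, and is the main use of
    [sep]. *)
Lemma perp_sep i j (k : J) : leJ k i -> perp k (sep i j) <-> leJ k j.
Proof.
move=> ki; split=> [kij u ku|kj].
  by apply: sep_cone (kij _ ku); exact: ki.
apply/perpP; split; first exact: dualm_le ki (sep_dualm _ _).
exact: dualm_le kj (sepN_dualm _ _).
Qed.

(** Localization: a monomial regular on the chart of i becomes regular on that of j after
    multiplication by a power of the monomial [sep j i]. *)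
Lemma dualm_shift_sep i j m : dualm i m ->
  exists N : nat, dualm j (m + sep j i *+ N).
Proof.
move=> im; apply: dualm_shift; first exact: sep_dualm.
by move=> u /sep_cone/[apply]; exact: im.
Qed.

(** The sum of the generators works: a form nonnegative on the cone that vanishes on the sum
    vanishes on each of them. *)
Lemma relint_exists j : exists v : 'rV[int]_n, cone j (lattice_vec v) /\
  forall w, (forall u, cone j u -> 0 <= dot w u) -> dot w (lattice_vec v) = 0 ->
    forall u, cone j u -> dot w u = 0.
Proof.
have [k [v jv]] := cone_gens j; exists (\sum_i v i); split.
  rewrite jv lattice_vec_sum; apply: incone_sum => i.
  exact: (incone_gen (fun i => lattice_vec (v i))).
move=> w w0; rewrite lattice_vec_sum => /dot_sum_gen_eq0 wv u.
rewrite jv; apply: incone_dot_eq0; apply: wv => i; apply: w0.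
by rewrite jv; exact: (incone_gen (fun i => lattice_vec (v i))).
Qed.

Definition relint j : 'rV[int]_n := projT1 (cid (relint_exists j)).

Lemma relint_cone j : cone j (lattice_vec (relint j)).
Proof. by rewrite /relint; case: cid => v []. Qed.

Lemma relint_eq0 j w : (forall u, cone j u -> 0 <= dot w u) ->
  dot w (lattice_vec (relint j)) = 0 -> forall u, cone j u -> dot w u = 0.
Proof. by rewrite /relint; case: cid => v [? H]; exact: H. Qed.

Lemma dot_relint_ge0 i j m : leJ i j -> dualm j m -> 0 <= dot m (relint i).
Proof.
move=> ij jm; rewrite -(ler0z R) -dot_lattice.
exact/jm/ij/relint_cone.
Qed.

Lemma dot_relint_eq0 i m : dualm i m -> dot m (relint i) = 0 <-> perp i m.
Proof.
move=> im; split=> [mi|im0].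
  by apply: relint_eq0 => //; rewrite dot_lattice mi.
have := im0 _ (relint_cone i); rewrite dot_lattice => /eqP.
by rewrite intr_eq0 => /eqP.
Qed.

Lemma relint_leJ i j : cone j (lattice_vec (relint i)) -> leJ i j.
Proof.
move=> ji; apply: (perp_sep j (leJ_refl i)).1.
apply: (dot_relint_eq0 (sep_dualm i j)).1.
apply/eqP; rewrite eq_le (dot_relint_ge0 (leJ_refl i)) ?andbT; last first.
  exact: sep_dualm.
rewrite -oppr_ge0 -dotNl -(ler0z R) -dot_lattice.
exact: sepN_dualm.
Qed.

(** Composition with this retraction of M onto [perp j] extends characters of [perp j] to all of
    M. *)
Lemma annihilator_projection j : exists Q : 'M[int]_n,
  (forall m, perp j (m *m Q)) /\ forall m, perp j m -> m *m Q = m.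
Proof.
have [k [v jv]] := cone_gens j; have [Q [Q0 Q1]] := lattice_projection v.
exists Q; split=> m; first exact/(perp_gens _ jv).
by move=> /(perp_gens _ jv); exact: Q1.
Qed.

Lemma meet_exists i j : exists k, cone k = cone i `&` cone j.
Proof.
apply/cone_surj/(fan_face fanS (Sigma_cone i)).
exact: (fan_meet fanS (Sigma_cone i) (Sigma_cone j)).1.
Qed.

Lemma cap_exists (A : {set J}) : A != finset.set0 ->
  exists k, forall u, cone k u <-> forall i, i \in A -> cone i u.
Proof.
move=> /set0Pn[a aA].
have [k kP] : exists k, forall u, cone k u <->
    forall i, i \in enum A -> cone i u.
  have {aA} : a \in enum A by rewrite mem_enum.
  elim: (enum A) a => [//|b s IH] a _; case: s IH => [|c s] IH.
    exists b => u; split=> [bu i|]; first by rewrite inE => /eqP ->.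
    by apply; rewrite inE.
  have [k kP] := IH c (mem_head _ _); have [l lP] := meet_exists b k.
  exists l => u; rewrite lP; split=> [[bu /kP ku] i|H].
    by rewrite inE => /orP[/eqP ->//|]; exact: ku.
  split; first by apply: H; rewrite mem_head.
  by apply/kP => i ic; apply: H; rewrite inE ic orbT.
exists k => u; rewrite kP; split=> H i; move: (H i); rewrite mem_enum; exact.
Qed.

(** Faces of the dual monoid correspond to faces of the cone. A generic element m0 of A cuts out the
    face k. If m is orthogonal to k, then a multiple of m0 minus m is still in the dual monoid, so m
    is a summand of an element of A and belongs to A. *)
Lemma dualm_face j (A : set 'rV[int]_n) :
  A 0 -> (forall m m', A m -> A m' -> A (m + m')) -> A `<=` dualm j ->
  (forall m m', dualm j m -> dualm j m' -> A (m + m') -> A m) ->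
  exists2 k, leJ k j & forall m, dualm j m -> A m <-> perp k m.
Proof.
move=> A0 AD Aj Aface; have [k [v jv]] := cone_gens j.
have Av m i : A m -> 0 <= dot m (v i).
  by move=> /Aj jm; exact: ((dualm_gens _ jv).1 jm).
have [m0 Am0 m0P] := lattice_generic A0 AD Av.
have gj i : cone j (lattice_vec (v i)).
  by rewrite jv; exact: (incone_gen (fun i => lattice_vec (v i))).
have [l lE] := cone_face (Aj _ Am0).
exists l => [u|m jm]; first by rewrite lE => -[].
split=> [Am u|lm].
  rewrite lE jv => -[[c [c0 ->]]] /= /eqP.
  rewrite !dot_sumr psumr_eq0 => [/allP e|i _]; last first.
    by rewrite dotZr mulr_ge0// dot_lattice ler0z Av.
  apply: big1 => i _; have := e i (mem_index_enum _).
  rewrite !dotZr !dot_lattice mulf_eq0 intr_eq0 => /orP[/eqP ->|/eqP m0i].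
    by rewrite mul0r.
  by rewrite (m0P _ m0i)// mulr0.
have [u ju m0u|N jN] := @dualm_shift j m0 (- m) (Aj _ Am0).
  by rewrite lattice_vecN dotNl lm ?oppr0// lE.
apply: (Aface m _ jm jN); rewrite addrA subrr add0r.
by elim: (N) => [//|N' IH]; rewrite mulrS; exact: AD.
Qed.

End FanCones.

Arguments leJ_refl {R n Sigma J} S j [t] _.
Arguments dualm0 {R n Sigma J} S j [u] _.
Arguments perp0 {R n Sigma J} S j [u] _.
Arguments sep_dualm {R n Sigma} fanS {J} S i j [u] _.
Arguments sepN_dualm {R n Sigma} fanS {J} S i j [u] _.
Arguments relint_cone {R n Sigma} fanS {J} S j.

(** * Convergence of complex functions *)

Section Convergence.
Context {T : Type} {F : set_system T} {FF : Filter F}.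

Lemma cvg_initial (S : choiceType) (U : topologicalType) (f : S -> U)
    (h : T -> S) (s : S) :
  h @ F --> (s : initial_topology f) <-> (f \o h) @ F --> f s.
Proof.
split=> [hs A fsA|fhs].
  exact: (hs _ (@initial_continuous S U f s A fsA)).
move=> A [_ [[B oB <-] Bfs BA]].
have fB : nbhs (f s) B by apply: open_nbhs_nbhs.
exact: (@filterS _ F FF ((f \o h) @^-1` B) (h @^-1` A) (fun t => BA (h t))
  (fhs _ fB)).
Qed.

Lemma cvg_set_type (U : topologicalType) (A : set U) (h : T -> A) (s : A) :
  h @ F --> s <-> (fun t => \val (h t)) @ F --> \val s.
Proof. exact: (@cvg_initial _ _ (set_val : A -> U)). Qed.

Lemma cvg_ptws (I : Type) (U : topologicalType) (h : T -> I -> U) (s : I -> U) :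
  h @ F --> (s : {ptws I -> U}) <-> forall i, (fun t => h t i) @ F --> s i.
Proof.
split=> [/cvg_sup hs i|hs].
  exact: (@cvg_initial _ _ (fun f : {ptws I -> U} => f i) h s).1 (hs i).
apply/cvg_sup => i.
exact: (@cvg_initial _ _ (fun f : {ptws I -> U} => f i) h s).2 (hs i).
Qed.

Lemma cvg_near_eq (U : topologicalType) (f g : T -> U) (l : U) :
  (\forall t \near F, f t = g t) -> g @ F --> l -> f @ F --> l.
Proof.
move=> fg; apply: cvg_trans; apply: near_eq_cvg.
by apply: filterS fg => t.
Qed.

End Convergence.

(** * Modulus and phase *)

Section ComplexModulus.
Context {R : realType}.
Implicit Types (z w : R[i]) (x : R).

(** The norm of [R[i]] takes its values in [R[i]]; [cabs] is the modulus as an element of R, where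
    logarithms and real powers are available. *)
Definition cabs z : R := complex.Re `|z|.

Lemma cabsE z : (cabs z)%:C = `|z|.
Proof. by rewrite /cabs normc_def. Qed.

Lemma cabs_ge0 z : 0 <= cabs z.
Proof. by rewrite -ler0c cabsE. Qed.

Lemma cabsM z w : cabs (z * w) = cabs z * cabs w.
Proof. by apply: complexI; rewrite rmorphM/= !cabsE normrM. Qed.

Lemma cabsV z : cabs z^-1 = (cabs z)^-1.
Proof. by apply: complexI; rewrite fmorphV/= !cabsE normfV. Qed.

Lemma cabs_eq0 z : (cabs z == 0) = (z == 0).
Proof. by rewrite -(inj_eq (@complexI R)) cabsE normr_eq0. Qed.

Lemma cabs_gt0 z : (0 < cabs z) = (z != 0).
Proof. by rewrite lt_neqAle cabs_ge0 andbT eq_sym cabs_eq0. Qed.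

Lemma cabs1 : cabs 1 = 1.
Proof. by rewrite /cabs normr1. Qed.

Lemma cabs0 : cabs 0 = 0.
Proof. by rewrite /cabs normr0. Qed.

Lemma cabs_real x : cabs x%:C = `|x|.
Proof. by rewrite /cabs normc_def/= expr0n addr0 sqrtr_sqr. Qed.

Lemma cabs_norm1 z : `|z| = 1 -> cabs z = 1.
Proof. by rewrite /cabs => ->. Qed.

(** The phase as a complex number, not an angle. Division by 0 makes [arg 0] equal to 0, so that
    [argM] holds without side condition. *)
Definition arg z : R[i] := z / `|z|.

Lemma argM z w : arg (z * w) = arg z * arg w.
Proof. by rewrite /arg normrM invfM mulrACA. Qed.

Lemma arg_norm z : z != 0 -> `|arg z| = 1.
Proof.
by move=> z0; rewrite /arg normrM normfV normr_id divff// normr_eq0.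
Qed.

Lemma arg_norm1 z : `|z| = 1 -> arg z = z.
Proof. by rewrite /arg => ->; rewrite divr1. Qed.

Lemma arg_eq0 z : (arg z == 0) = (z == 0).
Proof. by rewrite /arg mulf_eq0 invr_eq0 normr_eq0 orbb. Qed.

Lemma arg0 : arg 0 = 0. Proof. by apply/eqP; rewrite arg_eq0. Qed.

Lemma arg_real x : 0 < x -> arg x%:C = 1.
Proof.
move=> x0; have xC0 : 0 < x%:C by rewrite ltcR.
by rewrite /arg gtr0_norm// divff// gt_eqF.
Qed.

Lemma argE z : (cabs z)%:C * arg z = z.
Proof.
have [->|z0] := eqVneq z 0; first by rewrite arg0 mulr0.
by rewrite cabsE /arg mulrC divfK// normr_eq0.
Qed.

Lemma cabs_arg_le1 z : cabs (arg z) <= 1.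
Proof.
have [->|z0] := eqVneq z 0; first by rewrite arg0 cabs0 ler01.
by rewrite cabs_norm1// arg_norm.
Qed.

End ComplexModulus.

Section ComplexConvergence.
Context {R : realType} {T : Type} {F : set_system T} {FF : Filter F}.
Implicit Types (f g : T -> R[i]) (a b : R[i]) (h : T -> R).

Lemma cvg_complexM f g a b : f @ F --> (a : R[i]^o) -> g @ F --> (b : R[i]^o) ->
  (fun t => f t * g t) @ F --> (a * b : R[i]^o).
Proof. exact: (@cvgM R[i] T F FF f g a b). Qed.

Lemma cvg_complexV f a : a != 0 -> f @ F --> (a : R[i]^o) ->
  (fun t => (f t)^-1) @ F --> (a^-1 : R[i]^o).
Proof. exact: (@cvgV R[i] T F FF f a). Qed.

Lemma cvg_complexX f a k : f @ F --> (a : R[i]^o) ->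
  (fun t => f t ^+ k) @ F --> (a ^+ k : R[i]^o).
Proof.
move=> fa; elim: k => [|k IH]; first exact: (@cvg_cst R[i]^o).
by rewrite exprS; under eq_fun do rewrite exprS; exact: cvg_complexM.
Qed.

Lemma cvg_real_complex h (x : R) : h @ F --> x ->
  (fun t => (h t)%:C) @ F --> (x%:C : R[i]^o).
Proof.
move=> hx; apply/(@cvgrPdist_lt R[i] R[i]^o) => e e0.
have eE : e = (complex.Re e)%:C by rewrite RRe_real// ger0_real// ltW.
have {}e0 : 0 < complex.Re e by rewrite -ltcR -eE.
near=> t; rewrite -rmorphB/= -cabsE cabs_real eE ltcR.
by near: t; exact: (@cvgr_dist_lt R R).
Unshelve. all: by end_near. Qed.

Lemma cvg_cabs f a : f @ F --> (a : R[i]^o) -> (fun t => cabs (f t)) @ F --> cabs a.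
Proof.
move=> fa; apply/(@cvgrPdist_lt R R) => e e0.
have e0C : 0 < e%:C by rewrite ltcR.
near=> t; rewrite -ltcR -cabs_real rmorphB/= cabsE !cabsE.
apply: le_lt_trans (ler_dist_dist _ _) _.
by near: t; exact: (@cvgr_dist_lt R[i] R[i]^o).
Unshelve. all: by end_near. Qed.

Lemma cvg_complex0 f h : (\forall t \near F, cabs (f t) <= h t) ->
  h @ F --> (0 : R) -> f @ F --> (0 : R[i]^o).
Proof.
move=> fh h0; apply/(@cvgr0Pnorm_lt R[i] R[i]^o) => e e0.
have eE : e = (complex.Re e)%:C by rewrite RRe_real// ger0_real// ltW.
have {}e0 : 0 < complex.Re e by rewrite -ltcR -eE.
near=> t; rewrite -cabsE eE ltcR.
have ht : cabs (f t) <= h t by near: t.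
apply: (le_lt_trans ht); apply: le_lt_trans (ler_norm _) _.
by near: t; exact: (@cvgr0_norm_lt R R).
Unshelve. all: by end_near. Qed.

Lemma cvg_arg f a : a != 0 -> f @ F --> (a : R[i]^o) ->
  (fun t => arg (f t)) @ F --> (arg a : R[i]^o).
Proof.
move=> a0 fa; apply: (@cvg_complexM f (fun t => `|f t|^-1) a `|a|^-1 fa).
apply: (@cvg_complexV (fun t => `|f t|) `|a|); first by rewrite normr_eq0.
rewrite -cabsE (_ : (fun t => `|f t|) = fun t => (cabs (f t))%:C); last first.
  by apply/funext => t; rewrite cabsE.
exact: cvg_real_complex (cvg_cabs fa).
Qed.

Lemma near_neq0 f a : a != 0 -> f @ F --> (a : R[i]^o) ->
  \forall t \near F, f t != 0.
Proof. by move=> a0 fa; exact: (@cvgr_neq0 R[i] R[i]^o _ _ _ _ a). Qed.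

Lemma cvg_exprz h (x : R) (k : int) : 0 <= k \/ x != 0 -> h @ F --> x ->
  (fun t => h t ^ k) @ F --> x ^ k.
Proof.
have nat (k' : nat) : h @ F --> x -> (fun t => h t ^+ k') @ F --> x ^+ k'.
  move=> hx; elim: k' => [|k' IH]; first exact: cvg_cst.
  by rewrite exprS; under eq_fun do rewrite exprS; exact: cvgM.
case: k => k kx hx; first exact: nat.
by apply: cvgV; [case: kx => // x0; rewrite expf_neq0|exact: nat].
Qed.

Lemma cvg_bigprod (I : finType) (P : pred I) (h : I -> T -> R) (x : I -> R) :
  (forall i, P i -> h i @ F --> x i) ->
  (fun t => \prod_(i | P i) h i t) @ F --> \prod_(i | P i) x i.
Proof.
move=> hx; elim: (index_enum I) => [|i s IH].
  by rewrite big_nil; under eq_fun do rewrite big_nil; exact: cvg_cst.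
rewrite big_cons; under eq_fun do rewrite big_cons.
by case: ifP => // Pi; apply: cvgM => //; exact: hx.
Qed.

Lemma cvg_bigsum (I : finType) (P : pred I) (h : I -> T -> R) (x : I -> R) :
  (forall i, P i -> h i @ F --> x i) ->
  (fun t => \sum_(i | P i) h i t) @ F --> \sum_(i | P i) x i.
Proof.
move=> hx; elim: (index_enum I) => [|i s IH].
  by rewrite big_nil; under eq_fun do rewrite big_nil; exact: cvg_cst.
rewrite big_cons; under eq_fun do rewrite big_cons.
by case: ifP => // Pi; apply: cvgD => //; exact: hx.
Qed.

Lemma cvg_max h h' (x x' : R) : h @ F --> x -> h' @ F --> x' ->
  (fun t => Num.max (h t) (h' t)) @ F --> Num.max x x'.
Proof.
move=> hx hx'; have E (a b : R) : Num.max a b = (a + b + `|a - b|) / 2.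
  by have [ab|ba] := leP a b;
    [rewrite ler0_norm ?subr_le0//|rewrite gtr0_norm ?subr_gt0//]; lra.
rewrite E; under eq_fun do rewrite E.
apply: cvgM; last exact: cvg_cst.
by apply: cvgD; [exact: cvgD|apply: cvg_norm; exact: cvgB].
Qed.

Lemma cvg_min h h' (x x' : R) : h @ F --> x -> h' @ F --> x' ->
  (fun t => Num.min (h t) (h' t)) @ F --> Num.min x x'.
Proof.
move=> hx hx'; have E (a b : R) : Num.min a b = (a + b - `|a - b|) / 2.
  by have [ab|ba] := leP a b;
    [rewrite ler0_norm ?subr_le0//|rewrite gtr0_norm ?subr_gt0//]; lra.
rewrite E; under eq_fun do rewrite E.
apply: cvgM; last exact: cvg_cst.
by apply: cvgB; [exact: cvgD|apply: cvg_norm; exact: cvgB].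
Qed.

Lemma cvg_bigmax (I : finType) (h : I -> T -> R) (x : I -> R) :
  (forall i, h i @ F --> x i) ->
  (fun t => \big[Num.max/0]_i h i t) @ F --> \big[Num.max/0]_i x i.
Proof.
move=> hx; elim: (index_enum I) => [|i s IH].
  by rewrite big_nil; under eq_fun do rewrite big_nil; exact: cvg_cst.
by rewrite big_cons; under eq_fun do rewrite big_cons; exact: cvg_max.
Qed.

Lemma cvg_powR_exp h h' (x x' : R) : 0 < x -> h @ F --> x -> h' @ F --> x' ->
  (fun t => expR (h' t * ln (h t))) @ F --> expR (x' * ln x).
Proof.
move=> x0 hx hx'; apply: continuous_cvg; first exact: continuous_expR.
apply: cvgM => //; apply: continuous_cvg => //.
exact: continuous_ln.
Qed.

End ComplexConvergence.

(** * Points of the toric variety *)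

Section Gluing.
Context {Z : topologicalType} (r : Z -> Z -> Prop).

Lemma gluing_piP (x y : Z) :
  \pi_(gluing r) x = \pi_(gluing r) y <->
  Relation_Operators.clos_refl_sym_trans Z r x y.
Proof.
split=> [/eqmodP/asboolP//|xy].
by apply/eqmodP/asboolP.
Qed.

Lemma gluing_reprP (z : Z) :
  Relation_Operators.clos_refl_sym_trans Z r (repr (\pi_(gluing r) z)) z.
Proof. by apply/gluing_piP; rewrite reprK. Qed.

Lemma gluing_pi_continuous : continuous (\pi_(gluing r) : Z -> gluing r).
Proof. exact: pi_continuous. Qed.

Lemma gluing_open (A : set (gluing r)) :
  open A <-> open (\pi_(gluing r) @^-1` A).
Proof. by []. Qed.

End Gluing.

Section ToricPoints.
Context {R : realType} {n : nat} (Sigma : set (set 'rV[R]_n)).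
Context (fanS : rational_fan Sigma) {J : finType} (S : J -> Sigma).
Context (Sinj : injective S) (Ssurj : forall s : Sigma, exists j, S j = s).
Local Notation M := 'rV[int]_n.
Local Notation cone := (cone S).
Local Notation dualm := (dualm S).
Local Notation perp := (perp S).
Local Notation sep := (sep fanS S).
Implicit Types (s : Sigma) (j : J) (m : M) (y : M -> R[i]).

(** Extension by 0 off the dual monoid lets points of different charts be compared as functions on
    the same lattice. *)
Definition aeval s (x : affine_toric (\val s)) m : R[i] :=
  if pselect (dual_monoid (\val s) m) is left h
  then affine_eval x (exist _ m (mem_set h)) else 0.

Lemma aeval_val s (x : affine_toric (\val s)) (a : dual_monoid (\val s)) :
  aeval x (\val a) = affine_eval x a.
Proof.
rewrite /aeval; case: pselect => [h|[]]; last exact: set_mem (valP a).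
by congr affine_eval; apply: val_inj.
Qed.

Lemma aevalE s (x : affine_toric (\val s)) m (h : dual_monoid (\val s) m) :
  aeval x m = affine_eval x (exist _ m (mem_set h)).
Proof. by rewrite -aeval_val. Qed.

Lemma aeval0 s (x : affine_toric (\val s)) : aeval x 0 = 1.
Proof.
have h : dual_monoid (\val s) (0 : M) by move=> u _; rewrite /pairing lattice_vec0 -/(dot 0 u) dot0l.
by rewrite aevalE; have [+ _] := set_mem (valP x); exact.
Qed.

Lemma aevalD s (x : affine_toric (\val s)) a b :
  dual_monoid (\val s) a -> dual_monoid (\val s) b ->
  aeval x (a + b) = aeval x a * aeval x b.
Proof.
move=> ha hb; have hab : dual_monoid (\val s) (a + b).
  by move=> u su; rewrite /pairing lattice_vecD -/(dot (_ + _) u) dotDl addr_ge0 ?ha ?hb.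
by rewrite !aevalE; have [_ +] := set_mem (valP x); exact.
Qed.

Definition is_character s y := y 0 = 1 /\ forall a b,
  dual_monoid (\val s) a -> dual_monoid (\val s) b -> y (a + b) = y a * y b.

Lemma affine_one_subproof s :
  @affine_points R n (\val s) (fun=> 1).
Proof. by split=> // *; rewrite mulr1. Qed.

(* The constant character 1 is a junk value, for y not a character. *)
Definition affine_mk s y : affine_toric (\val s) :=
  match pselect (@affine_points R n (\val s) (fun a => y (\val a))) with
  | left h => exist (fun x => x \in @affine_points R n (\val s)) _ (mem_set h)
  | right _ =>
    exist (fun x => x \in @affine_points R n (\val s)) _
      (mem_set (affine_one_subproof s))
  end.

Lemma aeval_mk s y m : is_character s y -> dual_monoid (\val s) m ->
  aeval (affine_mk s y) m = y m.
Proof.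
move=> [y0 yD] sm; rewrite aevalE /affine_mk; case: pselect => [h//|[]].
split=> [a ->//|a b c ->]; apply: yD; first exact: set_mem (valP a).
exact: set_mem (valP b).
Qed.

(* [z] lies in the orbit of the cone [k], with character [y] of the lattice    *)
(* [perp k] (extended by 0).                                                  *)
Definition is_point (z : charts Sigma) (k : J) y := [/\
  cone k `<=` \val (projT1 z),
  forall m, y m != 0 <-> perp k m,
  forall a b, perp k a -> perp k b -> y (a + b) = y a * y b &
  forall m, dual_monoid (\val (projT1 z)) m -> aeval (projT2 z) m = y m].

Lemma aeval_dualmD j (x : affine_toric (\val (S j))) a b :
  dualm j a -> dualm j b -> aeval x (a + b) = aeval x a * aeval x b.
Proof. exact: aevalD. Qed.

Lemma aeval_dualmMn j (x : affine_toric (\val (S j))) m N :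
  dualm j m -> aeval x (m *+ N) = aeval x m ^+ N.
Proof.
move=> jm; elim: N => [|N IH]; first by rewrite mulr0n expr0 aeval0.
by rewrite mulrS exprS aeval_dualmD ?IH//; exact: dualmMn.
Qed.

(** The exponents on which x does not vanish form a face of the dual monoid, hence are those
    orthogonal to a face k of j by [dualm_face]. The form m0 = [sep j k] is one of them, and every
    exponent orthogonal to k enters the dual monoid of j after adding a multiple of m0. *)
Lemma point_exists z : exists ky : J * (M -> R[i]), is_point z ky.1 ky.2.
Proof.
case: z => s x; have [j sE] := Ssurj s; subst s.
have [||m [jm _]|m m' jm jm' [jmm']|k kj kP] := @dualm_face _ _ _ fanS _ _ Ssurj j
  [set m | dualm j m /\ aeval x m != 0].
- by split; [exact: dualm0|rewrite aeval0 oner_eq0].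
- move=> m m' [jm xm] [jm' xm']; split; first exact: dualmD.
  by rewrite aeval_dualmD// mulf_neq0.
- exact: jm.
- by rewrite aeval_dualmD// mulf_eq0 => /norP[xm _]; split.
set m0 := sep j k; have jm0 : dualm j m0 := sep_dualm fanS S j k.
have km0 : perp k m0 by apply/(perp_sep fanS k kj).
have xm0 : aeval x m0 != 0 by have [] := (kP _ jm0).2 km0.
have exN m : exists N : nat, perp k m -> dualm j (m + m0 *+ N).
  have [km|] := pselect (perp k m); last by exists 0%N.
  by have [N NP] := dualm_shift_sep fanS j (perp_dualm km); exists N.
have [f fP] := choice exN.
pose y m := if `[< perp k m >] then aeval x (m + m0 *+ f m) / aeval x m0 ^+ f m
            else 0.
(* The quotient defining [y m] does not depend on the multiple of m0 that was chosen. *)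
have yE m N : perp k m -> dualm j (m + m0 *+ N) ->
    aeval x (m + m0 *+ N) = y m * aeval x m0 ^+ N.
  move=> km jN; rewrite /y asboolT//.
  apply: (mulIf (expf_neq0 (f m) xm0)); rewrite mulrAC divfK ?expf_neq0//.
  rewrite -!aeval_dualmMn//; rewrite -aeval_dualmD//; last exact: dualmMn.
  rewrite -aeval_dualmD//; [|exact: fP|exact: dualmMn].
  by rewrite addrAC.
exists (k, y); split => //=.
- move=> m; rewrite /y; have [/asboolP km|/asboolPn nkm] := boolP `[< perp k m >].
    split=> // _; rewrite mulf_neq0 ?invr_eq0 ?expf_neq0//.
    by have [] := (kP _ (fP _ km)).2 (perpD km (perpMn _ km0)).
  by rewrite eqxx; split.
- move=> a b ka kb; have kab := perpD ka kb.
  apply: (mulIf (expf_neq0 (f a + f b) xm0)).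
  have E : a + b + m0 *+ (f a + f b) = (a + m0 *+ f a) + (b + m0 *+ f b).
    by rewrite mulrnDr addrACA.
  have jab := dualmD (fP _ ka) (fP _ kb).
  rewrite -yE// ?E// aeval_dualmD//; [|exact: fP|exact: fP].
  rewrite (yE a (f a) ka (fP _ ka)) (yE b (f b) kb (fP _ kb)).
  by rewrite exprD mulrACA.
- move=> m jm; have [km|nkm] := pselect (perp k m).
    by have := @yE m 0%N km; rewrite mulr0n addr0 expr0 mulr1 => ->.
  rewrite /y asboolF//; apply/eqP/negP => xm; apply: nkm; apply/(kP _ jm).
  by split => //; apply/negP.
Qed.

(** The nonvanishing locus of the point determines the cone through [perp_sep], and its values on
    the dual monoid determine y by localization. *)
Lemma point_unique z k k' y y' : is_point z k y -> is_point z k' y' ->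
  k = k' /\ y = y'.
Proof.
case: z => s x; have [j sE] := Ssurj s; subst s.
move=> [/= kj yk yD yx] [/= kj' yk' yD' yx'].
have kk' m : dualm j m -> perp k m <-> perp k' m.
  by move=> jm; rewrite -yk -yk' -yx// yx'.
have {}kk : k = k'.
  apply: (leJ_anti Sinj).
    by apply/(perp_sep fanS k' kj)/kk'; [|apply/perp_sep]; rewrite //;
      exact: sep_dualm.
  by apply/(perp_sep fanS k kj')/kk'; [|apply/perp_sep]; rewrite //;
      exact: sep_dualm.
subst k'; split=> //; apply/funext => m.
have [km|nkm] := pselect (perp k m); last first.
  have -> : y m = 0 by apply/eqP/negP => /negP/yk.
  by apply/esym/eqP/negP => /negP/yk'.
have [N jN] := dualm_shift_sep fanS j (perp_dualm km).
have km0 : perp k (sep j k) by apply/(perp_sep fanS k kj).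
have kN : perp k (sep j k *+ N) by exact: perpMn.
have yN : y (sep j k *+ N) != 0 by exact/yk.
apply: (mulIf yN); rewrite -yD// -yx// yx'// yD'//; congr (_ * _).
by rewrite -yx' ?yx//; apply: dualmMn; exact: sep_dualm.
Qed.

Lemma is_point_face z w k y : glue_face z w -> is_point z k y -> is_point w k y.
Proof.
case: z w => s x [s' x'] [/= ss' xx'] [/= ks yk yD yx].
have sub : \val s `<=` \val s'
  by case: ss' => v [_ e] u su; have : (sval s) u by []; rewrite e => -[].
split=> //= [u /ks/sub//|m s'm]; rewrite -yx; last by move=> u /sub/s'm.
by rewrite !aevalE; [move=> u /sub/s'm|move=> ?; apply/esym; exact: xx'].
Qed.

(** The data pass from a small chart to a larger one directly; the converse direction of a gluing
    step uses existence and uniqueness. *)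
Lemma is_point_gluing z w k y :
  Relation_Operators.clos_refl_sym_trans _ (@glue_face R n Sigma) z w ->
  is_point z k y <-> is_point w k y.
Proof.
elim=> {z w} [z w zw|z|z w _ zw|z w t _ zw _ wt]; rewrite ?zw ?wt//.
split=> [|wky]; first exact: is_point_face.
have [[k' y'] /= zky'] := point_exists z.
by have [-> ->] := point_unique wky (is_point_face zw zky').
Qed.

(** Both representatives are glued to the point p of the smallest chart that contains them, the one
    of the orbit cone k. *)
Lemma point_gluing z w k y : is_point z k y -> is_point w k y ->
  Relation_Operators.clos_refl_sym_trans _ (@glue_face R n Sigma) z w.
Proof.
move=> zky wky; pose p : charts Sigma := existT _ (S k) (affine_mk (S k) y).
suff H v : is_point v k y ->
    Relation_Operators.clos_refl_sym_trans _ (@glue_face R n Sigma) p v.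
  by apply: Relation_Operators.rst_trans (H _ wky); exact/Relation_Operators.rst_sym/H.
case: v => s x [/= ks yk yD yx]; apply: Relation_Operators.rst_step.
have [j sE] := Ssurj s; subst s.
have yc : is_character (S k) y.
  split=> [|a b ka kb].
    have y00 := yD _ _ (perp0 S k) (perp0 S k).
    have y0 : y 0 != 0 by exact/yk/perp0.
    by apply: (mulfI y0); rewrite -y00 addr0 mulr1.
  have [kab|nkab] := pselect (perp k (a + b)).
    by have [? ?] := (perp_addr ka kb).1 kab; exact: yD.
  have -> : y (a + b) = 0 by apply/eqP/negP => /negP/yk.
  apply/esym/eqP/negP => /negP; rewrite mulf_eq0 => /norP[/yk ? /yk ?].
  by apply: nkab; exact: perpD.
split=> /=; first exact: (leJ_face fanS).
move=> a b ab; rewrite -!aeval_val aeval_mk//; last exact: set_mem (valP a).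
by rewrite yx; [congr y|exact: set_mem (valP b)].
Qed.

End ToricPoints.

Lemma torus_cvg (R : realType) n (T : Type) (F : set_system T) {FF : Filter F}
    (f : T -> torus R n) (t : torus R n) :
  f @ F --> t <-> forall m, (fun s => f s m) @ F --> (t m : R[i]^o).
Proof.
split=> [/cvg_set_type/cvg_ptws ft m|ft]; first exact: ft.
by apply/cvg_set_type/cvg_ptws => m; exact: ft.
Qed.

Lemma torus0 (R : realType) n (t : torus R n) : t 0 = 1.
Proof. by apply: (mulfI (torus_neq0 t 0)); rewrite mulr1 -torusD addr0. Qed.

(** Continuity of f is required at p and q only, since the coordinates of X are continuous only on
    charts. *)
Lemma cluster_cvg_eq (U V : topologicalType) (f : U -> V) (p q : U) :
  hausdorff_space V -> f @ p --> f p -> f @ q --> f q ->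
  cluster (nbhs p) q -> f p = f q.
Proof.
move=> hV fp fq pq; apply: hV => A B /fp Ap /fq Bq.
by have [x [Ax Bx]] := pq _ _ Ap Bq; exists (f x).
Qed.

Lemma complex_hausdorff (R : realType) : hausdorff_space (R[i]^o).
Proof. exact: (@norm_hausdorff R[i] R[i]^o). Qed.

(** * Coordinates, action and weights on the toric variety *)

Section ToricCoordinates.
Context {R : realType} {n : nat} (Sigma : set (set 'rV[R]_n)).
Context (fanS : rational_fan Sigma) {J : finType} (S : J -> Sigma).
Context (Sinj : injective S) (Ssurj : forall s : Sigma, exists j, S j = s).
Local Notation M := 'rV[int]_n.
Local Notation X := (toric_variety Sigma).
Local Notation dualm := (dualm S).
Local Notation perp := (perp S).
Local Notation leJ := (leJ S).
Local Notation sep := (sep fanS S).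
Local Notation act := (toric_act Sigma).
Local Notation C := (R[i]^o).
Local Notation is_point := (is_point S).
Implicit Types (s : Sigma) (j : J) (m : M) (y : M -> R[i]) (x : X).

Let point_of x := projT1 (cid (point_exists fanS Ssurj (repr (x : gluing _)))).

Definition orb x : J := (point_of x).1.
(** For every j above [orb x], the restriction of this function to [dualm j] is the coordinate tuple
    of x in the chart of j. *)
Definition hat x : M -> R[i] := (point_of x).2.
Definition character j y := is_character (S j) y.
Definition chart j y : X :=
  \pi_(gluing (@glue_face R n Sigma)) (existT _ (S j) (affine_mk (S j) y)).

Let hatP x : is_point (repr (x : gluing _)) (orb x) (hat x).
Proof. by rewrite /orb /hat /point_of; case: cid. Qed.

Lemma is_point_pi (z : charts Sigma) k y : is_point z k y ->
  orb (\pi_(gluing (@glue_face R n Sigma)) z) = k /\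
  hat (\pi_(gluing (@glue_face R n Sigma)) z) = y.
Proof.
move=> zky; have := hatP (\pi_(gluing (@glue_face R n Sigma)) z).
move=> /(is_point_gluing fanS Sinj Ssurj _ _ (gluing_reprP _ z)) zP.
exact: point_unique zP zky.
Qed.

Lemma hat_pi (z : charts Sigma) :
  is_point z (orb (\pi_(gluing (@glue_face R n Sigma)) z))
    (hat (\pi_(gluing (@glue_face R n Sigma)) z)).
Proof.
have [[k y] /= zky] := point_exists fanS Ssurj z.
by have [-> ->] := is_point_pi zky.
Qed.

Lemma hat_neq0 x m : hat x m != 0 <-> perp (orb x) m.
Proof. by have [_ + _ _] := hatP x; exact. Qed.

Lemma hat_eq0 x m : ~ perp (orb x) m -> hat x m = 0.
Proof. by move=> xm; apply/eqP/negP => /negP/hat_neq0. Qed.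

Lemma hatD x a b : perp (orb x) a -> perp (orb x) b ->
  hat x (a + b) = hat x a * hat x b.
Proof. by have [_ _ + _] := hatP x; exact. Qed.

Lemma hat0 x : hat x 0 = 1.
Proof.
have xp0 := perp0 S (orb x).
have x0 : hat x 0 != 0 by exact/hat_neq0.
by apply: (mulfI x0); rewrite -hatD// addr0 mulr1.
Qed.

Lemma hat_character x j : leJ (orb x) j -> character j (hat x).
Proof.
move=> xj; split=> [|a b ja jb]; first exact: hat0.
have xa : dualm (orb x) a := dualm_le xj ja.
have xb : dualm (orb x) b := dualm_le xj jb.
have [/(perp_addr xa xb)[]|nab] := pselect (perp (orb x) (a + b)); first exact: hatD.
rewrite hat_eq0//; apply/esym/eqP/negP => /negP; rewrite mulf_eq0.
by move=> /norP[/hat_neq0 ? /hat_neq0 ?]; apply: nab; exact: perpD.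
Qed.

Lemma hat_dualD x j a b : leJ (orb x) j -> dualm j a -> dualm j b ->
  hat x (a + b) = hat x a * hat x b.
Proof. by move=> xj ja jb; have [_ +] := hat_character xj; exact. Qed.

Lemma hat_dualMn x j m N : leJ (orb x) j -> dualm j m ->
  hat x (m *+ N) = hat x m ^+ N.
Proof.
move=> xj jm; elim: N => [|N IH]; first by rewrite hat0.
by rewrite mulrS exprS (hat_dualD xj)// ?IH//; exact: dualmMn.
Qed.

Lemma hatN x m : perp (orb x) m -> hat x (- m) = (hat x m)^-1.
Proof.
move=> xm; have xm0 : hat x m != 0 by exact/hat_neq0.
by apply: (mulIf xm0); rewrite mulVf// -hatD ?addNr ?hat0//; exact: perpN.
Qed.

Lemma hat_pi_dual j (z : affine_toric (\val (S j))) m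
    (x := \pi_(gluing (@glue_face R n Sigma)) (existT _ (S j) z) : X) :
  dualm j m -> hat x m = aeval z m.
Proof. by move=> jm; have [_ _ _ +] := hat_pi (existT _ (S j) z) => /(_ m jm) ->. Qed.

Lemma leJ_pi j (z : affine_toric (\val (S j))) :
  leJ (orb (\pi_(gluing (@glue_face R n Sigma)) (existT _ (S j) z))) j.
Proof. by have [] := hat_pi (existT _ (S j) z). Qed.

Lemma leJ_chart j y : leJ (orb (chart j y)) j.
Proof. exact: leJ_pi. Qed.

Lemma hat_chart j y m : character j y -> dualm j m -> hat (chart j y) m = y m.
Proof. by move=> jy jm; rewrite hat_pi_dual// aeval_mk. Qed.

Lemma chart_eq x j y : leJ (orb x) j -> character j y ->
  (forall m, dualm j m -> hat x m = y m) -> x = chart j y.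
Proof.
move=> xj jy xy; rewrite -[LHS](reprK (x : gluing _)); apply/gluing_piP.
apply: (point_gluing fanS Ssurj (hatP x)); split=> //=.
- by move=> m; exact: hat_neq0.
- by move=> a b; exact: hatD.
- by move=> m jm; rewrite aeval_mk// xy.
Qed.

Lemma toric_ext j x x' : leJ (orb x) j -> leJ (orb x') j ->
  (forall m, dualm j m -> hat x m = hat x' m) -> x = x'.
Proof.
move=> xj x'j xx'; have yc := hat_character x'j.
by rewrite (chart_eq xj yc)// [RHS](chart_eq x'j yc).
Qed.

Lemma orb_act t x : orb (toric_act Sigma t x) = orb x /\
  hat (toric_act Sigma t x) = fun m => t m * hat x m.
Proof.
rewrite /toric_act; set z := repr _; have [zk yk yD zy] : is_point z (orb x) (hat x) := hatP x.
apply: is_point_pi; split=> //=.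
- by move=> m; rewrite mulf_eq0 (negPf (torus_neq0 t m)) yk.
- by move=> a b ka kb; rewrite yD// torusD mulrACA.
- by move=> m sm; rewrite -zy// !(aevalE _ sm).
Qed.

Lemma aeval_cvg j (z0 : affine_toric (\val (S j))) m :
  (fun z : affine_toric (\val (S j)) => aeval z m) @ z0 --> (aeval z0 m : C).
Proof.
have FF : Filter (nbhs z0) by exact: nbhs_filter.
have [jm|njm] := pselect (dual_monoid (\val (S j)) m); last first.
  have E (z : affine_toric (\val (S j))) : aeval z m = 0.
    by rewrite /aeval; case: pselect.
  have -> : (fun z : affine_toric (\val (S j)) => aeval z m) = cst (0 : C).
    by apply/funext.
  rewrite [aeval z0 m]E; exact: (@cvg_cst C).
have fE : (fun z : affine_toric (\val (S j)) => aeval z m) =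
    fun z => affine_eval z (exist _ m (mem_set jm)).
  by apply/funext => z; exact: aevalE.
rewrite fE (aevalE z0 jm).
have /cvg_set_type/cvg_ptws : (fun z : affine_toric (\val (S j)) => z) @ z0 --> z0.
  exact: cvg_id.
exact.
Qed.

(** Seen in the chart of i, membership in the chart of j is the nonvanishing of the coordinate
    [sep i j], and there [hat x m] is a quotient of two coordinates, hence continuous. *)
Lemma chart_open j m (W : set C) : dualm j m -> open W ->
  open [set x | leJ (orb x) j /\ W (hat x m)].
Proof.
move=> jm oW; apply/gluing_open/sigT_openP => s; have [i sE] := Ssurj s; subst s.
have ji := sep_dualm fanS S i j; have [N iN] := dualm_shift_sep fanS i jm.
have -> : existT _ (S i) @^-1` (\pi_(gluing (@glue_face R n Sigma)) @^-1`
      [set x | leJ (orb x) j /\ W (hat x m)]) =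
    [set z : affine_toric (\val (S i)) | aeval z (sep i j) != 0 /\
      W (aeval z (m + sep i j *+ N) / aeval z (sep i j) ^+ N)].
  apply/seteqP; split=> z /=; set x := \pi_(_) _.
    move=> [xj Wx]; rewrite -!hat_pi_dual// -/x.
    have x0 : hat x (sep i j) != 0.
      by apply/hat_neq0/(perp_sep fanS) => //; exact: leJ_pi.
    split=> //; rewrite (hat_dualD (leJ_refl S (orb x))).
    - rewrite (hat_dualMn _ (@leJ_pi i z))// mulfK// expf_neq0//.
    - exact: dualm_le jm.
    - by apply: dualmMn; apply: dualm_le ji; exact: leJ_pi.
  rewrite -!hat_pi_dual// -/x => -[/hat_neq0 xij].
  have xj : leJ (orb x) j by apply/(perp_sep fanS _ (@leJ_pi i z)).
  rewrite (hat_dualD (leJ_refl S (orb x))).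
  - rewrite (hat_dualMn _ (@leJ_pi i z))// mulfK// expf_neq0//.
    exact/hat_neq0.
  - exact: dualm_le jm.
  - by apply: dualmMn; apply: dualm_le ji; exact: leJ_pi.
rewrite openE => z /= [z0 Wz]; have FF : Filter (nbhs z) by exact: nbhs_filter.
have fz : (fun z : affine_toric (\val (S i)) =>
    aeval z (m + sep i j *+ N) / aeval z (sep i j) ^+ N) @ z -->
    (aeval z (m + sep i j *+ N) / aeval z (sep i j) ^+ N : C).
  apply: cvg_complexM; first exact: (@aeval_cvg i z (m + sep i j *+ N)).
  apply: cvg_complexV; first by rewrite expf_neq0.
  by apply: cvg_complexX; exact: (@aeval_cvg i z (sep i j)).
have nW := fz _ (open_nbhs_nbhs (conj oW Wz)).
have n0 := near_neq0 z0 (@aeval_cvg i z (sep i j)).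
exact: (@filterS2 _ (nbhs z) FF _ _ _ (fun w => @conj _ _) (n0 FF) nW).
Qed.

Lemma near_orb x0 j : leJ (orb x0) j -> \forall x \near x0, leJ (orb x) j.
Proof.
move=> xj; have := @chart_open j 0 setT (dualm0 S j) openT.
move=> oA; have := open_nbhs_nbhs (conj oA (conj xj Logic.I) : open_nbhs x0 _).
by apply: filterS => x [].
Qed.

Lemma hat_cvg x0 j m : leJ (orb x0) j -> dualm j m ->
  (fun x => hat x m) @ x0 --> (hat x0 m : C).
Proof.
move=> xj jm A Ax.
have [W [oW Wx] WA] : exists2 W, open_nbhs (hat x0 m : C) W & W `<=` A.
  by have : nbhs (hat x0 m : C) A := Ax; rewrite nbhsE.
have oA := chart_open jm oW.
have := open_nbhs_nbhs (conj oA (conj xj Wx) : open_nbhs x0 _).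
by apply: filterS => x [_ /WA].
Qed.

(** Convergence is tested on the coordinates of a single chart containing the limit; all maps into X
    below are treated in this way. *)
Lemma cvg_toric (T : Type) (F : set_system T) (FF : Filter F) (f : T -> X) x0 j :
  leJ (orb x0) j -> (\forall t \near F, leJ (orb (f t)) j) ->
  (forall m, dualm j m -> (fun t => hat (f t) m) @ F --> (hat x0 m : C)) ->
  f @ F --> x0.
Proof.
move=> xj fj fx.
have toE x : leJ (orb x) j -> x = chart j (hat x).
  by move=> ?; apply: chart_eq => //; exact: hat_character.
rewrite (toE _ xj).
apply: (@cvg_trans _ ((fun t => chart j (hat (f t))) @ F)).
  by apply: near_eq_cvg; apply: filterS fj => t /toE.
have : (fun t => affine_mk (S j) (hat (f t))) @ F --> affine_mk (S j) (hat x0).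
  apply/cvg_set_type/cvg_ptws => a.
  have ja : dualm j (\val a) by exact: set_mem (valP a).
  rewrite -[X in _ --> X]/(affine_eval _ _) -aeval_val aeval_mk//; last exact: hat_character.
  apply: cvg_trans (fx _ ja); apply: near_eq_cvg; apply: filterS fj => t tj.
  rewrite -[RHS]/(affine_eval _ _) -aeval_val aeval_mk//.
  exact: hat_character.
move=> H A Ax.
have := @gluing_pi_continuous _ (@glue_face R n Sigma) _ A Ax.
move=> /(@existT_continuous _ (fun s : Sigma => affine_toric (\val s)) (S j)).
exact: H.
Qed.

Lemma orb_toric_act t x : orb (act t x) = orb x.
Proof. by have [] := orb_act t x. Qed.

Lemma hat_toric_act t x m : hat (act t x) m = t m * hat x m.
Proof. by have [_ ->] := orb_act t x. Qed.

Lemma toric_act_cvg (t0 : torus R n) (x0 : X) :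
  (fun p : torus R n * X => act p.1 p.2) @ (t0, x0) --> act t0 x0.
Proof.
have x0' : leJ (orb x0) (orb x0) by [].
apply: (@cvg_toric _ (nbhs (t0, x0)) _
  (fun p => act p.1 p.2) _ (orb x0)).
- by rewrite orb_toric_act.
- have nj := @cvg_snd _ _ (nbhs t0) (nbhs x0) (nbhs_filter t0) _
    (near_orb x0').
  apply: (@filterS _ (nbhs (t0, x0)) _ _ _ _ nj) => p.
  by rewrite /= orb_toric_act.
- move=> m jm; rewrite hat_toric_act (_ : (fun p => _) =
    fun p : torus R n * X => p.1 m * hat p.2 m); last first.
    by apply/funext => p; rewrite hat_toric_act.
  apply: (@cvg_complexM R _ (nbhs (t0, x0)) _ (fun p => p.1 m)
    (fun p => hat p.2 m)).
    exact: (cvg_comp _ _ cvg_fst ((@torus_cvg R n _ (nbhs t0) _ id t0).1 cvg_id m)).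
  exact: (cvg_comp _ _ cvg_snd (hat_cvg x0' jm)).
Qed.

Lemma toric_action : is_action act.
Proof.
split=> [x|s t x|[t0 x0]].
- apply: (@toric_ext (orb x)).
  + by rewrite orb_toric_act.
  + by [].
  + by move=> m _; rewrite hat_toric_act mul1r.
- apply: (@toric_ext (orb x)).
  + by rewrite orb_toric_act.
  + by rewrite !orb_toric_act.
  + by move=> m _; rewrite !hat_toric_act mulrA.
- exact: toric_act_cvg.
Qed.

(* Continuous across the boundary of the chart of j: towards the orbit of     *)
(* another cone i, the character [sep j i] is unbounded on that chart.        *)
Definition lam j x : R :=
  if `[< leJ (orb x) j >] then (1 + \sum_i cabs (hat x (sep j i)))^-1 else 0.

Lemma lam_den_gt0 j x : 0 < 1 + \sum_i cabs (hat x (sep j i)).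
Proof. by rewrite ltr_wpDr// sumr_ge0// => i _; exact: cabs_ge0. Qed.

Lemma lam_gt0 j x : 0 < lam j x <-> leJ (orb x) j.
Proof.
rewrite /lam; case: asboolP => xj; last by rewrite ltxx.
by split=> // _; rewrite invr_gt0 lam_den_gt0.
Qed.

Lemma lam_ge0 j x : 0 <= lam j x.
Proof.
by rewrite /lam; case: asboolP => // _; rewrite invr_ge0 ltW// lam_den_gt0.
Qed.

Lemma lam_toric_act j t x : lam j (act t x) = lam j x.
Proof.
rewrite /lam orb_toric_act; case: asboolP => // _.
congr (_^-1); congr (1 + _); apply: eq_bigr => i _.
by rewrite hat_toric_act cabsM cabs_norm1 ?mul1r// torus_norm.
Qed.

(** If x0 lies outside the chart of j and i is its orbit cone, then minus [sep j i] is regular on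
    the chart of i and vanishes at x0. Near x0, [lam j] is at most the modulus of that coordinate,
    so it tends to 0. *)
Lemma lam_cvg j (x0 : X) : lam j @ x0 --> lam j x0.
Proof.
have FF : Filter (nbhs x0) := nbhs_filter x0.
have [xj|nxj] := pselect (leJ (orb x0) j).
  apply: (@cvg_near_eq _ (nbhs x0) FF R (lam j)
      (fun x => (1 + \sum_i cabs (hat x (sep j i)))^-1)).
    apply: (@filterS _ (nbhs x0) FF _ _ _ (near_orb xj)) => x xj'.
    by rewrite /lam asboolT.
  rewrite /lam asboolT//; apply: cvgV; first by rewrite gt_eqF// lam_den_gt0.
  apply: cvgD; first exact: cvg_cst.
  apply: cvg_bigsum => i _; apply: cvg_cabs.
  exact: (hat_cvg xj (sep_dualm fanS S j i)).
have x0' : leJ (orb x0) (orb x0) by [].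
set i := orb x0 in x0'.
have iNs := sepN_dualm fanS S j i.
have hat00 : hat x0 (- sep j i) = 0.
  apply: hat_eq0 => /perpN; rewrite opprK => H; apply: nxj => u xu.
  exact: (sep_cone_r xu (H u xu)).
have hc := hat_cvg x0' iNs; rewrite hat00 in hc.
have -> : lam j x0 = 0 by rewrite /lam asboolF.
have ca := @cvg_cabs _ _ _ FF _ _ hc; rewrite cabs0 in ca.
have c0 : (fun=> 0 : R) @ x0 --> (0 : R) := @cvg_cst R 0 _ (nbhs x0) FF.
apply: (@squeeze_cvgr X (nbhs x0) FF R (fun=> 0) _ (lam j) _ 0 c0 ca).
apply: (@filterS _ (nbhs x0) FF _ _ _ (near_orb x0')) => x xi.
  rewrite lam_ge0/= /lam; case: asboolP => xj; last exact: cabs_ge0.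
  have xs : perp (orb x) (sep j i) by apply/(perp_sep fanS).
  have xs0 : 0 < cabs (hat x (sep j i)) by rewrite cabs_gt0; exact/hat_neq0.
  rewrite hatN// cabsV lef_pV2 ?posrE ?lam_den_gt0//.
  rewrite (bigD1 i)//= addrCA lerDl addr_ge0// sumr_ge0// => k _.
  exact: cabs_ge0.
Qed.

(** The continuous weights force inseparable points to lie in the same charts, where the coordinates
    separate them. *)
Lemma toric_hausdorff : hausdorff_space X.
Proof.
move=> p q pq.
have E j : lam j p = lam j q.
  by apply: (cluster_cvg_eq _ _ _ pq); [exact: Rhausdorff|exact: lam_cvg..].
have o : leJ (orb p) (orb q) by apply/lam_gt0; rewrite E; exact/lam_gt0.
have o' : leJ (orb q) (orb p) by apply/lam_gt0; rewrite -E; exact/lam_gt0.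
apply: (@toric_ext (orb p)) => // m jm.
apply: (cluster_cvg_eq (@complex_hausdorff R) _ _ pq (f := fun x => hat x m : C)).
  exact: (hat_cvg (leJ_refl S (orb p)) jm).
exact: (hat_cvg o' jm).
Qed.

Definition lam_max x : R := \big[Num.max/0]_j lam j x.

Lemma lam_max_gt0 x : 0 < lam_max x.
Proof.
apply: lt_le_trans (le_bigmax _ _ (orb x)).
exact/lam_gt0.
Qed.

(** Dividing by the largest weight puts the tuple on the faces of the cube where some coordinate is
    1. *)
Definition Lam j x : R := lam j x / lam_max x.

Lemma Lam_ge0 j x : 0 <= Lam j x.
Proof. by rewrite divr_ge0 ?lam_ge0// ltW// lam_max_gt0. Qed.

Lemma Lam_le1 j x : Lam j x <= 1.
Proof. by rewrite ler_pdivrMr ?lam_max_gt0// mul1r le_bigmax. Qed.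

Lemma Lam_eq1 x : exists j, Lam j x = 1.
Proof.
have [j _ jE] : {j | j \in predT & \big[Num.max/0]_j lam j x = lam j x}.
  by apply: (eq_bigmax (orb x)) => // i _; exact: lam_ge0.
exists j; rewrite /Lam /lam_max jE divff// -jE.
by rewrite gt_eqF// lam_max_gt0.
Qed.

Lemma Lam_gt0 j x : 0 < Lam j x <-> leJ (orb x) j.
Proof. by rewrite -lam_gt0 /Lam pmulr_lgt0// invr_gt0 lam_max_gt0. Qed.

Lemma Lam_toric_act j t x : Lam j (act t x) = Lam j x.
Proof.
rewrite /Lam /lam_max lam_toric_act; congr (_ / _).
by apply: eq_bigr => i _; rewrite lam_toric_act.
Qed.

Lemma Lam_cvg j (x0 : X) : Lam j @ x0 --> Lam j x0.
Proof.
have FF : Filter (nbhs x0) := nbhs_filter x0.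
refine (@cvgM R X (nbhs x0) FF (lam j) (fun x => (lam_max x)^-1) _ _
  (@lam_cvg j x0) _).
apply: (@cvgV R X (nbhs x0) FF lam_max); first by rewrite gt_eqF// lam_max_gt0.
apply: (@cvg_bigmax R X (nbhs x0) FF J (fun j => lam j)) => i.
exact: lam_cvg.
Qed.

End ToricCoordinates.

(** * Tori, orbits and disks *)

Section SetType.
Context {U : topologicalType} (A : set U).

Lemma compact_set_type : compact A -> compact [set: A].
Proof.
move=> cA F FF _; have GA : (fmap set_val F) A.
  apply: (@filterS _ F _ setT) => [x _|]; last exact: filterT.
  exact: set_mem (valP x).
have [p [Ap clp]] := cA _ (fmap_proper_filter set_val FF) GA.
exists (exist _ p (mem_set Ap)); split=> // B V FB [_ [[W oW <-] Wp WV]].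
have FB' : (fmap set_val F) (set_val @` B).
  by apply: (@filterS _ F _ B) => // x Bx; exists x.
have [_ [[x Bx <-] Wx]] := clp _ _ FB' (open_nbhs_nbhs (conj oW Wp)).
by exists x; split=> //; exact: WV.
Qed.

Lemma set_val_cvg (a : A) : (set_val : A -> U) @ a --> set_val a.
Proof. exact: initial_continuous. Qed.

Lemma hausdorff_set_type : hausdorff_space U -> hausdorff_space A.
Proof.
move=> hU p q pq; apply: val_inj.
by apply: (cluster_cvg_eq hU _ _ pq); exact: set_val_cvg.
Qed.

End SetType.

Lemma closed_preimage (U V : topologicalType) (f : U -> V) (A : set V) :
  continuous f -> closed A -> closed (f @^-1` A).
Proof. by move=> cf cA; apply: closed_comp => // x _; exact: cf. Qed.

Lemma hausdorff_closed1 (U : topologicalType) (x : U) :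
  hausdorff_space U -> closed [set x].
Proof. by move=> hU; exact/accessible_closed_set1/hausdorff_accessible. Qed.

Lemma ptws_hausdorff (I : Type) (U : topologicalType) :
  hausdorff_space U -> hausdorff_space {ptws I -> U}.
Proof.
move=> hU p q pq; apply/funext => i.
have ev (f : {ptws I -> U}) : (fun g : {ptws I -> U} => g i) @ f --> f i.
  exact: ((@cvg_ptws _ (nbhs f) (nbhs_filter f) I U id f).1 cvg_id i).
exact: (cluster_cvg_eq hU (ev p) (ev q) pq).
Qed.

Lemma prod_hausdorff (U V : topologicalType) :
  hausdorff_space U -> hausdorff_space V -> hausdorff_space (U * V)%type.
Proof.
move=> hU hV [p1 p2] [q1 q2] pq; congr (_, _).
  exact: (cluster_cvg_eq (f := fst) hU cvg_fst cvg_fst pq).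
exact: (cluster_cvg_eq (f := snd) hV cvg_snd cvg_snd pq).
Qed.

Section Circle.
Context {R : realType}.
Local Notation C := (R[i]^o).

Lemma cabs_continuous : continuous (cabs : C -> R).
Proof. by move=> z; apply: (@cvg_cabs R _ (nbhs z) (nbhs_filter z) id). Qed.

Lemma circle_compact : compact [set z : C | `|z| = 1].
Proof.
pose f (p : R * R) : C := p.1%:C + 'i * p.2%:C.
have cf : continuous f.
  move=> p; apply: (@cvgD R[i] C).
    by apply: cvg_real_complex; exact: cvg_fst.
  apply: cvg_complexM; first exact: (@cvg_cst C).
  by apply: cvg_real_complex; exact: cvg_snd.
have cI := @segment_compact R (-1) 1.
have cB : compact (f @` (`[-1, 1]%classic `*` `[-1, 1]%classic)).
  apply: continuous_compact; first exact: continuous_subspaceT.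
  exact: compact_setX.
apply: subclosed_compact cB _ => [|z z1].
  have -> : [set z : C | `|z| = 1] = cabs @^-1` [set 1].
    apply/seteqP; split=> z /=; first exact: cabs_norm1.
    by move=> z1; rewrite -cabsE z1.
  apply: (closed_preimage (f := cabs : C -> R)); first exact: cabs_continuous.
  exact: hausdorff_closed1 (@Rhausdorff R).
exists (complex.Re z, complex.Im z); last by rewrite /f/= -complexE.
have := add_Re2_Im2 z; rewrite z1 expr1n => /complexI e.
have sq (a : R) : a ^+ 2 <= 1 -> -1 <= a <= 1.
  by move=> a1; rewrite -ler_norml -(@expr_le1 _ 2)// real_normK ?num_real.
by split; rewrite /= in_itv/=; apply: sq; rewrite -e ?lerDl ?lerDr sqr_ge0.
Qed.

End Circle.

(** * Compactness of the torus and its orbits *)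

Section TorusTopology.
Context {R : realType} {n : nat}.
Local Notation T := (torus R n).
Local Notation C := (R[i]^o).

Lemma ptws_eval_continuous (I : Type) (U : topologicalType) (i : I) :
  continuous (fun f : {ptws I -> U} => f i).
Proof.
move=> f; exact: ((@cvg_ptws _ (nbhs f) (nbhs_filter f) I U id f).1 cvg_id i).
Qed.

(** A closed subset of a product of circles, by Tychonoff's theorem. *)
Lemma torus_points_compact : compact (@torus_points R n).
Proof.
have cP : compact [set f : {ptws 'rV[int]_n -> C} | forall m, `|f m| = 1].
  exact: (@tychonoff _ (fun=> C) (fun=> [set z : C | `|z| = 1])
    (fun=> circle_compact)).
apply: subclosed_compact cP _ => [|f []//].
have -> : @torus_points R n =
    (\bigcap_m [set f : {ptws 'rV[int]_n -> C} | cabs (f m) = 1]) `&`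
    (\bigcap_(p : 'rV[int]_n * 'rV[int]_n)
       [set f : {ptws 'rV[int]_n -> C} | f (p.1 + p.2) - f p.1 * f p.2 = 0]).
  apply/seteqP; split=> f /=.
    move=> [f1 fD]; split=> [m _|p _] /=; first exact: cabs_norm1.
    by rewrite fD subrr.
  move=> [f1 fD]; split=> [m|m m']; first by rewrite -cabsE f1.
  by apply/eqP; rewrite -subr_eq0; apply/eqP/(fD (m, m')).
apply: closedI.
  apply: closed_bigI => m _.
  apply: (closed_preimage (f := fun f : {ptws 'rV[int]_n -> C} => cabs (f m))
    (A := [set 1 : R])).
    move=> f; apply: (@cvg_cabs R _ (nbhs f) (nbhs_filter f) (fun f => f m)).
    exact: (@ptws_eval_continuous _ C m f).
  exact: hausdorff_closed1 (@Rhausdorff R).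
apply: closed_bigI => p _.
apply: (closed_preimage (f := fun f : {ptws 'rV[int]_n -> C} =>
    f (p.1 + p.2) - f p.1 * f p.2 : C) (A := [set 0 : C])).
  move=> f; apply: (@cvgB R[i] C _ (nbhs f) (nbhs_filter f)
    (fun f => f (p.1 + p.2)) (fun f => f p.1 * f p.2)).
    exact: (@ptws_eval_continuous _ C (p.1 + p.2) f).
  apply: (@cvg_complexM R _ (nbhs f) (nbhs_filter f) (fun f => f p.1)
    (fun f => f p.2)).
    exact: (@ptws_eval_continuous _ C p.1 f).
  exact: (@ptws_eval_continuous _ C p.2 f).
exact: hausdorff_closed1 (@complex_hausdorff R).
Qed.

Lemma torus_compact : compact [set: T].
Proof. exact: compact_set_type torus_points_compact. Qed.

Lemma torus_eval_cvg (t : T) m : (fun s : T => s m) @ t --> (t m : C).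
Proof. exact: ((@torus_cvg R n _ (nbhs t) (nbhs_filter t) id t).1 cvg_id m). Qed.

Lemma torus_mulr_continuous (t : T) : continuous (fun s : T => (s * t)%g).
Proof.
move=> s; apply: ((@torus_cvg R n _ (nbhs s) (nbhs_filter s)
  (fun s : T => (s * t)%g) (s * t)%g).2) => m.
apply: (@cvg_complexM R _ (nbhs s) (nbhs_filter s) (fun s : T => s m)
  (fun=> t m)).
  exact: torus_eval_cvg.
exact: (@cvg_cst C _ _ (nbhs s) (nbhs_filter s)).
Qed.

Lemma torus_mull_continuous (t : T) : continuous (fun s : T => (t * s)%g).
Proof.
move=> s; apply: ((@torus_cvg R n _ (nbhs s) (nbhs_filter s)
  (fun s : T => (t * s)%g) (t * s)%g).2) => m.
apply: (@cvg_complexM R _ (nbhs s) (nbhs_filter s) (fun=> t m)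
  (fun s : T => s m)).
  exact: (@cvg_cst C _ _ (nbhs s) (nbhs_filter s)).
exact: torus_eval_cvg.
Qed.

Section Orbit.
Context {H : set T} (HP : closed_subgroup H).
Local Notation pi := (\pi_(gluing (same_coset H))).
Local Notation orbit := (@Defs.orbit R n).

Lemma orbit_piP (s t : T) : pi s = pi t <-> H (s^-1 * t)%g.
Proof.
split=> [/gluing_piP|st]; last first.
  by apply/gluing_piP; exact: Relation_Operators.rst_step.
elim=> {s t} [s t//|s|s t _ Hst|s t u _ Hst _ Htu].
- by rewrite mulVg; exact: subgroup_one HP.
- by rewrite -[s in (_ * s)%g]invgK -invgM; exact: (subgroup_inv HP).
- have -> : (s^-1 * u = (s^-1 * t) * (t^-1 * u))%g by rewrite mulgA mulgK.
  exact: (subgroup_mul HP).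
Qed.

Lemma orbit_actE (s t : T) : orbit_act s (pi t : orbit H) = pi (s * t)%g.
Proof.
apply/orbit_piP; rewrite invgM -mulgA mulKg.
by apply/orbit_piP; rewrite reprK.
Qed.

(** The saturation of A is a union of translates. Openness is what lets continuity descend from T x
    D^k to T/H x D^k in [cube_char_continuous]. *)
Lemma orbit_pi_open (A : set T) : open A -> open (pi @` A : set (orbit H)).
Proof.
move=> oA; apply/gluing_open.
have -> : pi @^-1` (pi @` A) = \bigcup_(h in H) ((fun s => s * h)%g @^-1` A).
  apply/seteqP; split=> s /=.
    move=> [t At /esym/orbit_piP st]; exists (s^-1 * t)%g => //=.
    by rewrite mulVKg.
  move=> [h Hh /= Ash]; exists (s * h)%g => //; apply/esym/orbit_piP.
  by rewrite mulKg.
apply: bigcup_open => h _; apply: open_comp => // s _.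
exact: torus_mulr_continuous.
Qed.

Lemma orbit_pi_surj (a : orbit H) : exists t, a = pi t.
Proof. by exists (repr (a : gluing (same_coset H))); rewrite reprK. Qed.

Lemma orbit_compact : compact [set: orbit H].
Proof.
have -> : [set: orbit H] = pi @` [set: T].
  by apply/seteqP; split=> // a _; have [t ->] := orbit_pi_surj a; exists t.
apply: continuous_compact torus_compact.
apply: continuous_subspaceT; exact: gluing_pi_continuous.
Qed.

Lemma orbit_closed1 (a : orbit H) : closed [set a].
Proof.
have [t ->] := orbit_pi_surj a; rewrite -openC; apply/gluing_open.
have -> : pi @^-1` (~` [set pi t]) = ~` ((fun s => t^-1 * s)%g @^-1` H).
  apply/seteqP; split=> s /= ns st; apply: ns; first exact/esym/orbit_piP.
  exact/orbit_piP/esym.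
rewrite openC; apply: closed_preimage; first exact: torus_mull_continuous.
exact: subgroup_closed HP.
Qed.

End Orbit.
End TorusTopology.

(** * The Euclidean disk and the cube *)

Section DiskToCube.
Context {R : realType} {k : nat}.
Implicit Types (v : 'rV[R]_k) (a : R).

Definition supnorm v : R := \big[Num.max/0]_i `|v 0 i|.
Definition eucnorm v : R := Num.sqrt (sqnorm v).

Lemma supnorm_ge0 v : 0 <= supnorm v.
Proof. exact: bigmax_ge_id. Qed.

Lemma le_supnorm v i : `|v 0 i| <= supnorm v.
Proof. exact: (le_bigmax _ (fun i => `|v 0 i|)). Qed.

Lemma supnorm_lt v a : 0 < a -> (supnorm v < a) <-> forall i, `|v 0 i| < a.
Proof.
move=> a0; split=> [va i|va]; first exact: le_lt_trans (le_supnorm v i) va.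
by apply: bigmax_lt.
Qed.

Lemma sqnorm_ge0 v : 0 <= sqnorm v.
Proof. by apply: sumr_ge0 => i _; exact: sqr_ge0. Qed.

Lemma eucnorm_ge0 v : 0 <= eucnorm v.
Proof. exact: sqrtr_ge0. Qed.

Lemma supnormZ a v : supnorm (a *: v) = `|a| * supnorm v.
Proof.
rewrite /supnorm; elim/big_ind2 : _ => [|x y x' y' -> ->|i _].
- by rewrite mulr0.
- by rewrite maxr_pMr.
- by rewrite mxE normrM.
Qed.

Lemma sqnormZ a v : sqnorm (a *: v) = a ^+ 2 * sqnorm v.
Proof. by rewrite /sqnorm mulr_sumr; apply: eq_bigr => i _; rewrite mxE exprMn. Qed.

Lemma eucnormZ a v : eucnorm (a *: v) = `|a| * eucnorm v.
Proof. by rewrite /eucnorm sqnormZ sqrtrM ?sqr_ge0// sqrtr_sqr. Qed.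

Lemma supnorm_eq0 v : (supnorm v == 0) = (v == 0).
Proof.
apply/eqP/eqP => [v0|->]; last first.
  by rewrite /supnorm; elim/big_rec: _ => // i x _ ->; rewrite mxE normr0 maxxx.
apply/rowP => i; rewrite mxE; apply/eqP.
by rewrite -normr_eq0 eq_le normr_ge0 andbT -v0 le_supnorm.
Qed.

Lemma eucnorm_eq0 v : (eucnorm v == 0) = (v == 0).
Proof.
apply/eqP/eqP => [/eqP|->]; last first.
  by rewrite /eucnorm /sqnorm big1 ?sqrtr0// => i _; rewrite mxE expr0n.
rewrite /eucnorm sqrtr_eq0 => v0; apply/rowP => i; rewrite mxE.
have : sqnorm v == 0 by rewrite eq_le v0 sqnorm_ge0.
rewrite psumr_eq0 => [/allP/(_ i)|j _]; last exact: sqr_ge0.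
by rewrite mem_index_enum sqrf_eq0 => /(_ isT)/eqP.
Qed.

(** Radial rescaling that carries the Euclidean norm to the sup norm, with inverse [diskmap]; both
    fix 0, whatever the quotient of norms there. *)
Definition cubemap v : 'rV[R]_k := (eucnorm v / supnorm v) *: v.
Definition diskmap v : 'rV[R]_k := (supnorm v / eucnorm v) *: v.

Lemma supnorm_cubemap v : supnorm (cubemap v) = eucnorm v.
Proof.
have [->|v0] := eqVneq v 0.
  by rewrite /cubemap scaler0 (eqP (_ : supnorm 0 == 0)) ?supnorm_eq0//;
    apply/esym/eqP; rewrite eucnorm_eq0.
rewrite supnormZ ger0_norm ?divr_ge0 ?eucnorm_ge0 ?supnorm_ge0// divfK//.
by rewrite supnorm_eq0.
Qed.

Lemma eucnorm_diskmap v : eucnorm (diskmap v) = supnorm v.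
Proof.
have [->|v0] := eqVneq v 0.
  by rewrite /diskmap scaler0 (eqP (_ : eucnorm 0 == 0)) ?eucnorm_eq0//;
    apply/esym/eqP; rewrite supnorm_eq0.
rewrite eucnormZ ger0_norm ?divr_ge0 ?eucnorm_ge0 ?supnorm_ge0// divfK//.
by rewrite eucnorm_eq0.
Qed.

Lemma diskmapK v : cubemap (diskmap v) = v.
Proof.
have [->|v0] := eqVneq v 0; first by rewrite /diskmap /cubemap !scaler0.
have s0 : supnorm v != 0 by rewrite supnorm_eq0.
have e0 : eucnorm v != 0 by rewrite eucnorm_eq0.
rewrite {1}/cubemap eucnorm_diskmap /diskmap supnormZ scalerA.
rewrite ger0_norm ?divr_ge0 ?eucnorm_ge0 ?supnorm_ge0//.
by rewrite -[RHS]scale1r; congr (_ *: _); field; rewrite s0 e0.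
Qed.

Lemma cubemapK v : diskmap (cubemap v) = v.
Proof.
have [->|v0] := eqVneq v 0; first by rewrite /diskmap /cubemap !scaler0.
have s0 : supnorm v != 0 by rewrite supnorm_eq0.
have e0 : eucnorm v != 0 by rewrite eucnorm_eq0.
rewrite {1}/diskmap supnorm_cubemap /cubemap eucnormZ scalerA.
rewrite ger0_norm ?divr_ge0 ?eucnorm_ge0 ?supnorm_ge0//.
by rewrite -[RHS]scale1r; congr (_ *: _); field; rewrite s0 e0.
Qed.

Lemma sqnormE v : sqnorm v = eucnorm v ^+ 2.
Proof. by rewrite /eucnorm sqr_sqrtr// sqnorm_ge0. Qed.

Lemma sqnorm_le1 v : (sqnorm v <= 1) = (eucnorm v <= 1).
Proof. by rewrite sqnormE expr_le1// eucnorm_ge0. Qed.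

Lemma sqnorm_lt1 v : (sqnorm v < 1) = (eucnorm v < 1).
Proof. by rewrite sqnormE expr_lt1// eucnorm_ge0. Qed.

Lemma coord_cvg v i : (fun w : 'rV[R]_k => w 0 i) @ v --> v 0 i.
Proof. exact: coord_continuous. Qed.

Lemma sqnorm_continuous : continuous (@sqnorm R k).
Proof.
move=> v; apply: (@cvg_bigsum R _ (nbhs v) (nbhs_filter v) _ _
  (fun i (w : 'rV[R]_k) => w 0 i ^+ 2) (fun i => v 0 i ^+ 2)) => i _.
rewrite expr2 (_ : (fun w => _) = fun w : 'rV[R]_k => w 0 i * w 0 i)//.
apply: (@cvgM R _ (nbhs v) (nbhs_filter v) (fun w => w 0 i) (fun w => w 0 i));
  exact: coord_cvg.
Qed.

Lemma eucnorm_continuous : continuous (eucnorm : 'rV[R]_k -> R).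
Proof.
move=> v; apply: (@continuous_comp _ _ _ (@sqnorm R k) Num.sqrt v).
  exact: sqnorm_continuous.
exact: sqrt_continuous.
Qed.

Lemma supnorm_continuous : continuous (supnorm : 'rV[R]_k -> R).
Proof.
move=> v; apply: (@cvg_bigmax R _ (nbhs v) (nbhs_filter v) _
  (fun i (w : 'rV[R]_k) => `|w 0 i|) (fun i => `|v 0 i|)) => i.
apply: (@cvg_norm R R _ (nbhs v) (nbhs_filter v) (fun w => w 0 i)).
exact: coord_cvg.
Qed.

(** At the origin the quotient of norms has no limit in general, but the coordinates are bounded by
    the Euclidean norm. *)
Lemma cubemap_cvg v i : (fun w : 'rV[R]_k => cubemap w 0 i) @ v --> cubemap v 0 i.
Proof.
have E (w : 'rV[R]_k) : cubemap w 0 i = eucnorm w / supnorm w * w 0 i.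
  by rewrite mxE.
have [->|v0] := eqVneq v 0.
  have -> : cubemap 0 0 i = 0 by rewrite /cubemap scaler0 mxE.
  have e0 : eucnorm @ (0 : 'rV[R]_k) --> (0 : R).
    rewrite -[X in _ --> X](eqP (_ : eucnorm 0 == 0)) ?eucnorm_eq0//.
    exact: eucnorm_continuous.
  have c0 := @cvg_cst R 0 _ (nbhs (0 : 'rV[R]_k)) (nbhs_filter _).
  have n0 : (fun w : 'rV[R]_k => `|cubemap w 0 i|) @ (0 : 'rV[R]_k) --> (0 : R).
    apply: (@squeeze_cvgr _ (nbhs (0 : 'rV[R]_k)) (nbhs_filter _) R (fun=> 0)
      eucnorm _ _ 0 c0 e0).
    by apply: nearW => w; rewrite normr_ge0 -supnorm_cubemap le_supnorm.
  exact: (@norm_cvg0 R R _ (nbhs (0 : 'rV[R]_k)) (nbhs_filter _)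
    (fun w => cubemap w 0 i)).
have FF : Filter (nbhs v) := nbhs_filter v.
rewrite E (_ : (fun w => _) = fun w => eucnorm w / supnorm w * w 0 i); last first.
  by apply/funext => w; rewrite E.
apply: (@cvgM R _ (nbhs v) FF (fun w => eucnorm w / supnorm w)
  (fun w => w 0 i)); last exact: coord_cvg.
apply: (@cvgM R _ (nbhs v) FF (eucnorm) (fun w => (supnorm w)^-1)).
  exact: eucnorm_continuous.
apply: (@cvgV R _ (nbhs v) FF (supnorm)); first by rewrite supnorm_eq0.
exact: supnorm_continuous.
Qed.

Lemma disk_compact : compact [set: disk (R := R) k].
Proof.
apply: compact_set_type.
have cB : compact [set v : 'rV[R]_k | forall i, `[(-1 : R), 1]%classic (v 0 i)].
  by apply: (@rV_compact R k (fun=> `[(-1 : R), 1]%classic)) => i; exact: segment_compact.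
apply: subclosed_compact cB _ => [|v /= v1 i].
  apply: (closed_preimage (f := (@sqnorm R k)) (A := [set x | x <= 1])).
    exact: sqnorm_continuous.
  exact: closed_le.
rewrite /= in_itv/= -ler_norml -(@expr_le1 _ 2)// real_normK ?num_real//.
apply: le_trans v1; rewrite /sqnorm (bigD1 i)//= lerDl sumr_ge0// => j _.
exact: sqr_ge0.
Qed.

Lemma disk_hausdorff : hausdorff_space (disk (R := R) k).
Proof. by apply: hausdorff_set_type; exact: norm_hausdorff. Qed.

End DiskToCube.

(** * Cubical T-CW structures *)

(* A face of the cube [0,1]^J is given by its set of free coordinates and its  *)
(* set of coordinates equal to 1.                                             *)
Section CubeFaces.
Context {R : realType} {J : finType}.
Implicit Types (e : {set J} * {set J}) (c : J -> R).

Definition cube_face e c :=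
  (forall j, j \in e.1 -> 0 <= c j <= 1) /\
  (forall j, j \notin e.1 -> c j = (j \in e.2)%:R).

Definition open_face e c :=
  (forall j, j \in e.1 -> 0 < c j < 1) /\
  (forall j, j \notin e.1 -> c j = (j \in e.2)%:R).

Lemma open_face_face e c : open_face e c -> cube_face e c.
Proof.
by move=> [eA eB]; split=> // j /eA /andP[/ltW -> /ltW ->].
Qed.

Definition face_disjoint e := forall j, j \in e.1 -> j \notin e.2.

Lemma open_face_eq e e' c : face_disjoint e -> face_disjoint e' ->
  open_face e c -> open_face e' c -> e = e'.
Proof.
have freeE f : open_face f c -> forall j, (j \in f.1) = (0 < c j < 1).
  move=> [fA fB] j; case: (boolP (j \in f.1)) => [/fA ->//|/fB ->].
  by case: (j \in f.2); rewrite ?ltxx ?andbF.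
have oneE f : face_disjoint f -> open_face f c ->
    forall j, (j \in f.2) = (c j == 1).
  move=> df [fA fB] j; case: (boolP (j \in f.1)) => [jf|/fB ->].
    rewrite (negPf (df _ jf)); have /andP[_ j1] := fA _ jf.
    by rewrite lt_eqF.
  by case: (j \in f.2); rewrite ?eqxx// eq_sym oner_eq0.
case: e e' => [A B] [A' B'] d d' ec ec'; congr (_, _); apply/setP => j.
  by rewrite (freeE _ ec) (freeE _ ec').
by rewrite (oneE _ d ec) (oneE _ d' ec').
Qed.

Section Coordinates.
Context {k : nat}.
Implicit Types (v : 'rV[R]_k).

(** Indexing by natural numbers, with default 0, avoids a cast along the equality of k with the
    number of free coordinates. *)
Definition row_nth v (i : nat) : R := oapp (fun i' => v 0 i') 0 (insub i).

Lemma row_nthE v (i : 'I_k) : row_nth v i = v 0 i.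
Proof. by rewrite /row_nth valK. Qed.

(** The free coordinates, in the order of [enum e.1], are those of the cube rescaled from [-1,1] to
    [0,1]. *)
Definition face_coord e v (j : J) : R :=
  if j \in e.1 then (1 + row_nth (cubemap v) (index j (enum e.1))) / 2
  else (j \in e.2)%:R.

Context {e : {set J} * {set J}} (ek : #|e.1| = k).

Lemma free_ord j : j \in e.1 -> exists i : 'I_k, index j (enum e.1) = i.
Proof.
move=> je; have ik : (index j (enum e.1) < k)%N.
  by rewrite -ek cardE index_mem mem_enum.
by exists (Ordinal ik).
Qed.

Lemma ord_free (i : 'I_k) : exists2 j, j \in e.1 & index j (enum e.1) = i.
Proof.
have ie : (i < size (enum e.1))%N by rewrite -cardE ek.
have [j0 _] : exists j0, j0 \in e.1.
  by apply/card_gt0P; rewrite ek (leq_ltn_trans _ (ltn_ord i)).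
exists (nth j0 (enum e.1) i); first by rewrite -mem_enum mem_nth.
by rewrite index_uniq// enum_uniq.
Qed.

Lemma disk_cubemap v : sqnorm v <= 1 -> forall i, -1 <= cubemap v 0 i <= 1.
Proof.
move=> v1 i; rewrite -ler_norml (le_trans (le_supnorm _ i))//.
by rewrite supnorm_cubemap -sqnorm_le1.
Qed.

Lemma face_coord_face v : sqnorm v <= 1 -> cube_face e (face_coord e v).
Proof.
move=> v1; split=> j je; rewrite /face_coord; last by rewrite (negPf je).
have [i ->] := free_ord je; rewrite je row_nthE.
by have /andP[? ?] := disk_cubemap v1 i; apply/andP; split; lra.
Qed.

Lemma face_coord_open v : sqnorm v <= 1 ->
  open_face e (face_coord e v) <-> sqnorm v <> 1.
Proof.
move=> v1; split=> [[eo _]|nv1].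
  apply/eqP; rewrite lt_eqF// sqnorm_lt1 -supnorm_cubemap.
  apply/(supnorm_lt _ ltr01) => i; have [j je ji] := ord_free i.
  have := eo _ je; rewrite /face_coord je ji row_nthE => /andP[? ?].
  by rewrite ltr_norml; apply/andP; split; lra.
have : sqnorm v < 1 by rewrite lt_neqAle v1 andbT; exact/eqP.
rewrite sqnorm_lt1 -supnorm_cubemap => /(supnorm_lt _ ltr01) vi.
split=> j je; rewrite /face_coord; last by rewrite (negPf je).
have [i ->] := free_ord je; rewrite je row_nthE.
by have := vi i; rewrite ltr_norml => /andP[? ?]; apply/andP; split; lra.
Qed.

Lemma face_coord_inj v v' :
  (forall j, face_coord e v j = face_coord e v' j) -> v = v'.
Proof.
move=> vv; rewrite -[v]cubemapK -[v']cubemapK; congr diskmap; apply/rowP => i.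
have [j je ji] := ord_free i; have := vv j.
by rewrite /face_coord je ji !row_nthE => ?; lra.
Qed.

Lemma face_coord_surj c : cube_face e c ->
  exists2 v, sqnorm v <= 1 & forall j, face_coord e v j = c j.
Proof.
move=> [eA eB]; have [f fP] := choice (fun i => let: ex_intro2 j a b := ord_free i in
  ex_intro (fun j => j \in e.1 /\ index j (enum e.1) = i) j (conj a b)).
exists (diskmap (\row_i (2 * c (f i) - 1))).
  rewrite sqnorm_le1 eucnorm_diskmap; apply: bigmax_le => // i _.
  rewrite mxE ler_norml; have [fe _] := fP i; have /andP[? ?] := eA _ fe.
  by apply/andP; split; lra.
move=> j; rewrite /face_coord; case: ifPn => [je|/eB ->//].
have [i ji] := free_ord je; rewrite ji row_nthE diskmapK mxE.
have [fe fi] := fP i; have -> : f i = j.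
  rewrite -[LHS](@nth_index _ j _ (enum e.1)) ?mem_enum//.
  by rewrite fi -ji nth_index// mem_enum.
by lra.
Qed.

Lemma face_coord_cvg v j :
  (fun w : 'rV[R]_k => face_coord e w j) @ v --> face_coord e v j.
Proof.
have FF : Filter (nbhs v) := nbhs_filter v.
rewrite /face_coord; case: ifPn => [je|_]; last exact: cvg_cst.
have [i ->] := free_ord je; rewrite row_nthE.
rewrite (_ : (fun w => _) = fun w : 'rV[R]_k => (1 + cubemap w 0 i) / 2); last first.
  by apply/funext => w; rewrite row_nthE.
apply: (@cvgM R _ (nbhs v) FF (fun w => 1 + cubemap w 0 i) (fun=> 2^-1)).
  apply: (@cvgD R R _ (nbhs v) FF (fun=> 1) (fun w => cubemap w 0 i)).
    exact: cvg_cst.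
  exact: cubemap_cvg.
exact: cvg_cst.
Qed.

End Coordinates.
End CubeFaces.

Section ClosedIn.
Context {X : topologicalType}.
Implicit Types (A B : set X).

Lemma closed_inP B A :
  closed_in B A <-> exists2 K, closed K & A `&` B = K `&` B.
Proof.
split=> [|[K cK AK]].
  rewrite /closed_in -openC => -[W oW WE].
  exists (~` W); first by rewrite closedC.
  apply/seteqP; split=> x [Ax Bx]; split=> //.
    move=> Wx; have : (set_val @^-1` W) (exist _ x (mem_set Bx) : B) by [].
    by rewrite WE; exact.
  apply: contrapT => nAx; apply: Ax.
  have : (~` (set_val @^-1` A)) (exist _ x (mem_set Bx) : B) by [].
  by rewrite -WE.
rewrite /closed_in (_ : _ @^-1` A = (set_val : B -> X) @^-1` K); last first.
  apply/seteqP; split=> b /= H.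
    have [] : (K `&` B) (set_val b); last by [].
    by rewrite -AK; split=> //; exact: set_mem (valP b).
  have [] : (A `&` B) (set_val b); last by [].
  by rewrite AK; split=> //; exact: set_mem (valP b).
by apply: closed_preimage cK; exact: initial_continuous.
Qed.

Lemma closed_in_closed B A : closed B -> closed_in B A <-> closed (A `&` B).
Proof.
move=> cB; split=> [/closed_inP[K cK ->]|cAB]; first exact: closedI.
by apply/closed_inP; exists (A `&` B) => //; rewrite -setIA setIid.
Qed.

End ClosedIn.

(** * T-CW structures from parametrizations by faces of a cube *)

Section CubicalStructure.
Context {R : realType} {n : nat} {X : topologicalType}.
Local Notation T := (torus R n).
Local Notation orbit := (@Defs.orbit R n).
Local Notation disk := (@Defs.disk R).
Context {act : T -> X -> X} (actP : is_action act) (hX : hausdorff_space X).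
Context {J : finType} (Phi : T -> (J -> R) -> X).
Local Notation fc := ({set J} * {set J})%type.
(** E is the set of faces used as cells and [H e] the stabilizer along the open face e. In
    [Phi_boundary] a boundary point is represented on a face of smaller dimension, possibly with
    other coordinates c': cells of X may be attached by maps that forget coordinates. *)
Context (E : pred fc) (H : fc -> set T).
Context (E_disjoint : forall e, E e -> face_disjoint e)
  (H_subgroup : forall e, E e -> closed_subgroup (H e))
  (Phi_cvg : forall e, E e -> forall (U : Type) (F : set_system U) (FF : Filter F)
    (s : U -> T) (c : U -> J -> R) (t0 : T) (c0 : J -> R),
    (forall u, cube_face e (c u)) -> cube_face e c0 -> s @ F --> t0 ->
    (forall j, (fun u => c u j) @ F --> c0 j) ->
    (fun u => Phi (s u) (c u)) @ F --> Phi t0 c0)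
  (Phi_act : forall e, E e -> forall (s t : T) c, cube_face e c ->
    Phi (s * t)%g c = act s (Phi t c))
  (Phi_stab : forall e, E e -> forall (s t : T) c, cube_face e c ->
    H e (s^-1 * t)%g -> Phi s c = Phi t c)
  (Phi_boundary : forall e, E e -> forall c, cube_face e c -> ~ open_face e c ->
    exists2 e', E e' & (#|e'.1| < #|e.1|)%N /\
      exists2 c', cube_face e' c' & forall t, Phi t c = Phi t c')
  (Phi_inj : forall e e' (t t' : T) c c', E e -> E e' -> open_face e c ->
    open_face e' c' -> Phi t c = Phi t' c' -> c = c' /\ H e (t^-1 * t')%g)
  (Phi_surj : forall x, exists e t c, [/\ E e, cube_face e c & x = Phi t c]).

Definition cube_cell (k : nat) := {e : fc | E e && (#|e.1| == k)}.

Section Cell.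
Context {k : nat} (e : cube_cell k).

Let Ee : E (val e). Proof. by have /andP[] := valP e. Qed.
Let ek : #|(val e).1| = k. Proof. by have /andP[_ /eqP] := valP e. Qed.

(** The representative of the coset is immaterial by [Phi_stab]; see [cube_charE]. *)
Definition cube_char (p : cell_type (H (val e)) k) : X :=
  Phi (repr (p.1 : gluing (same_coset (H (val e)))))
    (face_coord (val e) (\val p.2)).

Local Notation pi := (\pi_(gluing (same_coset (H (val e))))).

Lemma cube_char_face (v : disk k) : cube_face (val e) (face_coord (val e) (\val v)).
Proof. by apply: face_coord_face => //; exact: set_mem (valP v). Qed.

Lemma cube_charE t (v : disk k) :
  cube_char (pi t, v) = Phi t (face_coord (val e) (\val v)).
Proof.
apply: (Phi_stab Ee (cube_char_face v)).
by apply/(orbit_piP (H_subgroup Ee)); rewrite reprK.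
Qed.

Lemma cube_char_continuous : continuous cube_char.
Proof.
move=> [a v]; have [t ->] := orbit_pi_surj a => W; rewrite cube_charE => Wx.
have cv j : (fun p : T * disk k => face_coord (val e) (\val p.2) j) @ (t, v) -->
    face_coord (val e) (\val v) j.
  have c1 := @cvg_snd T (disk k) (nbhs t) (nbhs v) (nbhs_filter t).
  have c2 := cvg_comp _ _ c1 (@set_val_cvg _ _ v).
  exact: (cvg_comp _ _ c2 (@face_coord_cvg R J k _ ek (\val v) j)).
have := @Phi_cvg _ Ee (T * disk k)%type (nbhs (t, v)) (nbhs_filter (t, v))
  fst (fun p => face_coord (val e) (\val p.2)) t (face_coord (val e) (\val v))
  (fun p => cube_char_face p.2) (cube_char_face v)
  (@cvg_fst T (disk k) (nbhs t) (nbhs v) (nbhs_filter v)) cv W Wx.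
case=> -[P Q] [/= nP nQ] PQ; have nP' : nbhs (pi t : orbit _) (pi @` P°).
  apply: open_nbhs_nbhs; split; last by exists t => //; exact: nP.
  by apply: orbit_pi_open; [exact: H_subgroup|exact: open_interior].
exists (pi @` P°, Q) => //= -[_ w] [/= [s Ps <-] Qw].
rewrite /= cube_charE; apply: (PQ (s, w)); split=> //=.
exact: interior_subset Ps.
Qed.

Lemma cube_char_act t a (v : disk k) :
  cube_char (orbit_act t a, v) = act t (cube_char (a, v)).
Proof.
have [s ->] := orbit_pi_surj a.
rewrite (orbit_actE (H_subgroup Ee)) !cube_charE.
by apply: (Phi_act Ee); exact: cube_char_face.
Qed.

Lemma cell_compact : compact [set: cell_type (H (val e)) k].
Proof.
rewrite -setXTT; apply: compact_setX; first exact: orbit_compact.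
exact: disk_compact.
Qed.

(** Compact source and Hausdorff target: from this the pushout and colimit topologies follow. *)
Lemma cube_char_closed A : closed A -> closed (cube_char @` A).
Proof.
move=> cA; apply: compact_closed => //; apply: continuous_compact.
  by apply: continuous_subspaceT; exact: cube_char_continuous.
by apply: subclosed_compact cA cell_compact _.
Qed.

Lemma cube_char_interior (p : cell_type (H (val e)) k) :
  ~ in_sphere p.2 <-> open_face (val e) (face_coord (val e) (\val p.2)).
Proof. by rewrite face_coord_open//; exact: set_mem (valP p.2). Qed.

Lemma cube_char_range t c : cube_face (val e) c -> range cube_char (Phi t c).
Proof.
move=> ec; have [v v1 vc] := face_coord_surj ek ec.
exists (pi t, exist _ v (mem_set v1)) => //; rewrite cube_charE.
by congr Phi; apply/funext.
Qed.

End Cell.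

Definition cube_skeleton (k : nat) : set X :=
  [set x | exists i (e : cube_cell i), (i < k)%N /\ range (@cube_char _ e) x].

Lemma cube_skeletonP k e t c : E e -> cube_face e c -> (#|e.1| < k)%N ->
  cube_skeleton k (Phi t c).
Proof.
move=> Ee ec ek; have Pe : E e && (#|e.1| == #|e.1|) by rewrite Ee eqxx.
by exists #|e.1|, (exist _ e Pe); split=> //; exact: cube_char_range.
Qed.

(** Descent on the dimension of the face, by [Phi_boundary]. *)
Lemma to_open_face e t c : E e -> cube_face e c -> exists e' c',
  [/\ E e', (#|e'.1| <= #|e.1|)%N, open_face e' c' & Phi t c = Phi t c'].
Proof.
have [N] := ubnP #|e.1|; elim: N e c => // N IH e c; rewrite ltnS => eN Ee ec.
have [eo|neo] := pselect (open_face e c); first by exists e, c; split.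
have [e' Ee' [e'e [c' e'c' cc']]] := Phi_boundary Ee ec neo.
have [e2 [c2 [Ee2 e2e' e2o c2E]]] := IH e' c' (leq_trans e'e eN) Ee' e'c'.
exists e2, c2; split=> //; first exact: leq_trans e2e' (ltnW e'e).
by rewrite cc' c2E.
Qed.

Lemma Phi_same_face e e' t t' c c' : E e -> E e' -> open_face e c ->
  open_face e' c' -> Phi t c = Phi t' c' -> e = e'.
Proof.
move=> Ee Ee' eo e'o /(Phi_inj Ee Ee' eo e'o)[cc' _]; rewrite -cc' in e'o.
exact: open_face_eq (E_disjoint Ee) (E_disjoint Ee') eo e'o.
Qed.

Lemma cube_skeleton_closed k : closed (cube_skeleton k).
Proof.
have -> : cube_skeleton k = \big[setU/set0]_(i < k)
    \big[setU/set0]_(e : cube_cell i) range (@cube_char _ e).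
  apply/seteqP; split=> x.
    move=> [i [e [ik ex]]]; rewrite -bigcup_seq; exists (Ordinal ik) => //=.
      by rewrite mem_index_enum.
    by rewrite -bigcup_seq; exists e => //=; rewrite mem_index_enum.
  rewrite -bigcup_seq => -[i _]; rewrite -bigcup_seq => -[e _ ex].
  by exists i, e; split.
by apply: closed_bigsetU => i _; apply: closed_bigsetU => e _;
  apply: cube_char_closed; exact: closedT.
Qed.

Lemma cube_skeleton_top : cube_skeleton #|J|.+1 = setT.
Proof.
apply/seteqP; split=> // x _; have [e [t [c [Ee ec ->]]]] := Phi_surj x.
by apply: cube_skeletonP Ee ec _; rewrite ltnS max_card.
Qed.

Lemma cube_attach_boundary k (e : cube_cell k) (p : cell_type (H (val e)) k) :
  in_sphere p.2 -> cube_skeleton k (cube_char p).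
Proof.
have /andP[Ee /eqP ek] := valP e.
case: p => a v /= v1; have [t ->] := orbit_pi_surj a; rewrite cube_charE.
have [|e' Ee' [e'e [c' e'c' ->]]] := Phi_boundary Ee (cube_char_face e v).
  by move/(@cube_char_interior k e (a, v)).
by apply: cube_skeletonP Ee' e'c' _; rewrite -ek.
Qed.

(** A point of a lower cell lies on an open face of dimension at most that of the lower cell; open
    faces with a common point are equal, which contradicts the dimensions. *)
Lemma cube_attach_interior k (e : cube_cell k) (p : cell_type (H (val e)) k) :
  ~ in_sphere p.2 -> ~ cube_skeleton k (cube_char p).
Proof.
have /andP[Ee /eqP ek] := valP e.
case: p => a v /= /(@cube_char_interior k e (a, v)) eo [i [e' [ik [[a' v'] _]]]].
have [t ->] := orbit_pi_surj a; have [t' ->] := orbit_pi_surj a'.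
rewrite !cube_charE; have /andP[Ee' /eqP e'i] := valP e'.
have [e2 [c2 [Ee2 e2e' e2o ->]]] := to_open_face t' Ee' (cube_char_face e' v').
move=> /(Phi_same_face Ee2 Ee e2o eo) e2E.
by move: ik; rewrite -e'i -ek -e2E ltnNge e2e'.
Qed.

Lemma cube_attach_injective k (e e' : cube_cell k) p p' :
  ~ in_sphere p.2 -> ~ in_sphere p'.2 ->
  @cube_char k e p = @cube_char k e' p' ->
  existT (fun e : cube_cell k => cell_type (H (val e)) k : Type) e p =
  existT _ e' p'.
Proof.
have /andP[Ee /eqP ek] := valP e; have /andP[Ee' _] := valP e'.
move=> /cube_char_interior eo /cube_char_interior eo' pp'.
have ee' : e = e' by apply: val_inj; exact: Phi_same_face pp'.
subst e'; congr existT; have [vv aa] := Phi_inj Ee Ee' eo eo' pp'.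
case: p p' {eo eo' pp'} vv aa => a v [a' v'] /= vv aa; congr (_, _).
  rewrite -[a](reprK (a : gluing _)) -[a'](reprK (a' : gluing _)).
  exact/(orbit_piP (H_subgroup Ee)).
by apply: val_inj; apply: (face_coord_inj ek) => j; rewrite vv.
Qed.

Lemma cube_skeleton_pushout k A :
  closed_in (cube_skeleton k.+1) A <->
  closed_in (cube_skeleton k) A /\
  forall e : cube_cell k, closed (@cube_char k e @^-1` A).
Proof.
have sub : cube_skeleton k `<=` cube_skeleton k.+1.
  by move=> x [i [e [ik ex]]]; exists i, e; split=> //; exact: ltnW.
rewrite !closed_in_closed; [|exact: cube_skeleton_closed..].
split=> [cA|[cA cAe]].
  split=> [|e].
    rewrite -(setIidr sub) setIA; apply: closedI => //.
    exact: cube_skeleton_closed.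
  have -> : @cube_char k e @^-1` A = @cube_char k e @^-1` (A `&` cube_skeleton k.+1).
    apply/seteqP; split=> p /= Ap; last by case: Ap.
    by split=> //; exists k, e; split=> //; exists p.
  exact: closed_preimage (@cube_char_continuous k e) cA.
have -> : A `&` cube_skeleton k.+1 = (A `&` cube_skeleton k) `|`
    \big[setU/set0]_(e : cube_cell k)
      (@cube_char k e @` (@cube_char k e @^-1` A)).
  apply/seteqP; split=> x.
    move=> [Ax [i [e [+ ex]]]]; rewrite ltnS leq_eqVlt => /orP[/eqP ik|ik].
      right; subst i; rewrite -bigcup_seq; exists e; first exact: mem_index_enum.
      by case: ex Ax => p _ <- Ap; exists p.
    by left; split=> //; exists i, e; split.
  move=> [[Ax /sub]//|]; rewrite -bigcup_seq => -[e _ [p Ap <-]].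
  by split=> //; exists k, e; split=> //; exists p.
apply: closedU => //; apply: closed_bigsetU => e _; exact: cube_char_closed.
Qed.

Lemma cube_colimit A :
  closed A <-> forall k, closed_in (cube_skeleton k) A.
Proof.
split=> [cA k|/(_ #|J|.+1)].
  by apply/closed_in_closed; [exact: cube_skeleton_closed|
    apply: closedI => //; exact: cube_skeleton_closed].
by rewrite closed_in_closed cube_skeleton_top ?setIT//; exact: closedT.
Qed.

Definition cube_structure : TCW_structure act.
Proof.
refine (@TCWStructure R n X act actP cube_cell (fun k e => H (val e)) _
  (fun k e => @cube_char k e) (@cube_char_continuous) (@cube_char_act)
  cube_skeleton _ _ _ cube_attach_boundary cube_attach_interior
  cube_attach_injective cube_skeleton_pushout cube_colimit).
- by move=> k e; have /andP[Ee _] := valP e; exact: H_subgroup.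
- by apply/seteqP; split=> // x [i [e []]].
- move=> k; apply/seteqP; split=> x.
    move=> [i [e [+ ex]]]; rewrite ltnS leq_eqVlt => /orP[/eqP ik|ik].
      by right; subst i; exists e.
    by left; exists i, e; split.
  move=> [[i [e [ik ex]]]|[e _ ex]]; first by exists i, e; split=> //; exact: ltnW.
  by exists k, e; split.
- apply/seteqP; split=> // x _; exists #|J|.+1 => //.
  by rewrite cube_skeleton_top.
Defined.

Lemma cube_structure_finite : finite_TCW cube_structure.
Proof.
pose g (e : {e : fc | E e}) : {k : nat & cube_cell k} :=
  existT _ #|(val e).1|
    (exist _ (val e) (introT andP (conj (valP e) (eqxx #|(val e).1|)))).
apply: (@sub_finite_set _ _ (g @` setT)); last exact: finite_image.
move=> [k e] _; have /andP[Ee /eqP ek] := valP e.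
exists (exist _ (val e) Ee) => //; rewrite /g/=.
case: e Ee ek => e eP /= Ee ek; subst k; congr existT.
by apply: val_inj.
Qed.

Lemma cube_space_compact : compact [set: X].
Proof.
have -> : [set: X] = \big[setU/set0]_(i < #|J|.+1)
    \big[setU/set0]_(e : cube_cell i) range (@cube_char _ e).
  rewrite -cube_skeleton_top; apply/seteqP; split=> x.
    move=> [i [e [ik ex]]]; rewrite -bigcup_seq; exists (Ordinal ik) => //=.
      by rewrite mem_index_enum.
    by rewrite -bigcup_seq; exists e => //=; rewrite mem_index_enum.
  rewrite -bigcup_seq => -[i _]; rewrite -bigcup_seq => -[e _ ex].
  by exists i, e; split.
apply: bigsetU_compact => i _; apply: bigsetU_compact => e _.
apply: continuous_compact; last exact: cell_compact.
by apply: continuous_subspaceT; exact: cube_char_continuous.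
Qed.

End CubicalStructure.

(** * Compact T-CW complexes are finite *)

(** If D were infinite, the sets containing almost all of D would form a proper filter with a
    cluster point p. But D without p belongs to this filter and is closed, so p has a neighbourhood
    missing it. *)
Lemma compact_discrete_finite (X : topologicalType) (D : set X) :
  compact [set: X] -> (forall A, A `<=` D -> closed A) -> finite_set D.
Proof.
move=> cX cD; apply: contrapT => infD.
pose F : set_system X := [set B | finite_set (D `\` B)].
have FF : ProperFilter F.
  split; first by rewrite /F/= setD0.
  split; rewrite /F/=; first by rewrite setDT; exact: finite_set0.
    by move=> A B fA fB; rewrite /= setDIr finite_setU.
  by move=> A B AB; apply: sub_finite_set => x [Dx nBx]; split=> // /AB.
have FT : F setT by rewrite /F/= setDT; exact: finite_set0.
have [p [_ clp]] := cX F FF FT.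
have FA : F (D `\ p).
  apply: (@sub_finite_set _ _ [set p]) => [x [Dx nx]|]; last exact: finite_set1.
  by apply: contrapT => xp; apply: nx.
have nA : nbhs p (~` (D `\ p)).
  apply: open_nbhs_nbhs; split; last by case=> _; apply.
  by rewrite openC; apply: cD => x [].
by have [x [Ax nAx]] := clp _ _ FA nA.
Qed.

Section CompactTCW.
Context {R : realType} {n : nat} {X : topologicalType}.
Local Notation T := (torus R n).
Local Notation disk := (@Defs.disk R).
Local Notation orbit := (@Defs.orbit R n).
Context {act : T -> X -> X} (S : TCW_structure act).

Lemma disk_zero_subproof k : 0 \in [set v : 'rV[R]_k | sqnorm v <= 1].
Proof. by apply/mem_set; rewrite /= /sqnorm big1// => i _; rewrite mxE expr0n. Qed.
Let zero k : disk k := exist _ 0 (disk_zero_subproof k).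

Let zero_interior k : ~ in_sphere (zero k).
Proof.
rewrite /in_sphere /= /sqnorm big1 => [/eqP|i _]; last by rewrite mxE expr0n.
by rewrite eq_sym oner_eq0.
Qed.

Let base k (e : cell S k) : cell_type (stab e) k :=
  (\pi_(gluing (same_coset (stab e))) 1%g : orbit (stab e), zero k).

Let center (c : {k & cell S k}) : X := char_map (base (projT2 c)).

Let skeleton_mono k l : (k <= l)%N -> skeleton S k `<=` skeleton S l.
Proof.
elim: l => [|l IH]; first by rewrite leqn0 => /eqP ->.
rewrite leq_eqVlt => /orP[/eqP ->//|/IH kl x /kl Slx].
by rewrite skeletonS; left.
Qed.

Let char_skeleton k (e : cell S k) p : skeleton S k.+1 (@char_map _ _ _ _ S k e p).
Proof. by rewrite skeletonS; right; exists e => //; exists p. Qed.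

Let interior_dim k k' (e : cell S k) (e' : cell S k') p p' :
  ~ in_sphere p.2 -> ~ in_sphere p'.2 ->
  @char_map _ _ _ _ S k e p = @char_map _ _ _ _ S k' e' p' -> k = k'.
Proof.
have W l l' (f : cell S l) (f' : cell S l') q q' : ~ in_sphere q'.2 ->
    @char_map _ _ _ _ S l f q = @char_map _ _ _ _ S l' f' q' -> (l' <= l)%N.
  move=> q'i qq'; rewrite leqNgt; apply/negP => ll'.
  apply: (attach_interior q'i); rewrite -qq'.
  exact: skeleton_mono ll' _ (char_skeleton q).
move=> pi p'i pp'; apply/eqP; rewrite eqn_leq.
by rewrite (W _ _ _ _ _ _ pi (esym pp')) (W _ _ _ _ _ _ p'i pp').
Qed.

Let center_inj : injective center.
Proof.
move=> [k e] [k' e'] cc; have kk' := @interior_dim k k' e e' (base e) (base e') (@zero_interior k)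
  (@zero_interior k') cc.
subst k'; congr existT.
have := @attach_injective _ _ _ _ S k e e' (base e) (base e')
  (@zero_interior k) (@zero_interior k) cc.
by move=> /(congr1 (@projT1 _ _)).
Qed.

Let cell_closed1 k (e : cell S k) (p : cell_type (stab e) k) : closed [set p].
Proof.
have -> : [set p] = fst @^-1` [set p.1] `&` snd @^-1` [set p.2].
  case: p => a v; apply/seteqP; split=> -[b w] /=; first by move=> [-> ->].
  by move=> [-> ->].
apply: closedI.
  refine (@closed_preimage (cell_type (stab e) k) (orbit (stab e)) fst [set p.1] _ _).
    by move=> q; exact: (@cvg_fst _ _ (nbhs q.1) (nbhs q.2) (nbhs_filter q.2)).
  by apply: orbit_closed1; exact: stab_subgroup.
apply: (@closed_preimage (cell_type (stab e) k) (disk k) snd [set p.2]).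
  by move=> q; exact: (@cvg_snd _ _ (nbhs q.1) (nbhs q.2) (nbhs_filter q.1)).
by apply: hausdorff_closed1; exact: disk_hausdorff.
Qed.

Let boundary_closed k (e : cell S k) :
  closed [set p : cell_type (stab e) k | in_sphere p.2].
Proof.
apply: (closed_preimage (f := fun p : cell_type (stab e) k => sqnorm (\val p.2))
  (A := [set 1 : R])); last exact: hausdorff_closed1 (@Rhausdorff R).
move=> p.
have c1 := @cvg_snd _ _ (nbhs p.1) (nbhs p.2) (nbhs_filter p.1).
have c2 := cvg_comp _ _ c1 (@set_val_cvg _ _ p.2).
exact: (cvg_comp _ _ c2 (@sqnorm_continuous R k (\val p.2))).
Qed.

(** By induction on the skeleta: the preimage of A in a cell is closed on the boundary by induction,
    and in the interior it is at most the base point. *)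
Let centers_closed A : A `<=` range center -> closed A.
Proof.
move=> Ac; apply/(colimit_closed S); elim=> [|k IH].
  by apply/closed_inP; exists set0; [exact: closed0|rewrite skeleton0 !setI0].
apply/skeleton_closed; split=> // e.
have [K cK AK] := (closed_inP _ _).1 IH.
have -> : @char_map _ _ _ _ S k e @^-1` A =
    ([set p : cell_type (stab e) k | in_sphere p.2] `&` @char_map _ _ _ _ S k e @^-1` K)
    `|` [set p : cell_type (stab e) k | p = base e /\ A (char_map p)].
  apply/seteqP; split=> p /=.
    move=> Ap; have [pb|pi] := pselect (in_sphere p.2).
      left; split=> //; have [] : (K `&` skeleton S k) (char_map p); last by [].
      by rewrite -AK; split=> //; exact: attach_boundary.
    right; split=> //; have [[k' e'] _ cp] := Ac _ Ap.
    have kk' := @interior_dim k' k e' e (base e') p (@zero_interior k') pi cp.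
    subst k'; have ee := @attach_injective _ _ _ _ S k e' e (base e') p
      (@zero_interior k) pi cp.
    have ? : e' = e := congr1 (@projT1 _ _) ee; subst e'.
    (* Equality of cells is decided classically, so second components of equal dependent pairs over
       the same cell are equal. *)
    by apply/esym; exact: (inj_pair2_eq_dec _ (fun x y => pselect (x = y)) _ _ _ _ ee).
  move=> [[pb Kp]|[_ //]].
  have [] : (A `&` skeleton S k) (char_map p); last by [].
  by rewrite AK; split=> //; exact: attach_boundary.
apply: closedU.
  apply: closedI; first exact: boundary_closed.
  by apply: closed_preimage cK; exact: char_map_continuous.
have [Ab|nAb] := pselect (A (char_map (base e))).
  have -> : [set p | p = base e /\ A (char_map p)] = [set base e].
    by apply/seteqP; split=> p /= [] // ->.
  exact: cell_closed1.
rewrite (_ : [set p | _] = set0); first exact: closed0.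
by apply/seteqP; split=> // p [/= ->].
Qed.

Lemma compact_TCW_finite : compact [set: X] -> finite_TCW S.
Proof.
move=> cX; have fD := compact_discrete_finite cX centers_closed.
rewrite /finite_TCW; apply: card_le_finite fD.
have E := inj_card_eq (in2W center_inj : {in setT &, injective center}).
by rewrite (card_le_eqr E).
Qed.

End CompactTCW.

(** * The finite model *)

Lemma annihilator_subgroup (R : realType) n (A : set 'rV[int]_n) :
  closed_subgroup [set t : torus R n | forall m, A m -> t m = 1].
Proof.
split=> [|m _|s t Hs Ht m Am|s Hs m Am] //.
- have -> : [set t : torus R n | forall m, A m -> t m = 1] =
      \bigcap_(m in A) [set t : torus R n | t m = 1].
    by apply/seteqP; split=> t tP m Am; exact: tP.
  apply: closed_bigI => m _.
  rewrite (_ : [set t : torus R n | t m = 1] =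
    (fun t : torus R n => t m : R[i]^o) @^-1` [set (1 : R[i]^o)])//.
  apply: closed_preimage; first by move=> t; exact: torus_eval_cvg.
  exact: hausdorff_closed1 (@complex_hausdorff R).
- by rewrite -[LHS]/(s m * t m) Hs// Ht// mulr1.
- by rewrite -[LHS]/((s m)^-1) Hs// invr1.
Qed.

Section NerveModel.
Context {R : realType} {n : nat} (Sigma : set (set 'rV[R]_n)).
Context (fanS : rational_fan Sigma) {J : finType} (S : J -> Sigma).
Context (Ssurj : forall s : Sigma, exists j, S j = s) (j0 : J).
Local Notation M := 'rV[int]_n.
Local Notation T := (torus R n).
Local Notation cone := (cone S).
Local Notation perp := (perp S).
Local Notation leJ := (leJ S).
Local Notation C := (R[i]^o).
Implicit Types (j : J) (m : M) (p : J -> R).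

Definition supp p : J -> Prop := fun i => 0 < p i.
Definition icone (P : J -> Prop) : set 'rV[R]_n := [set u | forall i, P i -> cone i u].
Definition iperp (P : J -> Prop) m :=
  forall u, icone P u -> dot (lattice_vec m) u = 0.

Lemma icone_cone (P : J -> Prop) : (exists i, P i) -> exists k, cone k = icone P.
Proof.
move=> [i Pi]; pose A : {set J} := [set i | `[< P i >]]%SET.
have A0 : A != finset.set0 by apply/set0Pn; exists i; rewrite inE; exact/asboolP.
have [k kP] := cap_exists fanS Ssurj A0; exists k; apply/seteqP; split=> u.
  by move=> /kP ku j Pj; apply: ku; rewrite inE; exact/asboolP.
by move=> uP; apply/kP => j; rewrite inE => /asboolP; exact: uP.
Qed.

Lemma icone_sub (P Q : J -> Prop) : (forall i, P i -> Q i) -> icone Q `<=` icone P.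
Proof. by move=> PQ u Qu i /PQ; exact: Qu. Qed.

Lemma iperp_sub (P Q : J -> Prop) m : (forall i, P i -> Q i) ->
  iperp P m -> iperp Q m.
Proof. by move=> PQ Pm u Qu; apply: Pm; exact: icone_sub Qu. Qed.

(** A continuous measure of the failure of j to lie in all the cones of the support of p
    ([wt_eq0]). *)
Definition wt j p : R := \sum_(i | ~~ `[< leJ j i >]) p i.

Definition theta m p : R := \prod_(j | ~~ `[< perp j m >]) wt j p.

Section Weights.
Context {p : J -> R} (p0 : forall j, 0 <= p j).

Lemma wt_ge0 j : 0 <= wt j p.
Proof. by apply: sumr_ge0 => i _; exact: p0. Qed.

Lemma wt_eq0 j : wt j p = 0 <-> cone j `<=` icone (supp p).
Proof.
split=> [/eqP|jp]; last first.
  apply: big1 => i /negP nji; apply/eqP; rewrite eq_le p0 andbT leNgt.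
  by apply/negP => pi; apply: nji; apply/asboolP => u /jp; exact.
rewrite psumr_eq0 => [/allP w0 u ju i|i _]; last exact: p0.
rewrite /supp => pi; have /implyP := w0 i (mem_index_enum _).
have [ji _|_ /(_ isT)] := asboolP (leJ j i); first exact: ji.
by rewrite gt_eqF.
Qed.

Lemma theta_ge0 m : 0 <= theta m p.
Proof. by apply: prodr_ge0 => j _; exact: wt_ge0. Qed.

(** The intersection of the cones in the support is a cone k of the fan with [wt k p] = 0; if m is
    not orthogonal to k, this is one of the factors. *)
Lemma theta_neq0 m : (exists i, supp p i) -> theta m p != 0 <-> iperp (supp p) m.
Proof.
move=> /icone_cone[k kE]; split=> [tm|pm].
  have [km|nkm] := pselect (perp k m); first by rewrite /iperp -kE.
  exfalso; move: tm; rewrite /theta (bigD1 k) ?mulf_eq0 => /=; last first.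
    by apply/asboolPn.
  by rewrite (wt_eq0 k).2 ?eqxx// -kE.
apply/prodf_neq0 => j /asboolPn njm; apply/eqP => /wt_eq0 jp; apply: njm => u.
by move=> /jp; exact: pm.
Qed.

End Weights.

Lemma wt_cvg (U : Type) (F : set_system U) (FF : Filter F) (f : U -> J -> R) p j :
  (forall i, (fun u => f u i) @ F --> p i) ->
  (fun u => wt j (f u)) @ F --> wt j p.
Proof. by move=> fp; apply: cvg_bigsum => i _; exact: fp. Qed.

Lemma theta_cvg (U : Type) (F : set_system U) (FF : Filter F) (f : U -> J -> R) p m :
  (forall i, (fun u => f u i) @ F --> p i) ->
  (fun u => theta m (f u)) @ F --> theta m p.
Proof.
move=> fp; apply: (@cvg_bigprod R U F FF J _ (fun j u => wt j (f u))
  (fun j => wt j p)) => j _.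
exact: wt_cvg.
Qed.

Definition top_face p := (forall j, 0 <= p j <= 1) /\ exists j, p j = 1.

Lemma top_face_ge0 p : top_face p -> forall j, 0 <= p j.
Proof. by move=> [p01 _] j; have /andP[] := p01 j. Qed.

Lemma top_face_supp p : top_face p -> exists i, supp p i.
Proof. by move=> [_ [i i1]]; exists i; rewrite /supp i1. Qed.

(* A point of the model is a point p of the cube, with top coordinate 1,       *)
(* together with a class of t in the quotient of the torus by the stabilizer  *)
(* of the cone [icone (supp p)]; the class is recorded by the products         *)
(* [t m * theta m p], since theta m p <> 0 iff m is orthogonal to that cone.  *)
Definition nerve_points : set ({ptws J -> R} * {ptws M -> C}) :=
  [set pq | top_face pq.1 /\ exists t : T, forall m, pq.2 m = t m * (theta m pq.1)%:C].

Definition nerve : topologicalType := set_type nerve_points.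
Implicit Types (y : nerve).

Definition npos y : J -> R := (\val y).1.
Definition nang y : M -> R[i] := (\val y).2.

Lemma npos_top y : top_face (npos y).
Proof. by have [] := set_mem (valP y). Qed.

Lemma npos_ge0 y j : 0 <= npos y j.
Proof. exact/top_face_ge0/npos_top. Qed.

Lemma npos_supp y : exists i, supp (npos y) i.
Proof. exact/top_face_supp/npos_top. Qed.

Lemma nangP y : exists t : T, forall m, nang y m = t m * (theta m (npos y))%:C.
Proof. by have [] := set_mem (valP y). Qed.

Lemma nang_neq0 y m : nang y m != 0 <-> iperp (supp (npos y)) m.
Proof.
have [t ->] := nangP y; rewrite mulf_eq0 (negPf (torus_neq0 t m))/=.
rewrite -(theta_neq0 (npos_ge0 y) _ (npos_supp y)).
by rewrite (inj_eq (@complexI R) _ 0).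
Qed.

Lemma nerve_ext y y' : (forall j, npos y j = npos y' j) ->
  (forall m, nang y m = nang y' m) -> y = y'.
Proof.
move=> pp qq; apply: val_inj; rewrite [\val y]surjective_pairing.
rewrite [\val y']surjective_pairing; congr (_, _); apply/funext => ?.
  exact: pp.
exact: qq.
Qed.

Lemma nerve_cvg (U : Type) (F : set_system U) (FF : Filter F) (f : U -> nerve) y :
  f @ F --> y <-> (forall j, (fun u => npos (f u) j) @ F --> npos y j) /\
    (forall m, (fun u => nang (f u) m) @ F --> (nang y m : C)).
Proof.
split=> [/cvg_set_type fy|[fp fq]].
  split; [move=> j|move=> m].
    have fy1 : (fun u => (\val (f u)).1) @ F --> (\val y).1.
      exact: (cvg_comp _ _ fy (@cvg_fst _ _ (nbhs (\val y).1) (nbhs (\val y).2) (nbhs_filter _))).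
    exact: (cvg_ptws _ _).1 fy1 j.
  have fy2 : (fun u => (\val (f u)).2) @ F --> (\val y).2.
    exact: (cvg_comp _ _ fy (@cvg_snd _ _ (nbhs (\val y).1) (nbhs (\val y).2) (nbhs_filter _))).
  exact: (cvg_ptws _ _).1 fy2 m.
apply/cvg_set_type.
have c1 : (fun u => (\val (f u)).1) @ F --> (\val y).1 by apply/cvg_ptws.
have c2 : (fun u => (\val (f u)).2) @ F --> (\val y).2 by apply/cvg_ptws.
move=> A Ay; have Ay' : nbhs ((\val y).1, (\val y).2) A.
  by rewrite -surjective_pairing.
have H : F (fun u => A ((\val (f u)).1, (\val (f u)).2)) := cvg_pair c1 c2 Ay'.
have HA : (fun u => A ((\val (f u)).1, (\val (f u)).2)) =
    (fun u => A (\val (f u))).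
  by apply/funext => u; rewrite -surjective_pairing.
rewrite HA in H; exact: H.
Qed.

Lemma nerve_hausdorff : hausdorff_space nerve.
Proof.
apply: hausdorff_set_type; apply: prod_hausdorff; apply: ptws_hausdorff.
  exact: Rhausdorff.
exact: complex_hausdorff.
Qed.

Lemma top_face1 : top_face (fun=> 1).
Proof. by split=> [j|]; [rewrite ler01 lexx|exists j0]. Qed.

Lemma nerve_mk_subproof (t : T) p : top_face p ->
  nerve_points (p, fun m => t m * (theta m p)%:C).
Proof. by split=> //; exists t. Qed.

(** Off [top_face] the position is replaced by the constant 1, a default value. *)
Definition nerve_mk (t : T) p : nerve :=
  match pselect (top_face p) with
  | left h => exist (fun x => x \in nerve_points) _ (mem_set (nerve_mk_subproof t h))
  | right _ => exist (fun x => x \in nerve_points) _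
                 (mem_set (nerve_mk_subproof t top_face1))
  end.

Lemma npos_mk t p : top_face p -> npos (nerve_mk t p) = p.
Proof. by rewrite /nerve_mk; case: pselect. Qed.

Lemma nang_mk t p m : top_face p -> nang (nerve_mk t p) m = t m * (theta m p)%:C.
Proof. by rewrite /nerve_mk; case: pselect. Qed.

Lemma nerve_mkE y : exists t : T, y = nerve_mk t (npos y).
Proof.
have [t yt] := nangP y; exists t; apply: nerve_ext => [j|m].
  by rewrite npos_mk//; exact: npos_top.
by rewrite nang_mk ?yt//; exact: npos_top.
Qed.

Lemma nerve_act_subproof (t : T) y :
  nerve_points (npos y, fun m => t m * nang y m).
Proof.
split; first exact: npos_top.
have [s ys] := nangP y; exists (t * s)%g => m /=.
by rewrite ys mulrA.
Qed.

Definition nerve_act (t : T) y : nerve :=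
  exist (fun x => x \in nerve_points) _ (mem_set (nerve_act_subproof t y)).

Lemma npos_act t y : npos (nerve_act t y) = npos y. Proof. by []. Qed.

Lemma nang_act t y m : nang (nerve_act t y) m = t m * nang y m. Proof. by []. Qed.

Lemma nerve_action : is_action nerve_act.
Proof.
split=> [y|s t y|[t0 y0]].
- by apply: nerve_ext => // m; rewrite nang_act mul1r.
- by apply: nerve_ext => // m; rewrite !nang_act mulrA.
- have FF : Filter (nbhs (t0, y0)) := nbhs_filter (t0, y0).
  have c1 := @cvg_fst _ _ (nbhs t0) (nbhs y0) (nbhs_filter y0).
  have c2 := @cvg_snd _ _ (nbhs t0) (nbhs y0) (nbhs_filter t0).
  have [cp cq] := (@nerve_cvg _ (nbhs (t0, y0)) FF snd y0).1 c2.
  apply: (@nerve_cvg _ (nbhs (t0, y0)) FF _ _).2; split=> [j|m]; first exact: cp.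
  have cm := (@torus_cvg R n _ (nbhs (t0, y0)) FF fst t0).1 c1 m.
  exact: (@cvg_complexM R _ (nbhs (t0, y0)) FF _ _ _ _ cm (cq m)).
Qed.

Definition nerve_faces (e : {set J} * {set J}) : bool :=
  (e.2 != finset.set0) && [forall j in e.1, j \notin e.2].

(** On the open face e the support is constant, equal to the union of [e.1] and [e.2]. *)
Definition nerve_stab (e : {set J} * {set J}) : set T :=
  [set t | forall m, iperp (fun i => i \in e.1 :|: e.2)%SET m -> t m = 1].

Lemma nerve_stab_subgroup e : closed_subgroup (nerve_stab e).
Proof. exact: annihilator_subgroup. Qed.

Lemma nerve_face_top e c : nerve_faces e -> cube_face e c -> top_face c.
Proof.
move=> /andP[/set0Pn[i ie] /forall_inP de] [eA eB]; split=> [j|].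
  case: (boolP (j \in e.1)) => [/eA//|/eB ->].
  by case: (j \in e.2); rewrite ?lexx ler01.
exists i; rewrite eB ?ie//; apply/negP => /de.
by rewrite ie.
Qed.

Lemma nerve_TCW : exists S : TCW_structure nerve_act, finite_TCW S.
Proof.
have E_disj e : nerve_faces e -> face_disjoint e.
  by move=> /andP[_ /forall_inP de] j; exact: de.
have suppE e c : cube_face e c -> forall i, supp c i -> (i \in e.1 :|: e.2)%SET.
  move=> [eA eB] i; rewrite /supp inE; case: (boolP (i \in e.1)) => //= /eB ->.
  by case: (i \in e.2); rewrite // ltxx.
have h1 e : nerve_faces e -> forall (U : Type) (F : set_system U) (FF : Filter F)
    (s : U -> T) (c : U -> J -> R) (t0 : T) (c0 : J -> R),
    (forall u, cube_face e (c u)) -> cube_face e c0 -> s @ F --> t0 ->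
    (forall j, (fun u => c u j) @ F --> c0 j) ->
    (fun u => nerve_mk (s u) (c u)) @ F --> nerve_mk t0 c0.
  move=> Ee U F FF s c t0 c0 ce ce0 st cc.
  have tp := nerve_face_top Ee ce0; have tpu u := nerve_face_top Ee (ce u).
  apply/nerve_cvg; split=> [j|m].
    rewrite npos_mk// (_ : (fun u => _) = fun u => c u j)//.
    by apply/funext => u; rewrite npos_mk.
  rewrite nang_mk// (_ : (fun u => _) = fun u => s u m * (theta m (c u))%:C); last first.
    by apply/funext => u; rewrite nang_mk.
  apply: cvg_complexM; first exact: (torus_cvg _ _).1 st m.
  by apply: cvg_real_complex; exact: theta_cvg.
have h2 e : nerve_faces e -> forall (s t : T) c, cube_face e c ->
    nerve_mk (s * t)%g c = nerve_act s (nerve_mk t c).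
  move=> Ee s t c ce; have tp := nerve_face_top Ee ce.
  apply: nerve_ext => [j|m]; first by rewrite npos_act !npos_mk.
  by rewrite nang_act !nang_mk// mulrA.
have h3 e : nerve_faces e -> forall (s t : T) c, cube_face e c ->
    nerve_stab e (s^-1 * t)%g -> nerve_mk s c = nerve_mk t c.
  move=> Ee s t c ce Hst; have tp := nerve_face_top Ee ce.
  apply: nerve_ext => [j|m]; first by rewrite !npos_mk.
  rewrite !nang_mk//; have [->|tm] := eqVneq (theta m c) 0; first by rewrite !mulr0.
  have cm : iperp (supp c) m.
    exact/(theta_neq0 (top_face_ge0 tp) _ (top_face_supp tp)).
  have := Hst m (iperp_sub (suppE _ _ ce) cm).
  rewrite -[LHS]/((s m)^-1 * t m) => /(congr1 (fun z => s m * z)).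
  by rewrite mulrA mulfV ?torus_neq0// mul1r mulr1 => ->.
have h4 e : nerve_faces e -> forall c, cube_face e c -> ~ open_face e c ->
    exists2 e', nerve_faces e' & (#|e'.1| < #|e.1|)%N /\
      exists2 c', cube_face e' c' & forall t, nerve_mk t c = nerve_mk t c'.
  move=> Ee c ce neo; have [eA eB] := ce.
  (* The new face fixes the free coordinates that have reached 0 or 1; the point c itself is
     kept. *)
  pose A' : {set J} := [set j in e.1 | 0 < c j < 1]%SET.
  pose B' : {set J} := (e.2 :|: [set j in e.1 | c j == 1])%SET.
  exists (A', B').
    have /andP[/set0Pn[i ie] _] := Ee; apply/andP; split => /=.
      by apply/set0Pn; exists i; rewrite inE ie.
    apply/forall_inP => j; rewrite !inE => /andP[je /andP[_ j1]].
    by rewrite negb_or (E_disj _ Ee _ je)/= je/= lt_eqF.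
  split=> /=.
    apply: proper_card; rewrite properE; apply/andP; split.
      by apply/fintype.subsetP => j; rewrite inE => /andP[].
    apply/negP => /fintype.subsetP sub; apply: neo; split=> // j je.
    by have := sub j je; rewrite inE je.
  exists c => //; split=> j /=; rewrite !inE.
    by move=> /andP[_ /andP[/ltW -> /ltW ->]].
  case: (boolP (j \in e.1)) => [je /= nj|je _]; last by rewrite eB//= orbF.
  rewrite (negPf (E_disj _ Ee _ je))/=; have /andP[c0 c1] := eA _ je.
  move: nj c0 c1; rewrite !le_eqVlt [0 == c j]eq_sym.
  by case: (c j =P 1) => [->//|_]; case: (c j =P 0) => [->|_]//= /negP + c0 c1; rewrite c0 c1.
have h5 e e' (t t' : T) c c' : nerve_faces e -> nerve_faces e' -> open_face e c ->
    open_face e' c' -> nerve_mk t c = nerve_mk t' c' ->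
    c = c' /\ nerve_stab e (t^-1 * t')%g.
  move=> Ee Ee' eo eo' tt; have tp := nerve_face_top Ee (open_face_face eo).
  have tp' := nerve_face_top Ee' (open_face_face eo').
  have cc : c = c' by rewrite -(npos_mk t tp) tt npos_mk.
  subst c'; split=> // m em; rewrite -[LHS]/((t m)^-1 * t' m).
  have cm : iperp (supp c) m.
    apply: iperp_sub em => i; rewrite inE; have [eA eB] := eo.
    case: (boolP (i \in e.1)) => [/eA/andP[]//|/eB ci /= ie].
    by rewrite /supp ci ie.
  have tm : theta m c != 0.
    exact/(theta_neq0 (top_face_ge0 tp) _ (top_face_supp tp)).
  have tmC : (theta m c)%:C != 0 by rewrite (inj_eq (@complexI R) _ 0).
  have := congr1 (fun y => nang y m) tt; rewrite /= !nang_mk// => /(mulIf tmC) <-.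
  by rewrite mulVf// torus_neq0.
have h6 y : exists e t c, [/\ nerve_faces e, cube_face e c & y = nerve_mk t c].
  have [t yE] := nerve_mkE y; have [y01 [i i1]] := npos_top y.
  pose A : {set J} := [set j | 0 < npos y j < 1]%SET.
  pose B : {set J} := [set j | npos y j == 1]%SET.
  exists (A, B), t, (npos y); split=> //.
    apply/andP; split=> /=; first by apply/set0Pn; exists i; rewrite inE i1.
    by apply/forall_inP => j; rewrite !inE => /andP[_ j1]; rewrite lt_eqF.
  split=> j; rewrite !inE => // nj; have /andP[c0 c1] := y01 j.
  move: nj c0 c1; rewrite !le_eqVlt [0 == _]eq_sym.
  by case: (npos y j =P 1) => [->//|_]; case: (npos y j =P 0) => [->|_]//= /negP + c0 c1; rewrite c0 c1.
exists (cube_structure nerve_action nerve_hausdorff E_disj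
  (fun e _ => nerve_stab_subgroup e) h1 h2 h3 h4 h5 h6).
exact: cube_structure_finite.
Qed.

End NerveModel.

(** * The homotopy equivalence *)

(** A bounded factor [a], in practice a phase, may be discontinuous where the real factor r
    vanishes. *)
Lemma cvg_mul_bounded (R : realType) (U : Type) (F : set_system U) (FF : Filter F)
    (a : U -> R[i]) (r : U -> R) (a0 : R[i]) (r0 : R) :
  (forall u, cabs (a u) <= 1) -> r @ F --> r0 ->
  (r0 != 0 -> a @ F --> (a0 : R[i]^o)) ->
  (fun u => a u * (r u)%:C) @ F --> (a0 * r0%:C : R[i]^o).
Proof.
move=> a1 rr aa; have [r00|r00] := eqVneq r0 0; last first.
  by apply: cvg_complexM; [exact: aa|exact: cvg_real_complex].
rewrite r00 rmorph0 mulr0; rewrite r00 in rr.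
apply: (@cvg_complex0 R U F FF _ (fun u => `|r u|)).
  by apply: nearW => u; rewrite cabsM cabs_real ler_piMl.
by rewrite -(normr0 R); exact: cvg_norm.
Qed.

Lemma cvg_powR (R : realType) (U : Type) (F : set_system U) (FF : Filter F)
    (a r : U -> R) (a0 r0 : R) : 0 < a0 -> a @ F --> a0 -> r @ F --> r0 ->
  (fun u => a u `^ r u) @ F --> a0 `^ r0.
Proof.
move=> a00 aa rr; have an : \forall u \near F, 0 < a u by exact: (cvgr_gt a0).
have -> : a0 `^ r0 = expR (r0 * ln a0) by rewrite /powR gt_eqF.
apply: (@cvg_near_eq _ F FF R _ (fun u => expR (r u * ln (a u)))).
  by apply: filterS an => u au; rewrite /powR gt_eqF.
exact: cvg_powR_exp.
Qed.

Lemma powR_le_max (R : realType) (a r : R) : 0 <= a -> 0 <= r <= 1 -> a `^ r <= 1 + a.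
Proof.
move=> a0 /andP[r0 r1]; have [->|an] := eqVneq a 0.
  by rewrite /powR eqxx addr0; case: (r == 0).
have {}a0 : 0 < a by rewrite lt_neqAle eq_sym an.
have [a1|a1] := leP 1 a.
  apply: le_trans (_ : a `^ 1 <= _); first exact: ler_powR.
  by rewrite powRr1 ?(ltW a0)// lerDr.
apply: le_trans (_ : 1 <= _); last by rewrite lerDl ltW.
by rewrite -[leRHS](powRr0 a); apply: ger_powR => //; rewrite a0 ltW.
Qed.

Lemma exprzD_ge0 (R : realType) (z : R) (a b : int) : 0 <= a -> 0 <= b ->
  z ^ (a + b) = z ^ a * z ^ b.
Proof. by case: a b => // a [] // b _ _; rewrite -PoszD -!exprnP exprD. Qed.

Section HomotopyEquivalence.
Context {R : realType} {n : nat} (Sigma : set (set 'rV[R]_n)).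
Context (fanS : rational_fan Sigma) {J : finType} (S : J -> Sigma).
Context (Sinj : injective S) (Ssurj : forall s : Sigma, exists j, S j = s) (j0 : J).
Local Notation M := 'rV[int]_n.
Local Notation T := (torus R n).
Local Notation X := (toric_variety Sigma).
Local Notation cone := (cone S).
Local Notation dualm := (dualm S).
Local Notation perp := (perp S).
Local Notation leJ := (leJ S).
Local Notation relint := (relint fanS S).
Local Notation orb := (orb fanS Ssurj).
Local Notation hat := (hat fanS Ssurj).
Local Notation chart := (chart S).
Local Notation act := (toric_act Sigma).
Local Notation Lam := (Lam fanS Ssurj).
Local Notation icone := (icone S).
Local Notation iperp := (iperp S).
Local Notation wt := (wt S).
Local Notation theta := (theta S).
Local Notation nerve := (nerve S).
Local Notation nerve_mk := (nerve_mk S j0).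
Local Notation C := (R[i]^o).
Local Notation I := (@unit_interval R).
Implicit Types (j k : J) (m : M) (p W : J -> R) (x : X) (y : nerve).

(* The character exp (sum_j log (W j) relint j) of the big orbit, continued   *)
(* to its limits as some of the W j tend to 0.                                *)
Definition cw W m : R := \prod_j W j ^ dot m (relint j).

Lemma cw0 W : cw W 0 = 1.
Proof. by apply: big1 => j _; rewrite dot0l expr0z. Qed.

Lemma cw_one m : cw (fun=> 1) m = 1.
Proof. by apply: big1 => j _; rewrite exp1rz. Qed.

Lemma cw_ge0 W m : (forall j, 0 <= W j) -> 0 <= cw W m.
Proof. by move=> W0; apply: prodr_ge0 => j _; exact: exprz_ge0. Qed.

Section Weights.
Context {W : J -> R} {k : J} (Wk : forall j, W j = 0 -> leJ j k).

Lemma cwD a b : dualm k a -> dualm k b -> cw W (a + b) = cw W a * cw W b.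
Proof.
move=> ka kb; rewrite /cw -big_split; apply: eq_bigr => j _ /=; rewrite dotDl.
have [Wj|Wj] := eqVneq (W j) 0; last exact: expfzDr.
by apply: exprzD_ge0; exact: (dot_relint_ge0 fanS (Wk Wj)).
Qed.

Lemma cw_perp m : perp k m -> cw W m != 0.
Proof.
move=> km; apply/prodf_neq0 => j _; have [Wj|Wj] := eqVneq (W j) 0; last exact: expfz_neq0.
have jm : perp j m := perp_le (Wk Wj) km.
by rewrite (dot_relint_eq0 fanS (perp_dualm jm)).2// expr0z oner_eq0.
Qed.

Lemma cw_nperp m : W k = 0 -> dualm k m -> ~ perp k m -> cw W m = 0.
Proof.
move=> Wk0 km nkm; rewrite /cw (bigD1 k)//= Wk0 exp0rz.
case: eqP => [|_]; last by rewrite mul0r.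
by move/(dot_relint_eq0 fanS km).
Qed.

Lemma cw_cvg (U : Type) (F : set_system U) (FF : Filter F) (V : U -> J -> R) m :
  (forall j, (fun u => V u j) @ F --> W j) -> dualm k m ->
  (fun u => cw (V u) m) @ F --> cw W m.
Proof.
move=> VW km; apply: (@cvg_bigprod R U F FF J _
  (fun j u => V u j ^ dot m (relint j)) (fun j => W j ^ dot m (relint j))) => j _.
apply: cvg_exprz (VW j); have [Wj|Wj] := eqVneq (W j) 0; last by right.
by left; exact: (dot_relint_ge0 fanS (Wk Wj)).
Qed.

End Weights.

(** The cone of the fan equal to the intersection of the support; the default j0 does not occur for
    p in [top_face] ([capJ_cone]). *)
Definition capJ p : J :=
  if pselect (exists k, cone k = icone (supp p)) is left h then projT1 (cid h) else j0.

Section TopFace.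
Context {p : J -> R} (pT : top_face p).

Lemma capJ_cone : cone (capJ p) = icone (supp p).
Proof.
rewrite /capJ; case: pselect => [h|[]]; first by case: cid.
exact: (icone_cone fanS Ssurj (top_face_supp pT)).
Qed.

Lemma capJ_perp m : perp (capJ p) m <-> iperp (supp p) m.
Proof. by rewrite /iperp -capJ_cone. Qed.

Lemma leJ_capJ j : leJ j (capJ p) <-> forall i, 0 < p i -> leJ j i.
Proof.
split=> [jp i pi u /jp|jp u ju]; rewrite capJ_cone; first exact.
by move=> i pi; exact: jp.
Qed.

Lemma capJ_leJ i : 0 < p i -> leJ (capJ p) i.
Proof. by move=> pi; exact: (leJ_capJ _).1 pi. Qed.

Lemma wt_capJ j : wt j p = 0 <-> leJ j (capJ p).
Proof. by rewrite wt_eq0 ?capJ_cone//; [rewrite -capJ_cone|exact: top_face_ge0]. Qed.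

Lemma theta_capJ m : theta m p != 0 <-> perp (capJ p) m.
Proof.
rewrite capJ_perp; apply: (theta_neq0 fanS Ssurj).
  exact: top_face_ge0.
exact: top_face_supp.
Qed.

End TopFace.

(** Positivity is an open condition, so near p supports can only grow and their intersection cones
    only shrink. *)
Lemma capJ_near p (U : Type) (F : set_system U) (FF : Filter F) (f : U -> J -> R) :
  top_face p -> (forall u, top_face (f u)) ->
  (forall j, (fun u => f u j) @ F --> p j) ->
  \forall u \near F, leJ (capJ (f u)) (capJ p).
Proof.
move=> pT fT fp; have : \forall u \near F, forall i, 0 < p i -> 0 < f u i.
  apply: filter_forall => i; have [pi|npi] := boolP (0 < p i); last first.
    by apply: nearW.
  by apply: filterS (cvgr_gt _ (fp i) _ pi) => u.
apply: filterS => u H; apply/(leJ_capJ pT) => i /H fi.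
exact: (capJ_leJ (fT u)).
Qed.

Lemma leJ_anti_perp i k : leJ i k ->
  (forall m, dualm k m -> perp i m -> perp k m) -> i = k.
Proof.
move=> ik H; apply: (leJ_anti Sinj ik).
apply/(perp_sep fanS i (leJ_refl S k))/H; first exact: sep_dualm.
exact/(perp_sep fanS i ik).
Qed.

(** The phase is a character of [perp (orb x)] only; composing with the retraction of M extends it
    to a point of T. *)
Lemma angle_exists x : exists t : T, forall m, perp (orb x) m -> t m = arg (hat x m).
Proof.
have [Q [Q0 Q1]] := annihilator_projection fanS S (orb x).
have tP : torus_points (fun m => arg (hat x (m *m Q))).
  split=> [m|m m']; first by apply: arg_norm; exact/hat_neq0.
  by rewrite mulmxDl hatD// argM.
exists (exist (fun f => f \in @torus_points R n) _ (mem_set tP)) => m xm.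
by rewrite -[LHS]/(arg (hat x (m *m Q))) Q1.
Qed.

Definition angle x : T := projT1 (cid (angle_exists x)).

Lemma angleE x m : perp (orb x) m -> angle x m = arg (hat x m).
Proof. by rewrite /angle; case: cid => t; exact. Qed.

Lemma Lam_top x : top_face (fun j => Lam j x).
Proof.
split=> [j|]; first by rewrite Lam_ge0 Lam_le1.
exact: Lam_eq1.
Qed.

Lemma leJ_orb_Lam x : leJ (orb x) (capJ (fun j => Lam j x)).
Proof. by apply/(leJ_capJ (Lam_top x)) => i /Lam_gt0. Qed.

Arguments leJ_orb_Lam x [t] _.

Definition to_nerve x : nerve := nerve_mk (angle x) (fun j => Lam j x).

Lemma npos_to_nerve x : npos (to_nerve x) = fun j => Lam j x.
Proof. by apply: npos_mk; exact: Lam_top. Qed.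

Lemma nang_to_nerve x m :
  nang (to_nerve x) m = arg (hat x m) * (theta m (fun j => Lam j x))%:C.
Proof.
rewrite nang_mk; last exact: Lam_top.
have [->|tm] := eqVneq (theta m (fun j => Lam j x)) 0; first by rewrite !mulr0.
rewrite angleE//.
exact: (perp_le (leJ_orb_Lam x) ((theta_capJ (Lam_top x) m).1 tm)).
Qed.

(** Where [theta m] is nonzero at x0, [hat x0 m] is nonzero and its phase is continuous; elsewhere
    the product tends to 0. *)
Lemma to_nerve_continuous : continuous to_nerve.
Proof.
move=> x0; have FF : Filter (nbhs x0) := nbhs_filter x0.
have cL j : (fun x => Lam j x) @ x0 --> Lam j x0 by exact: Lam_cvg.
apply/(@nerve_cvg _ _ _ _ S X (nbhs x0) FF); split=> [j|m].
  rewrite npos_to_nerve (_ : (fun u => _) = fun x => Lam j x)//.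
  by apply/funext => x; rewrite npos_to_nerve.
rewrite nang_to_nerve (_ : (fun u => _) =
  fun x => arg (hat x m) * (theta m (fun j => Lam j x))%:C); last first.
  by apply/funext => x; rewrite nang_to_nerve.
apply: (@cvg_mul_bounded R X (nbhs x0) FF (fun x => arg (hat x m))).
- by move=> x; exact: cabs_arg_le1.
- exact: (@theta_cvg _ _ _ _ S X (nbhs x0) FF).
- move=> /(theta_capJ (Lam_top x0)) km.
  apply: (@cvg_arg R X (nbhs x0) FF (fun x => hat x m)).
    by apply/hat_neq0; exact: (perp_le (leJ_orb_Lam x0) km).
  exact: (hat_cvg Sinj (leJ_orb_Lam x0) (perp_dualm km)).
Qed.

Lemma to_nerve_equivariant : equivariant act (@nerve_act R n Sigma J S) to_nerve.
Proof.
move=> t x; have E : (fun j => Lam j (act t x)) = (fun j => Lam j x).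
  by apply/funext => j; exact: Lam_toric_act.
apply: nerve_ext => [j|m]; first by rewrite npos_act !npos_to_nerve Lam_toric_act.
rewrite nang_act !nang_to_nerve E hat_toric_act// argM arg_norm1 ?torus_norm//.
by rewrite mulrA.
Qed.

Definition nclass y : T := projT1 (cid (nangP y)).

Lemma nclassE y m : nang y m = nclass y m * (theta m (npos y))%:C.
Proof. by rewrite /nclass; case: cid. Qed.

Lemma arg_nang y m : perp (capJ (npos y)) m -> arg (nang y m) = nclass y m.
Proof.
move=> ym; rewrite nclassE argM arg_norm1 ?torus_norm// arg_real ?mulr1//.
rewrite lt_neqAle theta_ge0 ?andbT; last exact: npos_ge0.
by rewrite eq_sym; exact/(theta_capJ (npos_top y)).
Qed.

Lemma torus_cw_character (t : T) W k : (forall j, W j = 0 -> leJ j k) ->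
  character S k (fun m => t m * (cw W m)%:C).
Proof.
move=> Wk; split=> [|a b ka kb]; first by rewrite torus0 cw0 mulr1.
by rewrite (cwD Wk)// rmorphM/= torusD mulrACA.
Qed.

(** The weights [wt j] vanish exactly for j below [capJ (npos y)], so the limit defined by [cw] lies
    in the orbit of that cone ([orb_from_nerve]). *)
Definition from_nerve y : X := chart (capJ (npos y))
  (fun m => nclass y m * (cw (wt^~ (npos y)) m)%:C).

Lemma wt_npos y j : wt j (npos y) = 0 -> leJ j (capJ (npos y)).
Proof. by move/(wt_capJ (npos_top y)). Qed.

Lemma hat_from_nerve y m : dualm (capJ (npos y)) m ->
  hat (from_nerve y) m = arg (nang y m) * (cw (wt^~ (npos y)) m)%:C.
Proof.
move=> km; rewrite hat_chart//; last first.
  by apply: torus_cw_character => j; exact: wt_npos.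
have [ym|nym] := pselect (perp (capJ (npos y)) m); first by rewrite arg_nang.
rewrite (cw_nperp _ km nym) ?rmorph0 ?mulr0//.
exact/(wt_capJ (npos_top y)).
Qed.

Lemma orb_from_nerve y : orb (from_nerve y) = capJ (npos y).
Proof.
apply: leJ_anti_perp; first exact: leJ_chart.
move=> m km /hat_neq0; rewrite hat_from_nerve// mulf_eq0 negb_or => /andP[_ c0].
apply: contrapT => nym; move: c0; rewrite (cw_nperp _ km nym) ?rmorph0 ?eqxx//.
exact/(wt_capJ (npos_top y)).
Qed.

Lemma from_nerve_continuous : continuous from_nerve.
Proof.
move=> y0; have FF : Filter (nbhs y0) := nbhs_filter y0.
have [cp cq] := (@nerve_cvg _ _ _ _ S nerve (nbhs y0) FF id y0).1 cvg_id.
have near_k := @capJ_near _ _ (nbhs y0) FF (fun y => npos y) (npos_top y0) (fun y => npos_top y) cp.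
apply: (@cvg_toric _ _ _ fanS _ S Ssurj nerve (nbhs y0) FF _ _ (capJ (npos y0))).
- by rewrite orb_from_nerve.
- by apply: filterS near_k => y; rewrite orb_from_nerve.
- move=> m km; rewrite hat_from_nerve//.
  apply: (@cvg_near_eq _ (nbhs y0) FF C _
    (fun y => arg (nang y m) * (cw (wt^~ (npos y)) m)%:C)).
    by apply: filterS near_k => y yk; rewrite hat_from_nerve//; exact: dualm_le km.
  apply: (@cvg_mul_bounded R nerve (nbhs y0) FF (fun y => arg (nang y m))).
  + by move=> y; exact: cabs_arg_le1.
  + apply: (cw_cvg (k := capJ (npos y0)) _ FF) => // j; first exact: wt_npos.
    exact: (@wt_cvg _ _ _ _ S nerve (nbhs y0) FF).
  + move=> c0; have ym : perp (capJ (npos y0)) m.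
      apply: contrapT => nym; move: c0; rewrite (cw_nperp _ km nym) ?eqxx//.
      exact/(wt_capJ (npos_top y0)).
    apply: (@cvg_arg R nerve (nbhs y0) FF (fun y => nang y m)); last exact: cq.
    by apply/(nang_neq0 fanS Ssurj)/(capJ_perp (npos_top y0)).
Qed.

Lemma from_nerve_equivariant : equivariant (@nerve_act R n Sigma J S) act from_nerve.
Proof.
move=> t y; apply: (@toric_ext _ _ _ fanS _ S Ssurj (capJ (npos y))).
- by rewrite orb_from_nerve.
- by rewrite orb_toric_act// orb_from_nerve.
- move=> m km; rewrite hat_toric_act// !hat_from_nerve// nang_act argM.
  by rewrite arg_norm1 ?torus_norm// mulrA.
Qed.

Lemma unit_interval_bounds (u : I) : 0 <= \val u <= 1.
Proof. by have := set_mem (valP u); rewrite /= in_itv. Qed.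

(** The value 1 is reached at 1/2, so that at each time u one of [ramp u] and [ramp (1 - u)] is
    1. *)
Definition ramp (s : R) : R := Num.min 1 (2 * s).

Lemma ramp_bounds s : 0 <= s -> 0 <= ramp s <= 1.
Proof. by move=> s0; rewrite /ramp le_min ge_min ler01 lexx mulr_ge0. Qed.

Lemma ramp0 : ramp 0 = 0.
Proof. by rewrite /ramp mulr0 min_r. Qed.

Lemma ramp1 : ramp 1 = 1.
Proof. by rewrite /ramp mulr1 min_l// ler1n. Qed.

Lemma ramp_cvg (U : Type) (F : set_system U) (FF : Filter F) (f : U -> R) (s : R) :
  f @ F --> s -> (fun v => ramp (f v)) @ F --> ramp s.
Proof.
move=> fs; apply: cvg_min; first exact: cvg_cst.
by apply: cvgM => //; exact: cvg_cst.
Qed.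

Definition bent_wt (a : R) x j : R := 1 - a + a * wt j (fun i => Lam i x).

(** For a = 0 and b = 1 this is [hat x]; for a = 1 and b = 0 it keeps only the phase and the moduli
    of [from_nerve (to_nerve x)]. *)
Definition bent (a b : R) x m : R[i] :=
  arg (hat x m) * (cabs (hat x m) `^ b * cw (bent_wt a x) m)%:C.

Local Notation capL x := (capJ (fun i => Lam i x)).

Lemma bent_wt_ge0 a x j : 0 <= a <= 1 -> 0 <= bent_wt a x j.
Proof.
move=> /andP[a0 a1]; rewrite addr_ge0 ?subr_ge0// mulr_ge0//.
by apply: wt_ge0 => i; exact: Lam_ge0.
Qed.

Lemma bent_wt_leJ a x j : 0 <= a <= 1 -> bent_wt a x j = 0 -> leJ j (capL x).
Proof.
move=> /andP[a0 a1]; have w0 : 0 <= wt j (fun i => Lam i x).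
  by apply: wt_ge0 => i; exact: Lam_ge0.
move=> /eqP; rewrite paddr_eq0 ?subr_ge0 ?mulr_ge0// subr_eq0 => /andP[/eqP <-].
rewrite mul1r => /eqP wj.
exact/(wt_capJ (Lam_top x)).
Qed.

Lemma bent_character a b x : 0 <= a <= 1 -> character S (capL x) (bent a b x).
Proof.
move=> a01; split=> [|c d kc kd].
  rewrite /bent hat0 cw0 cabs1 powR1 mulr1.
  by rewrite (arg_norm1 (normr1 _)) mulr1.
have Wk j : bent_wt a x j = 0 -> leJ j (capL x) by exact: bent_wt_leJ.
rewrite /bent (hat_dualD (@leJ_orb_Lam x) kc kd).
rewrite argM cabsM powRM ?cabs_ge0// (cwD Wk kc kd).
by rewrite !rmorphM/=; ring.
Qed.

(* From u = 1 down to 1/2 the weights W of [cw W] move from 1 to [wt]; this    *)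
(* makes the product vanish off [perp (capL x)], and from 1/2 down to 0 the    *)
(* modulus of [hat x] can then be removed without losing continuity.          *)
Definition contract (q : X * I) : X :=
  chart (capL q.1)
    (bent (ramp (1 - \val q.2)) (ramp (\val q.2)) q.1).

Lemma ramp_unit (u : I) : 0 <= ramp (\val u) <= 1.
Proof. by apply: ramp_bounds; have /andP[] := unit_interval_bounds u. Qed.

Lemma ramp_unitC (u : I) : 0 <= ramp (1 - \val u) <= 1.
Proof.
by apply: ramp_bounds; rewrite subr_ge0; have /andP[] := unit_interval_bounds u.
Qed.

Lemma hat_contract q m : dualm (capL q.1) m ->
  hat (contract q) m = bent (ramp (1 - \val q.2)) (ramp (\val q.2)) q.1 m.
Proof.
move=> km; rewrite hat_chart//; apply: bent_character; exact: ramp_unitC.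
Qed.

Lemma leJ_contract q : leJ (orb (contract q)) (capL q.1).
Proof. exact: leJ_chart. Qed.

(** For m orthogonal to k every factor is continuous, since [hat x0 m] is nonzero. Otherwise the
    phase and the real power may jump, and the time u0 matters. *)
Lemma bent_cvg (U : Type) (F : set_system U) (FF : Filter F) (f : U -> X)
    (s : U -> I) x0 (u0 : I) m (k := capL x0) :
  dualm k m -> (fun v => hat (f v) m) @ F --> (hat x0 m : C) ->
  (forall j, (fun v => Lam j (f v)) @ F --> Lam j x0) ->
  (fun v => \val (s v)) @ F --> \val u0 ->
  (fun v => bent (ramp (1 - \val (s v))) (ramp (\val (s v))) (f v) m) @ F -->
    (bent (ramp (1 - \val u0)) (ramp (\val u0)) x0 m : C).
Proof.
move=> km hm hL su.
have s1 : (fun v => 1 - \val (s v)) @ F --> 1 - \val u0.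
  by apply: cvgB => //; exact: cvg_cst.
have ca := @ramp_cvg _ F FF _ _ s1; have cb := @ramp_cvg _ F FF _ _ su.
have a01 := ramp_unitC u0.
have Wk j : bent_wt (ramp (1 - \val u0)) x0 j = 0 -> leJ j k by exact: bent_wt_leJ.
have cW j : (fun v => bent_wt (ramp (1 - \val (s v))) (f v) j) @ F -->
    bent_wt (ramp (1 - \val u0)) x0 j.
  apply: cvgD; first by apply: cvgB => //; exact: cvg_cst.
  apply: cvgM => //.
  exact: (@wt_cvg _ _ _ _ S U F FF (fun v j => Lam j (f v)) (fun j => Lam j x0)).
have cc := @cw_cvg _ k Wk U F FF
  (fun v => bent_wt (ramp (1 - \val (s v))) (f v)) m cW km.
have ch := @cvg_cabs R U F FF _ _ hm.
have [pm|npm] := pselect (perp k m).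
  have h0 : hat x0 m != 0.
    by apply/hat_neq0; exact: (perp_le (@leJ_orb_Lam x0)).
  apply: cvg_complexM; first exact: (@cvg_arg R U F FF (fun v => hat (f v) m)).
  apply: cvg_real_complex; apply: cvgM => //.
  by apply: cvg_powR => //; rewrite cabs_gt0.
have wk0 : wt k (fun i => Lam i x0) = 0.
  exact/(wt_capJ (Lam_top x0)).
(* Up to time 1/2 the factor [cw] vanishes in the limit while the rest is bounded by 1 + |hat|.
   After it, the exponent is constantly 1 nearby and phase and modulus recombine into [hat]. *)
have [u01|u01] := leP (\val u0) 2^-1.
  have r1 : ramp (1 - \val u0) = 1 by rewrite /ramp min_l//; lra.
  have c0 : cw (bent_wt (ramp (1 - \val u0)) x0) m = 0.
    by rewrite (cw_nperp _ km npm)// /bent_wt r1 subrr add0r mul1r.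
  rewrite /bent c0 mulr0 rmorph0 mulr0; rewrite c0 in cc.
  have cc' : (fun v => (1 + cabs (hat (f v) m)) *
      cw (bent_wt (ramp (1 - \val (s v))) (f v)) m) @ F --> (0 : R).
    have c1 : (fun v => 1 + cabs (hat (f v) m)) @ F --> 1 + cabs (hat x0 m).
      by apply: cvgD => //; exact: cvg_cst.
    by rewrite -[X in _ --> X](mulr0 (1 + cabs (hat x0 m))); exact: cvgM c1 cc.
  apply: (@cvg_complex0 R U F FF _ _ _ cc'); apply: nearW => v.
  rewrite cabsM cabs_real normrM.
  have cw0 : 0 <= cw (bent_wt (ramp (1 - \val (s v))) (f v)) m.
    by apply: cw_ge0 => j; apply: bent_wt_ge0; exact: ramp_unitC.
  rewrite (ger0_norm cw0) ger0_norm ?powR_ge0// mulrA ler_wpM2r//.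
  apply: le_trans (_ : 1 * (1 + cabs (hat (f v) m)) <= _); last by rewrite mul1r.
  rewrite ler_pM ?cabs_ge0 ?powR_ge0 ?cabs_arg_le1//.
  apply: powR_le_max; [exact: cabs_ge0|exact: ramp_unit].
have B (z : I) : 2^-1 < \val z -> forall x, bent (ramp (1 - \val z)) (ramp (\val z)) x m =
    hat x m * (cw (bent_wt (ramp (1 - \val z)) x) m)%:C.
  move=> z1 x; rewrite /bent (_ : ramp (\val z) = 1); last first.
    by rewrite /ramp min_l//; lra.
  by rewrite powRr1 ?cabs_ge0// rmorphM/= mulrA [_ * (cabs _)%:C]mulrC argE.
rewrite (B u0 u01 x0).
apply: (@cvg_near_eq _ F FF C _
  (fun v => hat (f v) m * (cw (bent_wt (ramp (1 - \val (s v))) (f v)) m)%:C)).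
  have H : F (fun v => 2^-1 < \val (s v)) := cvgr_gt _ su _ u01.
  exact: (@filterS _ F FF _ _ (fun v (sv : 2^-1 < \val (s v)) => B _ sv (f v)) (H FF)).
exact: (@cvg_complexM R U F FF _ _ _ _ hm (cvg_real_complex cc)).
Qed.

Lemma contract_continuous : continuous contract.
Proof.
move=> [x0 u0]; have FF : Filter (nbhs (x0, u0)) := nbhs_filter (x0, u0).
have c1 := @cvg_fst _ _ (nbhs x0) (nbhs u0) (nbhs_filter u0).
have c2 := @cvg_snd _ _ (nbhs x0) (nbhs u0) (nbhs_filter x0).
have cL j : (fun q : X * I => Lam j q.1) @ (x0, u0) --> Lam j x0.
  exact: (cvg_comp _ _ c1 (@Lam_cvg _ _ _ fanS _ S Sinj Ssurj j x0)).
have nk : \forall q \near nbhs (x0, u0), leJ (capL q.1) (capL x0).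
  apply: (@capJ_near _ (X * I)%type (nbhs (x0, u0)) FF
    (fun q j => Lam j q.1)) => //.
  - exact: Lam_top.
  - by move=> q; exact: Lam_top.
apply: (@cvg_toric _ _ _ fanS _ S Ssurj (X * I)%type (nbhs (x0, u0)) FF _ _ (capL x0)).
- exact: leJ_contract.
- by apply: filterS nk => q pk w /leJ_contract; exact: pk.
- move=> m km; rewrite (@hat_contract (x0, u0))//.
  apply: (@cvg_near_eq _ (nbhs (x0, u0)) FF C _ (fun q =>
    bent (ramp (1 - \val q.2)) (ramp (\val q.2)) q.1 m)).
    by apply: filterS nk => q pk; rewrite hat_contract//; exact: dualm_le km.
  apply: (@bent_cvg _ (nbhs (x0, u0)) FF fst snd) => //.
    exact: (cvg_comp _ _ c1 (@hat_cvg _ _ _ fanS _ S Sinj Ssurj x0 _ m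
      (@leJ_orb_Lam x0) km)).
  exact: (@cvg_set_type _ (nbhs (x0, u0)) FF _ _ snd u0).1 c2.
Qed.

Lemma contract_equivariant (u : I) : equivariant act act (fun x => contract (x, u)).
Proof.
move=> t x; have E : (fun j => Lam j (act t x)) = (fun j => Lam j x).
  by apply/funext => j; exact: Lam_toric_act.
have o := @leJ_contract (act t x, u); rewrite /= E in o.
apply: (@toric_ext _ _ _ fanS _ S Ssurj (capL x)) => //.
- rewrite (orb_toric_act fanS Sinj Ssurj t (contract (x, u))).
  exact: (@leJ_contract (x, u)).
- move=> m km; rewrite (hat_toric_act fanS Sinj Ssurj t (contract (x, u))).
  rewrite (@hat_contract (x, u))// (@hat_contract (act t x, u)) ?E//=.
  rewrite /bent /bent_wt E hat_toric_act// argM arg_norm1 ?torus_norm//.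
  by rewrite cabsM cabs_norm1 ?torus_norm// mul1r mulrA.
Qed.

Lemma contract0 x (u : I) : \val u = 0 -> contract (x, u) = from_nerve (to_nerve x).
Proof.
move=> u0; have N := npos_to_nerve x.
apply: (@toric_ext _ _ _ fanS _ S Ssurj (capL x)); first exact: leJ_contract.
  by rewrite (orb_from_nerve) N.
move=> m km; rewrite hat_contract// (hat_from_nerve) ?N//.
rewrite /bent u0 subr0 ramp0 ramp1 powRr0 mul1r.
have -> : bent_wt 1 x = wt^~ (fun i => Lam i x).
  by apply/funext => j; rewrite /bent_wt subrr add0r mul1r.
have [pm|npm] := pselect (perp (capL x) m); last first.
  rewrite (cw_nperp _ km npm) ?rmorph0 ?mulr0//.
  exact/(wt_capJ (Lam_top x)).
congr (_ * _); rewrite nang_to_nerve argM arg_real ?mulr1.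
  rewrite [RHS]arg_norm1 ?arg_norm//; apply/hat_neq0; move: pm; apply: perp_le.
  exact: leJ_orb_Lam.
rewrite lt_neqAle theta_ge0 ?andbT; last by move=> j; exact: Lam_ge0.
by rewrite eq_sym; exact/(theta_capJ (Lam_top x)).
Qed.

Lemma contract1 x (u : I) : \val u = 1 -> contract (x, u) = x.
Proof.
move=> u1; apply: (@toric_ext _ _ _ fanS _ S Ssurj (capL x)).
- exact: leJ_contract.
- exact: leJ_orb_Lam.
- move=> m km; rewrite hat_contract//= u1 subrr ramp0 ramp1 /bent.
  rewrite (_ : bent_wt 0 x = fun=> 1); last first.
    by apply/funext => j; rewrite /bent_wt subr0 mul0r addr0.
  by rewrite cw_one mulr1 powRr1 ?cabs_ge0// mulrC argE.
Qed.

(** A maximum is taken instead of a convex combination: one of the two tuples is at full scale, so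
    some coordinate stays equal to 1. *)
Definition slide_pos (q : nerve * I) j : R :=
  Num.max (ramp (\val q.2) * npos q.1 j)
    (ramp (1 - \val q.2) * Lam j (from_nerve q.1)).

Definition slide (q : nerve * I) : nerve := nerve_mk (nclass q.1) (slide_pos q).

Lemma slide_top q : top_face (slide_pos q).
Proof.
case: q => y u; have slide_posE j : slide_pos (y, u) j =
  Num.max (ramp (\val u) * npos y j) (ramp (1 - \val u) * Lam j (from_nerve y)) by [].
have /andP[u0 u1] := unit_interval_bounds u.
have /andP[a0 a1] := ramp_unit u; have /andP[b0 b1] := ramp_unitC u.
have bd j : 0 <= slide_pos (y, u) j <= 1.
  rewrite slide_posE le_max ge_max; have [p01 _] := npos_top y.
  have /andP[p0 p1] := p01 j; rewrite mulr_ge0//=.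
  have L0 := Lam_ge0 fanS Ssurj j (from_nerve y).
  have L1 := Lam_le1 fanS Ssurj j (from_nerve y).
  by apply/andP; split; exact: mulr_ile1.
split=> //; have [u01|u01] := leP 2^-1 (\val u).
  have [_ [j j1]] := npos_top y; exists j; apply/eqP; rewrite eq_le.
  have /andP[_ ->] := bd j; rewrite slide_posE le_max j1 mulr1.
  by rewrite /ramp min_l ?lexx//; lra.
have [j j1] := Lam_eq1 fanS Ssurj (from_nerve y); exists j; apply/eqP; rewrite eq_le.
have /andP[_ ->] := bd j; rewrite slide_posE le_max j1 mulr1.
by rewrite /ramp (@min_l _ _ _ (2 * (1 - _))) ?lexx ?orbT//; lra.
Qed.

(** Both tuples are supported on cones containing [capJ (npos y)], the orbit cone of [from_nerve y].
    Hence the class of y still determines a class modulo the stabilizer along the whole path. *)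
Lemma slide_leJ q : leJ (capJ (npos q.1)) (capJ (slide_pos q)).
Proof.
apply/(leJ_capJ (slide_top q)) => i.
rewrite /slide_pos lt_max => /orP[] H; last first.
  rewrite -(orb_from_nerve); apply/(@Lam_gt0 _ _ _ fanS _ S Ssurj).
  rewrite lt_neqAle Lam_ge0 andbT; apply/eqP => e.
  by move: H; rewrite -e mulr0 ltxx.
have pi : 0 < npos q.1 i.
  rewrite lt_neqAle npos_ge0 andbT; apply/eqP => e.
  by move: H; rewrite -e mulr0 ltxx.
by move=> w; exact: (capJ_leJ (npos_top q.1) pi).
Qed.

Arguments slide_leJ q [t] _.

Lemma npos_slide q : npos (slide q) = slide_pos q.
Proof. by apply: npos_mk; exact: slide_top. Qed.

Lemma nang_slide q m :
  nang (slide q) m = arg (nang q.1 m) * (theta m (slide_pos q))%:C.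
Proof.
rewrite nang_mk; last exact: slide_top.
have [->|tm] := eqVneq (theta m (slide_pos q)) 0; first by rewrite !mulr0.
rewrite (@arg_nang q.1)//; apply: (perp_le (slide_leJ q)).
exact/(theta_capJ (slide_top q)).
Qed.

Lemma slide_continuous : continuous slide.
Proof.
move=> [y0 u0]; have FF : Filter (nbhs (y0, u0)) := nbhs_filter (y0, u0).
have c1 := @cvg_fst _ _ (nbhs y0) (nbhs u0) (nbhs_filter u0).
have c2 := @cvg_snd _ _ (nbhs y0) (nbhs u0) (nbhs_filter y0).
have [cp cq] := (@nerve_cvg _ _ _ _ S (nerve * I)%type (nbhs (y0, u0)) FF fst y0).1 c1.
have cs : (fun q : nerve * I => \val q.2) @ (y0, u0) --> \val u0.
  exact: (@cvg_set_type _ (nbhs (y0, u0)) FF _ _ snd u0).1 c2.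
have cs1 : (fun q : nerve * I => 1 - \val q.2) @ (y0, u0) --> 1 - \val u0.
  by apply: (@cvgB _ _ _ _ FF) => //; exact: (@cvg_cst _ _ _ (nbhs (y0, u0)) FF).
have cL j : (fun q : nerve * I => Lam j (from_nerve q.1)) @ (y0, u0) -->
    Lam j (from_nerve y0).
  have c3 := cvg_comp _ _ c1 (@from_nerve_continuous y0).
  exact: (cvg_comp _ _ c3 (@Lam_cvg _ _ _ fanS _ S Sinj Ssurj j (from_nerve y0))).
have cS j : (fun q : nerve * I => slide_pos q j) @ (y0, u0) --> slide_pos (y0, u0) j.
  apply: (@cvg_max _ _ (nbhs (y0, u0)) FF).
    by apply: (@cvgM _ _ (nbhs (y0, u0)) FF); [exact: ramp_cvg|exact: cp].
  by apply: (@cvgM _ _ (nbhs (y0, u0)) FF); [exact: ramp_cvg|exact: cL].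
apply/(@nerve_cvg _ _ _ _ S (nerve * I)%type (nbhs (y0, u0)) FF); split=> [j|m].
  rewrite npos_slide (_ : (fun q => _) = fun q : nerve * I => slide_pos q j)//.
  by apply/funext => q; rewrite npos_slide.
rewrite nang_slide (_ : (fun q => _) = fun q : nerve * I =>
  arg (nang q.1 m) * (theta m (slide_pos q))%:C); last first.
  by apply/funext => q; rewrite nang_slide.
apply: (@cvg_mul_bounded R _ (nbhs (y0, u0)) FF (fun q => arg (nang q.1 m))).
- by move=> q; exact: cabs_arg_le1.
- exact: (@theta_cvg _ _ _ _ S _ (nbhs (y0, u0)) FF).
- move=> /(theta_capJ (slide_top (y0, u0))) km.
  apply: (@cvg_arg R _ (nbhs (y0, u0)) FF (fun q => nang q.1 m)); last exact: cq.
  apply/(nang_neq0 fanS Ssurj)/(capJ_perp (npos_top y0)).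
  exact: (perp_le (slide_leJ (y0, u0))).
Qed.

Lemma slide_equivariant (u : I) :
  equivariant (@nerve_act R n Sigma J S) (@nerve_act R n Sigma J S)
    (fun y => slide (y, u)).
Proof.
move=> t y; have E : slide_pos (nerve_act t y, u) = slide_pos (y, u).
  apply/funext => j; rewrite /slide_pos /= npos_act.
  by rewrite (from_nerve_equivariant) Lam_toric_act.
apply: nerve_ext => [j|m]; first by rewrite npos_act !npos_slide E.
rewrite nang_act !nang_slide E/= nang_act argM arg_norm1 ?torus_norm//.
by rewrite mulrA.
Qed.

Lemma slide0 y (u : I) : \val u = 0 -> slide (y, u) = to_nerve (from_nerve y).
Proof.
move=> u0; have E : slide_pos (y, u) = fun j => Lam j (from_nerve y).
  apply/funext => j; rewrite /slide_pos /= u0 subr0 ramp0 ramp1 mul0r mul1r.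
  by rewrite max_r// Lam_ge0.
apply: nerve_ext => [j|m]; first by rewrite npos_slide E npos_to_nerve.
rewrite nang_slide nang_to_nerve E.
have [->|tm] := eqVneq (theta m (fun j => Lam j (from_nerve y))) 0.
  by rewrite !mulr0.
have pm : perp (capJ (npos y)) m.
  have := @slide_leJ (y, u); rewrite E /= => le; apply: (perp_le le).
  exact/(theta_capJ (Lam_top (from_nerve y))).
congr (_ * _); rewrite (hat_from_nerve); last exact: perp_dualm.
rewrite argM arg_real ?mulr1.
  by rewrite [RHS]arg_norm1// arg_norm//;
    apply/(nang_neq0 fanS Ssurj)/(capJ_perp (npos_top y)).
rewrite lt_neqAle cw_ge0 ?andbT; last by move=> j; apply: wt_ge0 => i; exact: npos_ge0.
rewrite eq_sym; apply: (@cw_perp _ (capJ (npos y))) => //.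
by move=> j; exact: wt_npos.
Qed.

Lemma slide1 y (u : I) : \val u = 1 -> slide (y, u) = y.
Proof.
move=> u1; have E : slide_pos (y, u) = npos y.
  apply/funext => j; rewrite /slide_pos /= u1 subrr ramp0 ramp1 mul0r mul1r.
  by rewrite max_l// npos_ge0.
apply: nerve_ext => [j|m]; first by rewrite npos_slide E.
by rewrite nang_mk ?E; [rewrite nclassE|exact: npos_top].
Qed.

Lemma toric_nerve_equivalent :
  T_homotopy_equivalent act (@nerve_act R n Sigma J S).
Proof.
split; [exact: toric_action Ssurj|exact: nerve_action|].
exists to_nerve, from_nerve; split.
- by split; [exact: to_nerve_continuous|exact: to_nerve_equivariant].
- by split; [exact: from_nerve_continuous|exact: from_nerve_equivariant].
- exists contract; split=> //.
  + exact: contract_continuous.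
  + exact: contract_equivariant.
  + exact: contract0.
  + exact: contract1.
- exists slide; split=> //.
  + exact: slide_continuous.
  + exact: slide_equivariant.
  + exact: slide0.
  + exact: slide1.
Qed.

End HomotopyEquivalence.

(** * Complete fans *)

Lemma farkas_fin (F : realFieldType) n (I : finType) (v : I -> 'rV[F]_n) b :
  (exists2 c : I -> F, forall i, 0 <= c i & b = \sum_i c i *: v i) \/
  exists m, (forall i, 0 <= dot m (v i)) /\ dot m b < 0.
Proof.
have [[c [c0 ->]]|[m [mv mb]]] := farkas (fun i : 'I_#|I| => v (enum_val i)) b.
  left; exists (fun i => c (enum_rank i)) => //.
  rewrite [RHS](reindex (@enum_val I predT))/=; last first.
    by apply: onW_bij; exact: enum_val_bij.
  by apply: eq_bigr => i _; rewrite enum_valK.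
right; exists m; split=> // i.
by have := mv (enum_rank i); rewrite enum_rankK.
Qed.

(** Provides the logarithm vector of a point from the logarithms of its moduli in
    [cell_point_surj]. *)
Lemma additive_int_row (R : realType) n (f : 'rV[int]_n -> R) :
  (forall a b, f (a + b) = f a + f b) ->
  exists w, forall m, f m = dot (lattice_vec m) w.
Proof.
move=> fD; have f0 : f 0 = 0 by apply: (addrI (f 0)); rewrite -fD !addr0.
have fN m : f (- m) = - f m.
  by apply: (addrI (f m)); rewrite -fD !subrr f0.
have fMn m k : f (m *+ k) = f m *+ k.
  by elim: k => [|k IH]; rewrite ?f0// !mulrS fD IH.
have fZ a m : f (a *: m) = a%:~R * f m.
  rewrite -[in LHS](intz a) scaler_int mulrzl; case: a => k; first exact: fMn.
  by rewrite -[LHS]/(f (- (m *+ k.+1))) fN fMn.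
exists (\row_i f (delta_mx 0 i)) => m; rewrite {1}[m]row_sum_delta.
rewrite (big_morph f fD f0); apply: eq_bigr => i _.
by rewrite fZ !mxE.
Qed.

(** * Chains of cones and uniqueness of chain decompositions *)

Section FanChains.
Context {R : realType} {n : nat} (Sigma : set (set 'rV[R]_n)).
Context (fanS : rational_fan Sigma) {J : finType} (S : J -> Sigma).
Context (Sinj : injective S) (Ssurj : forall s : Sigma, exists j, S j = s) (j0 : J).
Local Notation M := 'rV[int]_n.
Local Notation cone := (cone S).
Local Notation dualm := (dualm S).
Local Notation perp := (perp S).
Local Notation leJ := (leJ S).
Local Notation sep := (sep fanS S).
Local Notation relint := (relint fanS S).
Local Notation T := (torus R n).
Local Notation X := (toric_variety Sigma).
Local Notation orb := (orb fanS Ssurj).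
Local Notation hat := (hat fanS Ssurj).
Local Notation act := (toric_act Sigma).
Local Notation cw := (cw fanS S).
Local Notation C := (R[i]^o).
Implicit Types (i j k z : J) (m : M) (a c : J -> R).

Lemma chain_top (P : J -> Prop) : (exists i, P i) ->
  (forall i j, P i -> P j -> leJ i j \/ leJ j i) ->
  exists2 k, P k & forall i, P i -> leJ i k.
Proof.
move=> [i0 Pi0] Pc; pose A : {set J} := [set i | `[< P i >]]%SET.
pose N i := #|[set j | `[< leJ j i >]]%SET|.
have Ai0 : i0 \in A by rewrite inE; exact/asboolP.
case: (@arg_maxnP _ i0 (fun i => i \in A) N Ai0) => k.
rewrite inE => /asboolP Pk kmax; exists k => // i Pi.
have [//|ki] := Pc i k Pi Pk; apply: contrapT => nik.
have : (N k < N i)%N.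
  apply: proper_card; apply/fintype.properP; split.
    apply/fintype.subsetP => j; rewrite !finset.in_set => /asboolP jk; apply/asboolP.
    by move=> u /jk/ki.
  by exists i; rewrite !finset.in_set; apply/asboolP.
by rewrite ltnNge => /negP; apply; apply: kmax; rewrite inE; exact/asboolP.
Qed.

Record chain_coeff z a : Prop := ChainCoeff {
  chain_ge0 : forall i, 0 <= a i;
  chain_above : forall i, 0 < a i -> leJ z i /\ ~ leJ i z;
  chain_total : forall i j, 0 < a i -> 0 < a j -> leJ i j \/ leJ j i }.

(** The pairing of m with the vector that is the combination of the interior vectors with
    coefficients a. *)
Definition chain_pairing a m : R := \sum_i a i * (dot m (relint i))%:~R.

Lemma chain_coeff_top z a : chain_coeff z a ->
  exists k, [/\ leJ z k, forall i, 0 < a i -> leJ i k & k = z \/ 0 < a k].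
Proof.
move=> za; have [aP|a0] := pselect (exists i, 0 < a i).
  have [k ak kmax] := chain_top aP (chain_total za).
  by exists k; split=> //; [have [] := chain_above za ak|right].
by exists z; split=> // [i ai|]; [case: a0; exists i|left].
Qed.

(** The form [sep k k'] is nonnegative on the first chain and nonpositive on the second, so equal
    pairings are 0 and every term vanishes, in particular that of k. *)
Lemma chain_tops_le z a a' k k' :
  (forall m, perp z m -> chain_pairing a m = chain_pairing a' m) ->
  chain_coeff z a -> chain_coeff z a' -> leJ z k -> leJ z k' ->
  (forall i, 0 < a i -> leJ i k) -> (forall i, 0 < a' i -> leJ i k') ->
  k = z \/ 0 < a k -> leJ k k'.
Proof.
move=> aa' za za' zk zk' ak a'k' [->//|ak0].
pose m := sep k k'; have km : dualm k m := @sep_dualm _ _ _ fanS _ S k k'.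
have kNm : dualm k' (- m) := @sepN_dualm _ _ _ fanS _ S k k'.
have zm : perp z m.
  by apply/perpP; split; [exact: dualm_le km|exact: dualm_le kNm].
have t0 i : 0 <= a i * (dot m (relint i))%:~R.
  have := chain_ge0 za i; rewrite le_eqVlt => /predU1P[<-|ai]; first by rewrite mul0r.
  by rewrite pmulr_rge0// ler0z; exact: (dot_relint_ge0 fanS (ak _ ai)).
have t0' i : a' i * (dot m (relint i))%:~R <= 0.
  have := chain_ge0 za' i; rewrite le_eqVlt => /predU1P[<-|ai]; first by rewrite mul0r.
  rewrite pmulr_rle0// lerz0 -oppr_ge0 -dotNl.
  exact: (dot_relint_ge0 fanS (a'k' _ ai)).
have s0 : chain_pairing a m == 0.
  rewrite eq_le sumr_ge0 ?andbT => [|i _//].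
  by rewrite aa'// sumr_le0.
have /allP/(_ k (mem_index_enum _)) : all (fun i => predT i ==>
    (a i * (dot m (relint i))%:~R == 0)) (index_enum J).
  by rewrite -psumr_eq0// => i _; exact: t0.
rewrite /= mulf_eq0 gt_eqF//= intr_eq0 => /eqP.
by move=> /(dot_relint_eq0 fanS km)/(perp_sep fanS _ (leJ_refl S k)).
Qed.

Lemma chain_coeff_shrink z a b : (forall i, 0 <= b i <= a i) ->
  chain_coeff z a -> chain_coeff z b.
Proof.
move=> ba za; have pos i : 0 < b i -> 0 < a i.
  by move=> /lt_le_trans; apply; have /andP[] := ba i.
split=> [i|i /pos|i j /pos ai /pos aj]; first by have /andP[] := ba i.
  exact: chain_above.
exact: (chain_total za).
Qed.

(* The tops k, k' of the two chains agree, since both pairings of the         *)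
(* separating form [sep k k'] vanish; then the smaller of the two top          *)
(* coefficients is subtracted on both sides.                                  *)
Lemma chain_unique z a a' : chain_coeff z a -> chain_coeff z a' ->
  (forall m, perp z m -> chain_pairing a m = chain_pairing a' m) -> a = a'.
Proof.
pose sz a := #|[set i | 0 < a i]%SET|.
have [N] := ubnP (sz a + sz a')%N.
elim: N a a' => // N IH a a' /ltnSE aN za za' aa'.
have [k [zk ak kz]] := chain_coeff_top za.
have [k' [zk' a'k' kz']] := chain_coeff_top za'.
have kk' : k = k'.
  apply: (leJ_anti Sinj).
    exact: (chain_tops_le aa' za za' zk zk' ak a'k' kz).
  by apply: (chain_tops_le _ za' za zk' zk a'k' ak kz') => m zm; rewrite aa'.
subst k'; have [kE|kNz] := pselect (k = z).
  subst k; have E b i : chain_coeff z b -> (forall i, 0 < b i -> leJ i z) -> b i = 0.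
    move=> zb bz; have := chain_ge0 zb i; rewrite le_eqVlt => /predU1P[//|bi].
    by case: (chain_above zb bi) => _ []; exact: bz.
  by apply/funext => i; rewrite (E a)// (E a').
case: kz => // ak0; case: kz' => // a'k0.
pose d := Num.min (a k) (a' k).
have d0 : 0 < d by rewrite lt_min ak0.
pose sub b i : R := b i - d *+ (i == k).
have sub_le b : d <= b k -> (forall i, 0 <= b i) -> forall i, 0 <= sub b i <= b i.
  move=> dk b0 i; rewrite /sub; case: eqVneq => [->|_]; last by rewrite subr0 b0/=.
  by rewrite subr_ge0 dk/= lerBlDr lerDl ltW.
have da : d <= a k by rewrite ge_min lexx.
have da' : d <= a' k by rewrite ge_min lexx orbT.
have sub_pairing b m : chain_pairing (sub b) m =
    chain_pairing b m - d * (dot m (relint k))%:~R.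
  rewrite /chain_pairing (bigD1 k)//= [X in _ = X - _](bigD1 k)//= addrAC.
  rewrite {1}/sub eqxx mulrBl; congr (_ + _); apply: eq_bigr => i /negPf ik.
  by rewrite /sub ik subr0.
have sz_le b : d <= b k -> (forall i, 0 <= b i) -> (sz (sub b) <= sz b)%N.
  move=> db b0; apply: subset_leq_card; apply/fintype.subsetP => i; rewrite !inE.
  by move=> /lt_le_trans; apply; have /andP[] := sub_le b db b0 i.
have sz_lt b : d = b k -> (forall i, 0 <= b i) -> (sz (sub b) < sz b)%N.
  move=> db b0; apply: proper_card; apply/fintype.properP; split.
    apply/fintype.subsetP => i; rewrite !inE => /lt_le_trans; apply.
    have db' : d <= b k by rewrite db.
    by have /andP[] := sub_le b db' b0 i.
  exists k; rewrite !finset.in_set; first by rewrite -db.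
  by rewrite /sub eqxx db subrr ltxx.
have ss : sub a = sub a'.
  apply: IH.
  - have := sz_le a da (chain_ge0 za); have := sz_le a' da' (chain_ge0 za').
    have [aa|aa] := leP (a k) (a' k).
      have := sz_lt a (min_l aa) (chain_ge0 za); lia.
    have := sz_lt a' (min_r (ltW aa)) (chain_ge0 za'); lia.
  - by apply: (chain_coeff_shrink _ za); exact: sub_le (chain_ge0 za).
  - by apply: (chain_coeff_shrink _ za'); exact: sub_le (chain_ge0 za').
  - by move=> m zm; rewrite !sub_pairing aa'.
apply/funext => i; have := congr1 (fun f => f i) ss.
by rewrite /sub => /addIr.
Qed.

(** * Existence of chain decompositions *)

Local Notation vec j := (lattice_vec (relint j) : 'rV[R]_n).

Lemma cone_add j u w : cone j u -> cone j w -> cone j (u + w).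
Proof. by have [k [v ->]] := cone_gens fanS S j; exact: inconeD. Qed.

Lemma cone_scale j (c : R) u : 0 <= c -> cone j u -> cone j (c *: u).
Proof. by have [k [v ->]] := cone_gens fanS S j; exact: inconeZ. Qed.

(** For z below j this is cone j plus the span of z, that is, cone j seen modulo that span: adding a
    large multiple of an interior vector of z absorbs the span. *)
Definition star z j u := exists2 s : R, 0 <= s & cone j (u + s *: vec z).

Lemma star_add z j u w : star z j u -> star z j w -> star z j (u + w).
Proof.
move=> [s s0 us] [t t0 wt]; exists (s + t); first exact: addr_ge0.
by rewrite scalerDl addrACA; exact: cone_add.
Qed.

Lemma star_scale z j (c : R) u : 0 <= c -> star z j u -> star z j (c *: u).
Proof.
move=> c0 [s s0 us]; exists (c * s); first exact: mulr_ge0.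
by rewrite -scalerA -scalerDr; exact: cone_scale.
Qed.

Lemma star_dot_ge0 z j w u : (forall u, cone j u -> 0 <= dot w u) ->
  dot w (vec z) = 0 -> star z j u -> 0 <= dot w u.
Proof.
by move=> w0 wz [s s0 /w0]; rewrite dotDr dotZr wz mulr0 addr0.
Qed.

(** Farkas' lemma for the generators of cone j together with the opposites of [vec z] and u. *)
Lemma star_farkas z j u b : leJ z j ->
  (exists2 s : R, 0 <= s & star z j (b + s *: u)) \/
  exists w, [/\ forall u, cone j u -> 0 <= dot w u, dot w (vec z) = 0,
    dot w u <= 0 & dot w b < 0].
Proof.
move=> zj; have [k [v jv]] := cone_gens fanS S j.
pose g (i : ('I_k + bool)%type) : 'rV[R]_n :=
  match i with
  | inl i => lattice_vec (v i)
  | inr true => - vec z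
  | inr false => - u
  end.
have [[c c0 ->]|[w [wg wb]]] := farkas_fin g b.
  left; exists (c (inr false)) => //; exists (c (inr true)) => //.
  rewrite big_sumType/= big_bool/= !scalerN addrA !subrK jv.
  by exists (fun i : 'I_k => c (inl i)); split=> [i|]; first exact: c0.
right; have w0 t : cone j t -> 0 <= dot w t.
  by rewrite jv; apply: incone_dot_ge0 => i; exact: (wg (inl i)).
exists w; split=> //; last by have := wg (inr false); rewrite /= dotNr oppr_ge0.
apply/eqP; rewrite eq_le w0 ?andbT; last exact/zj/relint_cone.
by have := wg (inr true); rewrite /= dotNr oppr_ge0.
Qed.

(* The points u + N z, for N large, stay in one of the finitely many cones,    *)
(* and such a cone contains z by Farkas' lemma.                               *)
Lemma star_exists z u : complete_fan Sigma -> exists2 j, leJ z j & star z j u.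
Proof.
move=> cS; apply: contrapT => H.
have bad j : exists N : nat, forall N' : nat, (N <= N')%N ->
    ~ cone j (u + N'%:R *: vec z).
  have [zj|nzj] := pselect (leJ z j).
    by exists 0%N => N' _ ju; apply: H; exists j => //; exists N'%:R.
  have [k [v jv]] := cone_gens fanS S j.
  have [vz|[w [wv wz]]] := farkas (fun i : 'I_k => lattice_vec (v i)) (vec z).
    by case: nzj; apply: (relint_leJ (fanS := fanS)); rewrite jv.
  exists (Num.bound `|dot w u / - dot w (vec z)|) => N' NN'.
  rewrite jv => /(incone_dot_ge0 wv); rewrite dotDr dotZr leNgt => /negP; apply.
  have wz0 : 0 < - dot w (vec z) by rewrite oppr_gt0.
  suff H' : dot w u < N'%:R * - dot w (vec z) by rewrite mulrN in H'; lra.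
  rewrite -ltr_pdivrMr//.
  apply: lt_le_trans (_ : (Num.bound `|dot w u / - dot w (vec z)|)%:R <= _).
    exact: le_lt_trans (ler_norm _) (archi_boundP (normr_ge0 _)).
  by rewrite ler_nat.
pose N := (\sum_j projT1 (cid (bad j)))%N.
have [s Ss su] : (\bigcup_(s in Sigma) s) (u + N%:R *: vec z) by rewrite cS.
have [j jE] := cone_surj Ssurj Ss; rewrite -jE in su.
apply: (projT2 (cid (bad j)) N _ su).
by rewrite /N (bigD1 j)//= leq_addr.
Qed.

(* t is the largest number such that u - t j stays in [star z j]; Farkas'     *)
(* lemma provides a face of j that contains the point reached.                *)
Lemma star_step z j u : leJ z j -> ~ leJ j z -> star z j u ->
  exists k (t : R), [/\ 0 <= t, leJ z k, leJ k j, ~ leJ j k &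
    star z k (u - t *: vec j)].
Proof.
move=> zj njz ju; pose A : set R := [set t | 0 <= t /\ star z j (u - t *: vec j)].
have A0 : A 0 by split=> //; rewrite scale0r subr0.
pose m := sep j z; have jm : dualm j m := @sep_dualm _ _ _ fanS _ S j z.
have zm : perp z m.
  apply/perpP; split; first exact: dualm_le jm.
  exact: (@sepN_dualm _ _ _ fanS _ S j z).
have x0 : 0 < dot (lattice_vec m) (vec j).
  rewrite dot_lattice ltr0z lt_neqAle (dot_relint_ge0 fanS (leJ_refl S j))// andbT.
  apply/eqP => /esym/(dot_relint_eq0 fanS jm)/(perp_sep fanS _ (leJ_refl S j)).
  exact: njz.
have ubA w : (forall u, cone j u -> 0 <= dot w u) -> dot w (vec z) = 0 ->
    0 < dot w (vec j) -> ubound A (dot w u / dot w (vec j)).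
  move=> w0 wz wj t [t0 /(star_dot_ge0 w0 wz)].
  by rewrite dotDr dotNr dotZr subr_ge0 -ler_pdivlMr.
have hA : has_sup A.
  split; first by exists 0.
  by exists (dot (lattice_vec m) u / dot (lattice_vec m) (vec j)); apply: ubA;
    [|apply: zm; exact: relint_cone|].
pose t := sup A; have t0 : 0 <= t by apply: (ub_le_sup hA.2).
pose v := u - t *: vec j.
(* The supremum is attained: by Farkas' lemma [star z j] is defined by weak linear inequalities, and
   these pass to the supremum. *)
have jv : star z j v.
  have [[s s0]|[w [w0 wz _ wv]]] := star_farkas 0 v zj; first by rewrite scaler0 addr0.
  exfalso; move: wv; rewrite ltNge => /negP; apply.
  have := w0 _ (relint_cone fanS S j); rewrite le_eqVlt => /predU1P[wj|wj].
    by rewrite dotDr dotNr dotZr -wj mulr0 subr0; exact: star_dot_ge0 ju.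
  rewrite dotDr dotNr dotZr subr_ge0 -ler_pdivlMr//.
  by apply: ge_sup; [exact: hA.1|exact: ubA].
have tmax e : 0 < e -> ~ star z j (v - e *: vec j).
  move=> e0 je; have : A (t + e).
    by split; [exact/addr_ge0/ltW|rewrite scalerDl opprD addrA].
  by move=> /(ub_le_sup hA.2); rewrite gerDl leNgt e0.
(* The first alternative would allow t to be increased by 1/(1 + s). The second gives a form w
   positive at [vec j] and vanishing at v, which cuts out the proper face. *)
have [[s s0 js]|[w [w0 wz wv wj]]] := star_farkas v (- vec j) zj.
  exfalso; have s1 : 0 < 1 + s by rewrite ltr_wpDr.
  apply: (tmax (1 + s)^-1); first by rewrite invr_gt0.
  have -> : v - (1 + s)^-1 *: vec j = (1 + s)^-1 *: (v + (- vec j + s *: v)).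
    rewrite [- _ + _]addrC addrA -{2}[v]scale1r -scalerDl scalerBr scalerA.
    by rewrite mulVf ?scale1r// gt_eqF.
  by apply: star_scale; [rewrite invr_ge0 ltW|exact: star_add].
have [k kE] := cone_face fanS Ssurj w0.
have wv0 : dot w v = 0.
  by apply/eqP; rewrite eq_le wv (star_dot_ge0 w0 wz jv).
exists k, t; split=> //.
- move=> x zx; rewrite kE; split; first exact: zj.
  apply: (@relint_eq0 _ _ _ fanS _ S z w) => // y zy; exact/w0/zj.
- by move=> x; rewrite kE => -[].
- move=> jk; have := jk _ (relint_cone fanS S j); rewrite kE => -[_ /=] wj0.
  by move: wj; rewrite dotNr wj0 oppr0 ltxx.
- have [s s0 js] := jv; exists s => //; rewrite kE; split=> //=.
  by rewrite dotDr dotZr wz mulr0 addr0.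
Qed.

(** [star_step] removes a multiple of [vec j] and moves to a strictly smaller cone above z;
    induction is on the number of cones below j. *)
Lemma star_chain z j u : leJ z j -> star z j u -> exists a,
  [/\ chain_coeff z a, forall i, 0 < a i -> leJ i j &
    forall m, perp z m -> dot (lattice_vec m) u = chain_pairing a m].
Proof.
have [N] := ubnP #|[set i | `[< leJ i j >]]%SET|.
elim: N j u => // N IH j u /ltnSE jN zj ju.
have [jz|njz] := pselect (leJ j z).
  exists (fun=> 0); split=> [|i|m zm]; rewrite ?ltxx//.
    by split=> [//|i|i k]; rewrite ltxx.
  rewrite /chain_pairing big1 => [|i _]; last by rewrite mul0r.
  have [s s0 /jz/zm] := ju; rewrite dotDr dotZr.
  by rewrite (zm _ (relint_cone fanS S z)) mulr0 addr0.
have [k [t [t0 zk kj njk kt]]] := star_step zj njz ju.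
have kN : (#|[set i | `[< leJ i k >]]%SET| < N)%N.
  apply: leq_trans jN; apply: proper_card; apply/fintype.properP; split.
    apply/fintype.subsetP => i; rewrite !finset.in_set => /asboolP ik; apply/asboolP.
    by move=> x /ik/kj.
  by exists j; rewrite !finset.in_set; apply/asboolP.
have [a [za ak aE]] := IH k _ kN zk kt.
have aj i : 0 < a i + t *+ (i == j) -> i = j \/ 0 < a i.
  by case: eqVneq => [->|_]; [left|rewrite addr0; right].
have ij i : 0 < a i -> leJ i j by move=> /ak ik x /ik/kj.
exists (fun i => a i + t *+ (i == j)); split.
- split=> [i|i /aj[->|]|i i'].
  + by rewrite addr_ge0 ?(chain_ge0 za)// mulrn_wge0.
  + by [].
  + exact: chain_above.
  + move=> /aj[->|ai] /aj[->|ai']; [by left|by right; exact: ij|by left; exact: ij|].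
    exact: (chain_total za).
- by move=> i /aj[->|/ij].
- move=> m zm; have := aE m zm; rewrite dotDr dotNr dotZr dot_lattice => /eqP.
  rewrite subr_eq => /eqP ->; rewrite /chain_pairing [RHS](bigD1 j)//=.
  rewrite eqxx mulrDl addrAC [in LHS](bigD1 j)//=; congr (_ + _ + _).
  by apply: eq_bigr => i /negPf ->; rewrite addr0.
Qed.

Lemma chain_exists z u : complete_fan Sigma -> exists2 a, chain_coeff z a &
  forall m, perp z m -> dot (lattice_vec m) u = chain_pairing a m.
Proof.
move=> /(star_exists z u)[j zj /(star_chain zj)[a [za _ aE]]].
by exists a.
Qed.

(** * Cells of the toric variety of a complete fan *)

Implicit Types (x : X) (t : T) (e : {set J} * {set J}).

Definition zero_chain c :=
  (forall j, 0 <= c j) /\ exists2 k, c k = 0 & forall i, c i = 0 -> leJ i k.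

Definition top_zero c : J :=
  if pselect (exists2 k, c k = 0 & forall i, c i = 0 -> leJ i k) is left h
  then s2val (cid2 h) else j0.

(** With c_j = exp(-a_j), this is t times the exponential of minus the sum of the a_j [vec j], a
    coordinate 0 meaning a limit. The largest cone with coordinate 0 is the cone of the orbit. *)
Definition cell_point t c : X := chart S (top_zero c) (fun m => t m * (cw c m)%:C).

Section ZeroChain.
Context {c : J -> R} (cP : zero_chain c).

Lemma top_zeroP : c (top_zero c) = 0 /\ forall i, c i = 0 -> leJ i (top_zero c).
Proof.
rewrite /top_zero; case: pselect => [h|[]]; last by case: cP.
by case: cid2.
Qed.

Lemma top_zero_leJ i : c i = 0 -> leJ i (top_zero c).
Proof. exact: top_zeroP.2. Qed.

Lemma top_zero_eq k : c k = 0 -> (forall i, c i = 0 -> leJ i k) -> top_zero c = k.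
Proof.
move=> ck kmax; apply: (leJ_anti Sinj); last exact: top_zero_leJ.
exact/kmax/top_zeroP.1.
Qed.

Lemma hat_cell_point t m : dualm (top_zero c) m ->
  hat (cell_point t c) m = t m * (cw c m)%:C.
Proof.
move=> km; rewrite hat_chart//; apply: torus_cw_character => j.
exact: top_zero_leJ.
Qed.

Lemma cw_top_zero m : dualm (top_zero c) m -> ~ perp (top_zero c) m -> cw c m = 0.
Proof. by move=> km npm; rewrite (cw_nperp fanS _ km npm)//; exact: top_zeroP.1. Qed.

Lemma orb_cell_point t : orb (cell_point t c) = top_zero c.
Proof.
apply: (leJ_anti_perp fanS Sinj); first exact: leJ_chart.
move=> m km /hat_neq0; rewrite hat_cell_point// mulf_eq0 negb_or => /andP[_ c0].
by apply: contrapT => npm; move: c0; rewrite cw_top_zero ?rmorph0 ?eqxx.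
Qed.

Lemma cell_point_ext x t : orb x = top_zero c ->
  (forall m, perp (top_zero c) m -> hat x m = t m * (cw c m)%:C) ->
  x = cell_point t c.
Proof.
move=> xo xE; apply: (@toric_ext _ _ _ fanS _ S Ssurj (top_zero c)).
- by rewrite xo.
- by rewrite orb_cell_point.
- move=> m km; rewrite hat_cell_point//.
  have [pm|npm] := pselect (perp (top_zero c) m); first exact: xE.
  by rewrite cw_top_zero// rmorph0 mulr0 hat_eq0// xo.
Qed.

Lemma cw_gt0 m : perp (top_zero c) m -> 0 < cw c m.
Proof.
move=> pm; rewrite lt_neqAle cw_ge0 ?cP.1 ?andbT; last exact: cP.1.
by rewrite eq_sym; apply: (@cw_perp _ _ _ fanS _ S _ _ top_zero_leJ).
Qed.

End ZeroChain.

Lemma cell_point_act s t c : zero_chain c ->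
  cell_point (s * t)%g c = act s (cell_point t c).
Proof.
move=> cP; apply/esym/cell_point_ext => //.
  by rewrite (orb_toric_act fanS Sinj Ssurj) orb_cell_point.
move=> m /perp_dualm pm; rewrite (hat_toric_act fanS Sinj Ssurj) hat_cell_point//.
by rewrite mulrA.
Qed.

(** Near c0 the zeros of c are among those of c0, so all points lie in the chart of
    [top_zero c0]. *)
Lemma cell_point_cvg (U : Type) (F : set_system U) (FF : Filter F)
    (s : U -> T) (c : U -> J -> R) (t0 : T) (c0 : J -> R) :
  (forall u, zero_chain (c u)) -> zero_chain c0 -> s @ F --> t0 ->
  (forall j, (fun u => c u j) @ F --> c0 j) ->
  (fun u => cell_point (s u) (c u)) @ F --> cell_point t0 c0.
Proof.
move=> cP cP0 st cc.
have near_k : \forall u \near F, leJ (top_zero (c u)) (top_zero c0).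
  have : \forall u \near F, forall j, c0 j != 0 -> c u j != 0.
    apply: filter_forall => j; have [cj|cj] := eqVneq (c0 j) 0.
      exact: nearW.
    by apply: filterS (cvgr_neq0 _ (cc j) cj) => u.
  apply: filterS => u cu; apply: (top_zero_leJ cP0); apply/eqP; apply: contrapT.
  by move=> /negP/cu; rewrite (top_zeroP (cP u)).1 eqxx.
apply: (@cvg_toric _ _ _ fanS _ S Ssurj U F FF _ _ (top_zero c0)).
- by rewrite orb_cell_point.
- by apply: filterS near_k => u; rewrite orb_cell_point.
- move=> m km; rewrite hat_cell_point//.
  apply: (@cvg_near_eq _ F FF C _ (fun u => s u m * (cw (c u) m)%:C)).
    by apply: filterS near_k => u uk; rewrite hat_cell_point//; exact: dualm_le km.
  apply: cvg_complexM; first exact: (torus_cvg _ _).1 st m.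
  apply: cvg_real_complex.
  exact: (@cw_cvg _ _ _ fanS _ S _ _ (@top_zero_leJ _ cP0) U F FF c).
Qed.

(* The cells are indexed by a cone z and a chain of cones strictly above z:   *)
(* the coordinate of z is 0, those of the chain are free, the others are 1.   *)
Record chain_face z e : Prop := ChainFace {
  chain_face_bot : z \notin e.1 /\ z \notin e.2;
  chain_face_disj : face_disjoint e;
  chain_face_cover : forall j, j != z -> j \notin e.1 -> j \in e.2;
  chain_face_le : forall j, j \in e.1 -> leJ z j;
  chain_face_total : forall i j, i \in e.1 -> j \in e.1 -> leJ i j \/ leJ j i }.

Lemma chain_face_mk z (A : {set J}) : (forall j, j \in A -> leJ z j) ->
  (forall i j, i \in A -> j \in A -> leJ i j \/ leJ j i) -> z \notin A ->
  chain_face z (A, ~: (z |: A))%SET.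
Proof.
move=> zA tA nzA; split=> //=; first by rewrite !inE eqxx.
  by move=> j /= jA; rewrite !inE jA orbT.
by move=> j jz jA; rewrite !inE negb_or jz.
Qed.

Section ChainFace.
Context {z : J} {e : {set J} * {set J}} (ze : chain_face z e).
Context {c : J -> R} (ce : cube_face e c).

Lemma chain_face_bounds j : 0 <= c j <= 1.
Proof.
have [eA eB] := ce; case: (boolP (j \in e.1)) => [/eA//|/eB ->].
by case: (j \in e.2); rewrite ?lexx ler01.
Qed.

Lemma chain_face_bot0 : c z = 0.
Proof. by have [zA /negPf zB] := chain_face_bot ze; rewrite ce.2// zB. Qed.

Lemma chain_face_zero j : c j = 0 -> j = z \/ j \in e.1.
Proof.
move=> cj; have [->|jz] := eqVneq j z; first by left.
right; apply: contraT => je; have := chain_face_cover ze jz je.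
by have := ce.2 j je; rewrite cj => + jB; rewrite jB => /esym/eqP; rewrite oner_eq0.
Qed.

Lemma chain_face_zero_le j : c j = 0 -> leJ z j.
Proof. by move=> /chain_face_zero[->//|]; exact: chain_face_le. Qed.

Lemma chain_face_comparable i j : c i = 0 -> j \in e.1 -> leJ i j \/ leJ j i.
Proof.
move=> /chain_face_zero[->|ie] je; last exact: (chain_face_total ze).
by left; exact: (chain_face_le ze).
Qed.

Lemma chain_face_zero_chain : zero_chain c.
Proof.
split=> [j|]; first by have /andP[] := chain_face_bounds j.
apply: (chain_top (P := fun i => c i = 0)); first by exists z; exact: chain_face_bot0.
move=> i j ci cj; have [jz|/(chain_face_comparable ci)//] := chain_face_zero cj.
by right; rewrite jz; exact: chain_face_zero_le.
Qed.

End ChainFace.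

Lemma open_face_top_zero z e c : chain_face z e -> open_face e c -> top_zero c = z.
Proof.
move=> ze oe; have ce := open_face_face oe.
apply: (top_zero_eq (chain_face_zero_chain ze ce)); first exact: (chain_face_bot0 ze ce).
move=> i ci; have [->//|ie] := chain_face_zero ze ce ci.
by have /andP[] := oe.1 i ie; rewrite ci ltxx.
Qed.

(** Let k be the largest zero of c. Characters orthogonal to k ignore the coordinates of cones below
    k, which c' resets to 1 except that of k itself. What remains free is the part of the chain
    strictly above k with coordinate below 1, a proper part. *)
Lemma cell_point_boundary z e c : chain_face z e -> cube_face e c ->
  ~ open_face e c -> exists k e', [/\ chain_face k e', (#|e'.1| < #|e.1|)%N &
    exists2 c', cube_face e' c' & forall t, cell_point t c = cell_point t c'].
Proof.
move=> ze ce neo; have cP := chain_face_zero_chain ze ce.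
pose k := top_zero c; have ck : c k = 0 := (top_zeroP cP).1.
have kmax i : c i = 0 -> leJ i k := @top_zero_leJ _ cP i.
pose A' : {set J} := [set j in e.1 | [&& `[< leJ k j >], j != k & c j < 1]]%SET.
have A'P j : j \in A' -> [/\ j \in e.1, leJ k j, j != k & c j < 1].
  by rewrite finset.in_set => /and4P[je /asboolP kj jk cj].
have nz j : j \in A' -> c j != 0.
  move=> /A'P[_ kj jk _]; apply/eqP => /kmax jk'.
  by move/eqP: jk; apply; exact: (leJ_anti Sinj).
have ke' : chain_face k (A', ~: (k |: A'))%SET.
  apply: chain_face_mk => [j /A'P[]//|i j /A'P[ie _ _ _] /A'P[je _ _ _]|].
    exact: (chain_face_total ze).
  by apply/negP => /A'P[_ _]; rewrite eqxx.
pose e' := (A', ~: (k |: A'))%SET.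
pose c' j := if j \in A' then c j else (j \in e'.2)%:R.
have ce' : cube_face e' c'.
  split=> j /= jA; last by rewrite /c' (negPf jA).
  by rewrite /c' jA; exact: (chain_face_bounds ce).
exists k, e'; split=> //.
  apply: proper_card; rewrite properE; apply/andP; split.
    by apply/fintype.subsetP => j /A'P[].
  apply/negP => /fintype.subsetP sub; apply: neo; split=> [j je|]; last exact: ce.2.
  have jA := sub _ je; have [_ _ _ ->] := A'P _ jA.
  by rewrite lt_neqAle eq_sym nz// (andP (chain_face_bounds ce j)).1.
exists c' => // t; have cP' := chain_face_zero_chain ke' ce'.
have ck' : c' k = 0 := chain_face_bot0 ke' ce'.
have kE : top_zero c' = k.
  apply: (top_zero_eq cP') => // i ci; have [->//|iA] := chain_face_zero ke' ce' ci.
  by have := nz i iA; move: ci; rewrite /c' iA => ->; rewrite eqxx.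
apply: (cell_point_ext cP'); first by rewrite orb_cell_point.
rewrite kE => m km; rewrite hat_cell_point//; last exact: perp_dualm.
congr (_ * (_)%:C); apply: eq_bigr => j _.
have [jk|njk] := pselect (leJ j k).
  have jm : perp j m := perp_le jk km.
  by rewrite (dot_relint_eq0 fanS (perp_dualm jm)).2.
have jk : j != k by apply/eqP => jk; apply: njk; rewrite jk.
congr (_ ^ _); rewrite /c'; case: ifPn => // jA; rewrite finset.in_setC finset.in_setU1 (negPf jk) (negPf jA)/=.
have [je|je] := boolP (j \in e.1).
  have [kj|//] := chain_face_comparable ze ce ck je.
  apply/eqP; rewrite eq_le (andP (chain_face_bounds ce j)).2/= leNgt.
  apply/negP => cj; move/negP: jA; apply; rewrite finset.in_set je jk cj/= andbT.
  exact/asboolP.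
have jz : j != z.
  by apply/eqP => jz; apply: njk; rewrite jz; apply: kmax; exact: (chain_face_bot0 ze ce).
by rewrite ce.2// (chain_face_cover ze jz je).
Qed.

Lemma cw_exp z m W a : perp z m -> (forall j, j != z -> W j = expR (- a j)) ->
  cw W m = expR (- chain_pairing a m).
Proof.
move=> zm Wa; rewrite -[chain_pairing a m]/(\sum_i a i * (dot m (relint i))%:~R) -sumrN expR_sum; apply: eq_bigr => j _.
have [->|jz] := eqVneq j z.
  by rewrite (dot_relint_eq0 fanS (perp_dualm zm)).2// mulr0 oppr0 expR0 expr0z.
rewrite Wa//; case: (dot m (relint j)) => k.
  by rewrite -exprnP -expRM_natr mulNr.
by rewrite NegzE -exprnN -expRM_natr -expRN rmorphN/= mulrN mulNr opprK.
Qed.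

(** The orbit gives z, the phases give t on [perp z], and the logarithms of the moduli give the
    pairings of a chain, to which [chain_unique] applies. *)
Lemma cell_point_inj z z' e e' t t' c c' : chain_face z e -> chain_face z' e' ->
  open_face e c -> open_face e' c' -> cell_point t c = cell_point t' c' ->
  [/\ z = z', c = c' & forall m, perp z m -> t m = t' m].
Proof.
move=> ze ze' oe oe' tt.
have cP := chain_face_zero_chain ze (open_face_face oe).
have cP' := chain_face_zero_chain ze' (open_face_face oe').
have kz := open_face_top_zero ze oe; have kz' := open_face_top_zero ze' oe'.
have zz : z = z'.
  by rewrite -kz -kz' -(orb_cell_point cP t) -(orb_cell_point cP' t') tt.
move: ze' kz'; rewrite -zz => ze' kz'; have hE m : perp z m -> t m * (cw c m)%:C = t' m * (cw c' m)%:C.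
  move=> /perp_dualm zm; rewrite -(hat_cell_point cP t) ?kz// tt.
  by rewrite (hat_cell_point cP' t') ?kz'.
have cwE m : perp z m -> cw c m = cw c' m.
  move=> zm; have := congr1 (@cabs R) (hE m zm).
  rewrite !cabsM (cabs_norm1 (torus_norm t m)) (cabs_norm1 (torus_norm t' m)).
  rewrite !mul1r !cabs_real.
  by rewrite !gtr0_norm//; apply: cw_gt0; rewrite ?kz ?kz'.
split=> // [|m zm]; last first.
  have := hE m zm; rewrite cwE// => /mulIf; apply.
  by rewrite (inj_eq (@complexI R) _ 0) gt_eqF// cw_gt0// kz'.
pose a d j : R := if j == z then 0 else - ln (d j).
have pos d f j : chain_face z f -> open_face f d -> j != z -> 0 < d j.
  move=> zf [fA fB] jz; have [/fA/andP[]//|jf] := boolP (j \in f.1).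
  by rewrite fB// (chain_face_cover zf jz jf).
have expE d f j : chain_face z f -> open_face f d -> j != z -> d j = expR (- a d j).
  move=> zf of_ jz; rewrite /a (negPf jz) opprK lnK// posrE.
  exact: pos zf of_ jz.
have aP d f : chain_face z f -> open_face f d -> chain_coeff z (a d).
  move=> zf of_; have free j : 0 < a d j -> j \in f.1.
    rewrite /a; case: eqVneq => [_|jz]; first by rewrite ltxx.
    move=> d0; apply: contraT => jf; move: d0.
    by rewrite of_.2// (chain_face_cover zf jz jf) ln1 oppr0 ltxx.
  split=> [j|j /free jf|i j /free ie /free je].
  - rewrite /a; case: eqVneq => // jz; rewrite oppr_ge0 ln_le0//.
    by have /andP[] := chain_face_bounds (open_face_face of_) j.
  - split=> [|jz]; first exact: (chain_face_le zf).
    have := (chain_face_bot zf).1; rewrite (leJ_anti Sinj _ jz) ?jf//.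
    exact: (chain_face_le zf).
  - exact: (chain_face_total zf).
have aa : a c = a c'.
  apply: (chain_unique (aP _ _ ze oe) (aP _ _ ze' oe')) => m zm.
  have := cwE m zm; rewrite (cw_exp zm (fun j => expE c e j ze oe)).
  by rewrite (cw_exp zm (fun j => expE c' e' j ze' oe')) => /expR_inj/oppr_inj.
apply/funext => j; have [->|jz] := eqVneq j z.
  rewrite (chain_face_bot0 ze (open_face_face oe)).
  by rewrite (chain_face_bot0 ze' (open_face_face oe')).
by rewrite (expE c e)// (expE c' e')// aa.
Qed.

(** The logarithm of the modulus of [hat x] on [perp z] is the pairing with a vector w; completeness
    decomposes minus w along a chain, the sign coming from c_j = exp(-a_j). *)
Lemma cell_point_surj x : complete_fan Sigma ->
  exists z e t c, [/\ chain_face z e, cube_face e c & x = cell_point t c].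
Proof.
move=> cS; pose z := orb x.
have [Q [Q0 Q1]] := annihilator_projection fanS S z.
have pos m : 0 < cabs (hat x (m *m Q)) by rewrite cabs_gt0; exact/hat_neq0.
pose f m := ln (cabs (hat x (m *m Q))).
have fD m m' : f (m + m') = f m + f m'.
  by rewrite /f mulmxDl hatD// cabsM lnM ?posrE.
have [w wE] := additive_int_row fD.
have [a za aE] := chain_exists z (- w) cS.
pose A : {set J} := [set j | 0 < a j]%SET.
have zA : z \notin A.
  by rewrite finset.in_set; apply/negP => /(chain_above za)[_ []].
pose c j : R := if j == z then 0 else expR (- a j).
have ze : chain_face z (A, ~: (z |: A))%SET.
  apply: chain_face_mk => // [j|i j]; rewrite !finset.in_set.
    by move=> /(chain_above za)[].
  exact: (chain_total za).
have ce : cube_face (A, ~: (z |: A))%SET c.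
  split=> j /= jA.
    rewrite /c; case: eqVneq => _; first by rewrite lexx ler01.
    by rewrite expR_ge0 -expR0 ler_expR oppr_le0 (chain_ge0 za).
  rewrite /c !inE; case: eqVneq => //= jz; move: jA; rewrite finset.in_set => jA.
  have /eqP : a j == 0 by rewrite eq_le (chain_ge0 za) andbT leNgt.
  by move=> ->; rewrite ltxx oppr0 expR0.
have cP := chain_face_zero_chain ze ce.
have kz : top_zero c = z.
  apply: (top_zero_eq cP); first by rewrite /c eqxx.
  move=> i; rewrite /c; case: eqVneq => [-> _|_ /eqP]; first exact: leJ_refl.
  by rewrite gt_eqF ?expR_gt0.
exists z, (A, ~: (z |: A))%SET, (angle fanS Ssurj x), c; split=> //.
apply: (cell_point_ext cP); first by rewrite kz.
rewrite kz => m zm; rewrite (@angleE _ _ _ fanS _ S Ssurj x m zm) (@cw_exp z _ _ a)//; last first.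
  by move=> j /negPf jz; rewrite /c jz.
rewrite -aE// dotNr opprK -wE /f Q1// lnK ?posrE; last by rewrite -[m in hat x m]Q1.
by rewrite mulrC argE.
Qed.

Lemma complete_toric_TCW : complete_fan Sigma ->
  inhabited (TCW_structure act) /\ (forall K : TCW_structure act, finite_TCW K).
Proof.
move=> cS; pose E e := `[< exists z, chain_face z e >].
(* The face e does not carry z as a component, but determines it as the only index outside [e.1] and
   [e.2]. *)
pose H e : set T :=
  [set t | forall m, (exists2 z, chain_face z e & perp z m) -> t m = 1].
have zc e c : E e -> cube_face e c -> zero_chain c.
  by move=> /asboolP[z ze] ce; exact: (chain_face_zero_chain ze ce).
have H1 e : E e -> face_disjoint e.
  by move=> /asboolP[z ze]; exact: (chain_face_disj ze).
have H2 e : E e -> closed_subgroup (H e) by move=> _; exact: annihilator_subgroup.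
have H3 e : E e -> forall (U : Type) (F : set_system U) (FF : Filter F)
    (s : U -> T) (c : U -> J -> R) (t0 : T) (c0 : J -> R),
    (forall u, cube_face e (c u)) -> cube_face e c0 -> s @ F --> t0 ->
    (forall j, (fun u => c u j) @ F --> c0 j) ->
    (fun u => cell_point (s u) (c u)) @ F --> cell_point t0 c0.
  move=> Ee U F FF s c t0 c0 ce ce0; apply: cell_point_cvg => [u|].
    exact: zc (ce u).
  exact: zc ce0.
have H4 e : E e -> forall (s t : T) c, cube_face e c ->
    cell_point (s * t)%g c = act s (cell_point t c).
  by move=> Ee s t c ce; apply: cell_point_act; exact: zc ce.
have H5 e : E e -> forall (s t : T) c, cube_face e c -> H e (s^-1 * t)%g ->
    cell_point s c = cell_point t c.
  move=> Ee s t c ce Hst; have cP := zc e c Ee ce.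
  apply: (cell_point_ext cP); first by rewrite orb_cell_point.
  move=> m km; rewrite hat_cell_point//; last exact: perp_dualm.
  have /asboolP[z ze] := Ee; congr (_ * _).
  have zm : perp z m.
    by apply: perp_le km; apply: (top_zero_leJ cP); exact: (chain_face_bot0 ze ce).
  have := Hst m (ex_intro2 _ _ z ze zm).
  rewrite -[LHS]/((s m)^-1 * t m) => /(congr1 (fun r => s m * r)).
  by rewrite mulrA mulfV ?torus_neq0// mul1r mulr1.
have H6 e : E e -> forall c, cube_face e c -> ~ open_face e c ->
    exists2 e', E e' & (#|e'.1| < #|e.1|)%N /\
      exists2 c', cube_face e' c' & forall t, cell_point t c = cell_point t c'.
  move=> /asboolP[z ze] c ce neo.
  have [k [e' [ke' lt ex]]] := cell_point_boundary ze ce neo.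
  by exists e'; [apply/asboolP; exists k|split].
have H7 e e' (t t' : T) c c' : E e -> E e' -> open_face e c -> open_face e' c' ->
    cell_point t c = cell_point t' c' -> c = c' /\ H e (t^-1 * t')%g.
  move=> /asboolP[z ze] /asboolP[z' ze'] oe oe' tt.
  have [_ cc tm] := cell_point_inj ze ze' oe oe' tt; split=> // m [k ke km].
  have kz : k = z by rewrite -(open_face_top_zero ke oe) (open_face_top_zero ze oe).
  by rewrite -[LHS]/((t m)^-1 * t' m) tm ?mulVf ?torus_neq0// -kz.
have H8 x : exists e t c, [/\ E e, cube_face e c & x = cell_point t c].
  have [z [e [t [c [ze ce xE]]]]] := cell_point_surj x cS.
  by exists e, t, c; split=> //; apply/asboolP; exists z.
split.
  exact: inhabits (cube_structure (toric_action fanS Sinj Ssurj)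
    (toric_hausdorff fanS Sinj Ssurj) H1 H2 H3 H4 H5 H6 H7 H8).
move=> K; apply: compact_TCW_finite.
exact: cube_space_compact H2 H3 H5 H8.
Qed.

End FanChains.

Lemma fan_index (R : realType) n (Sigma : set (set 'rV[R]_n)) :
  rational_fan Sigma -> exists (J : finType) (S : J -> Sigma),
    [/\ injective S, forall s : Sigma, exists j, S j = s & inhabited J].
Proof.
move=> fanS; have /finite_seqP[s sE] := fan_finite fanS.
have mem (j : seq_sub s) : ssval j \in Sigma by rewrite inE sE; exact: ssvalP.
exists (seq_sub s), (fun j => exist _ (ssval j) (mem j)); split.
- by move=> i j [/val_inj].
- move=> [t tS]; have /= ts : [set` s] t by rewrite -sE; exact: set_mem.
  by exists (SeqSub ts); exact: val_inj.
- have [t] := fan_nonempty fanS; rewrite sE => /= ts.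
  exact: (inhabits (SeqSub ts)).
Qed.

Theorem corollary1p2 (R : realType) (n : nat) (Sigma : set (set 'rV[R]_n)) :
  rational_fan Sigma ->
  (complete_fan Sigma ->
     inhabited (TCW_structure (toric_act Sigma)) /\
     (forall S : TCW_structure (toric_act Sigma), finite_TCW S)) /\
  (exists (Y : topologicalType) (actY : torus R n -> Y -> Y)
      (S : TCW_structure actY),
     finite_TCW S /\ T_homotopy_equivalent (toric_act Sigma) actY).
Proof.
move=> fanS; have [J [S [Sinj Ssurj [j0]]]] := fan_index fanS.
split; first exact: (complete_toric_TCW fanS Sinj Ssurj j0).
have [K Kfin] := nerve_TCW fanS Ssurj j0.
exists (nerve S), (@nerve_act R n Sigma J S), K; split=> //.
exact: (toric_nerve_equivalent fanS Sinj Ssurj j0).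
Qed.
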